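(* There exist universal constants $\bar\varepsilon>0$ and $\eta\in(0,1)$ such that the following holds. Let $\mathbf{u}=(u^1,\dots,u^m)$ be a viscosity solution to $\Delta\mathbf{u}=|\mathbf{u}|^{p-2}\mathbf{u}$ in $B_1$, let $x_0\in B_1(\mathbf{u})\cup\Gamma(\mathbf{u})$, $r>0$ with $B_r(x_0)\subset B_1$, and let $a_0\le b_0$ be real numbers with $b_0-a_0\le\bar\varepsilon r$ such that $$|\mathbf{u}|\le u_0(x_n+b_0)\ \text{ in } B_r(x_0),\qquad u_0(x_n+a_0)\le u^1\ \text{ in } B_r(x_0)\cap\{x_n\ge -a_0\},$$ $$|u^i|\le r^\kappa\left(\frac{b_0-a_0}{r}\right)^{5/8}\ \text{ in } B_r(x_0),\quad i=2,\dots,m.$$ Then there exist $a_1,b_1$ with $a_0\le a_1\le b_1\le b_0$ and $b_1-a_1=(1-\eta)(b_0-a_0)$ such that $$|\mathbf{u}|\le u_0(x_n+b_1)\ \text{ in } B_{\eta r}(x_0),\qquad u_0(x_n+a_1)\le u^1\ \text{ in } B_{\eta r}(x_0)\cap\{x_n\ge -a_1\}.$$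
   Context: Fix integers $n\ge 2$, $m\ge 1$ and $0<p<1$; universal means depending only on $n,m,p$. Set $\kappa:=\frac{2}{2-p}$, $c_p:=[\kappa(\kappa-1)]^{\frac{1}{p-2}}$, $u_0(t):=c_p(\max\{t,0\})^\kappa$. Points of $\mathbb{R}^n$ are $x=(x',x_n)$. For $\mathbf{u}\in C(\Omega;\mathbb{R}^m)$, $\Omega(\mathbf{u}):=\Omega\cap\{|\mathbf{u}|>0\}$ (so $B_1(\mathbf{u})=B_1\cap\{|\mathbf{u}|>0\}$) and $\Gamma(\mathbf{u}):=\Omega\cap\partial\Omega(\mathbf{u})$. Viscosity solution: $\mathbf{u}\in C(\Omega;\mathbb{R}^m)$ is a viscosity solution of $\Delta\mathbf{u}=|\mathbf{u}|^{p-2}\mathbf{u}$ in $\Omega$ if (i) $\Delta u^i=|\mathbf{u}|^{p-2}u^i$ in $\Omega(\mathbf{u})$ for all $i$, and (ii) for every $x_0\in\Gamma(\mathbf{u})$ and every $f\in\mathbb{R}^m$, $\langle\mathbf{u},f\rangle$ cannot be touched from below at $x_0$ by a function $\varphi\in C^1$ with $\varphi(x_0)=0$, $|\nabla\varphi(x_0)|\ne0$, such that on $\{\varphi\ne0\}$, $\varphi\in C^2$ and $\Delta\varphi>\varphi^{p-1}\chi_{\{\varphi>0\}}$. *)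

(* Defs.v *)
From HB Require Import structures.
From mathcomp Require Import all_boot all_order all_algebra.
From mathcomp Require Import all_classical all_reals all_analysis.
Set Implicit Arguments. Unset Strict Implicit. Unset Printing Implicit Defensive.
Import Order.TTheory GRing.Theory Num.Theory.
Import numFieldNormedType.Exports.
Local Open Scope classical_set_scope.
Local Open Scope ring_scope.

Section Defs.
Variable R : realType.

Definition enorm (k : nat) (v : 'rV[R]_k) : R := Num.sqrt (\sum_(i < k) v 0 i ^+ 2).
Definition dotp (k : nat) (v w : 'rV[R]_k) : R := \sum_(i < k) v 0 i * w 0 i.

Definition eball (n : nat) (x0 : 'rV[R]_n) (r : R) : set 'rV[R]_n :=
  [set y | enorm (y - x0) < r].

Definition ebasis (n : nat) (i : 'I_n) : 'rV[R]_n := delta_mx 0 i.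

Definition partial (n : nat) (i : 'I_n) (f : 'rV[R]_n -> R) : 'rV[R]_n -> R :=
  fun x => 'D_(ebasis i) f x.

Definition C1on (n : nat) (U : set 'rV[R]_n) (f : 'rV[R]_n -> R) : Prop :=
  forall x, U x ->
    {for x, continuous f} /\
    forall i : 'I_n, derivable f x (ebasis i) /\ {for x, continuous (partial i f)}.

Definition C2on (n : nat) (U : set 'rV[R]_n) (f : 'rV[R]_n -> R) : Prop :=
  C1on U f /\
  forall x, U x -> forall i j : 'I_n,
    derivable (partial i f) x (ebasis j) /\ {for x, continuous (partial j (partial i f))}.

Definition laplacian (n : nat) (f : 'rV[R]_n -> R) (x : 'rV[R]_n) : R :=
  \sum_(i < n) partial i (partial i f) x.

Definition posset (n m : nat) (Om : set 'rV[R]_n) (u : 'rV[R]_n -> 'rV[R]_m) :=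
  Om `&` [set x | 0 < enorm (u x)].

Definition bdry (n : nat) (A : set 'rV[R]_n) : set 'rV[R]_n :=
  closure A `\` interior A.

Definition freebd (n m : nat) (Om : set 'rV[R]_n) (u : 'rV[R]_n -> 'rV[R]_m) :=
  Om `&` bdry (posset Om u).

Definition kappa (p : R) : R := 2 / (2 - p).
Definition cp (p : R) : R := (kappa p * (kappa p - 1)) `^ (1 / (p - 2)).
Definition u0 (p : R) (t : R) : R := cp p * (Num.max t 0) `^ (kappa p).

Definition posrhs (p : R) (s : R) : R := if 0 < s then s `^ (p - 1) else 0.

Definition touched_below (n : nat) (p : R) (g : 'rV[R]_n -> R) (x0 : 'rV[R]_n) : Prop :=
  exists (phi : 'rV[R]_n -> R) (d : R), 0 < d /\
    C1on (eball x0 d) phi /\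
    phi x0 = 0 /\
    (exists i : 'I_n, partial i phi x0 != 0) /\
    C2on (eball x0 d `&` [set y | phi y != 0]) phi /\
    (forall y, eball x0 d y -> phi y != 0 -> laplacian phi y > posrhs p (phi y)) /\
    (forall y, eball x0 d y -> phi y <= g y) /\
    phi x0 = g x0.

Definition visc_sol (n m : nat) (p : R) (Om : set 'rV[R]_n)
    (u : 'rV[R]_n -> 'rV[R]_m) : Prop :=
  (forall x, Om x -> {for x, continuous u}) /\
  (forall i : 'I_m,
     C2on (posset Om u) (fun x => u x 0 i) /\
     forall x, posset Om u x ->
       laplacian (fun y => u y 0 i) x = (enorm (u x)) `^ (p - 2) * u x 0 i) /\
  (forall x0, freebd Om u x0 -> forall f : 'rV[R]_m,
     ~ touched_below p (fun x => dotp (u x) f) x0).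

End Defs.

(* Main.v *)
(* Only the maximum principle is used. After rescaling to r = 1, fix the point c at
   height 1/4 above x0 and put eps = b0 - a0. The function w = u^1 - u0(x_n + a0) is nonnegative and both w and
   its Laplacian are O(eps) near c, so comparing w(x) - w(Rx), R a coordinate
   reflection, with a quadratic polynomial bounds its oscillation. Hence either w or
   u0(x_n + b0) - u^1 is bounded below by a multiple of eps on a fixed ball around c;
   in the second case the same holds for u0(x_n + b0) - |u|, since |u| - u^1 is of
   order eps^(5/4).

   The gain is carried to x0 by barriers u0(g), where g is x_n plus a constant and plus
   or minus a small multiple of exp(- A |x - c|^2). They are strict sub- or
   supersolutions on the annulus around c: where x_n lies below c the first-order
   term has the right sign, elsewhere g is bounded below and the Laplacian of the
   exponential dominates. They are slid in the x_n direction until the first contact.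

   From below, the barrier is u0(g) + s g with a small s > 0: it remains a strict
   subsolution because t^(p-1) is decreasing, and it now has non-zero gradient on its
   zero set, so that a contact on the free boundary contradicts the viscosity
   condition. The component u^1 may be slightly negative where x_n < - a0, but the
   large potential |u|^(p-2) makes it O(eps^(2+kappa)) there, which is below the
   level of the barrier.

   From above, the exponent of u0 is increased to kappa (1 + nu); a contact at a zero of
   u would then force u to grow slower than |x|^kappa there, contradicting
   non-degeneracy. Finally nu is taken small and absorbed in a shift. *)
Require Import Defs.
From HB Require Import structures.
From mathcomp Require Import all_boot all_order all_algebra.
From mathcomp Require Import ring lra.
From mathcomp Require Import all_classical all_reals all_analysis.
Import Order.TTheory GRing.Theory Num.Theory.
Import numFieldNormedType.Exports.
Local Open Scope classical_set_scope.
Local Open Scope ring_scope.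

Set Implicit Arguments.
Unset Strict Implicit.
Unset Printing Implicit Defensive.

(** * Second derivatives along lines *)

(** After rescaling, the height [b] is nonnegative but has no upper bound, since the ball may lie
    far inside the positivity set. Gains are therefore measured in units of [du0 p h * eps], where
    [h] is the argument of the lower profile at c; the monotonicity of [du0] and of [du0 p t / t]
    makes every comparison uniform in [h]. The constants are fixed in this order: the radius of the
    ball around c and the rate A depend on n only, eta is a fixed multiple of the gain of the
    exponential, and the smallness of eps comes last. The exponent nu depends also on eps and b;
    this is harmless because the resulting bound is converted back to the exponent kappa before it
    leaves the comparison. The two comparisons differ because the viscosity condition forbids
    contact from below only, and only for test functions with non-zero gradient; at a zero of u
    nothing is assumed about contact from above. Contacts are tested through second derivatives
    along coordinate lines at one point, so the singularity of the barriers on their zero level does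
    no harm elsewhere. *)

Lemma is_derive_line {R : realType} {V : normedModType R} (f : V -> R)
    (x v : V) (l : R) :
  is_derive x v f l <-> is_derive (0 : R) 1 (fun t => f (x + t *: v)) l.
Proof.
have E : (fun h : R => h^-1 *: ((f \o shift x) (h *: v) - f x)) =
  (fun h : R => h^-1 *: (((fun t => f (x + t *: v)) \o shift (0 : R)) (h *: (1 : R))
                          - f (x + (0 : R) *: v))).
  apply/funext => h /=.
  by rewrite scale0r !addr0 [h *: 1]mulr1 (addrC x).
by split=> -[d1 d2]; split; move: d1 d2; rewrite /derivable /derive E.
Qed.

Lemma eq_is_derive {R : realType} {V W : normedModType R} (f g : V -> W)
    (x v : V) (l : W) :
  f =1 g -> is_derive x v f l -> is_derive x v g l.
Proof. by move=> /funext ->. Qed.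

Lemma is_derive_line_at {R : realType} {V : normedModType R} (f : V -> R)
    (x v : V) (t l : R) :
  is_derive (x + t *: v) v f l <-> is_derive t 1 (fun t => f (x + t *: v)) l.
Proof.
split=> /is_derive_line H; apply/is_derive_line; apply: eq_is_derive H => s;
  by rewrite [s *: 1]mulr1 scalerDl addrA.
Qed.

Lemma is_derive_compR {R : realType} {V : normedModType R} (F : R -> R)
    (g : V -> R) (x v : V) (dF dg : R) :
  is_derive (g x) 1 F dF -> is_derive x v g dg ->
  is_derive x v (fun y => F (g y)) (dF * dg).
Proof.
move=> hF /is_derive_line hg; apply/is_derive_line.
have := @is_derive1_comp R F (fun t => g (x + t *: v)) 0 dF dg.
by apply => //; rewrite scale0r addr0.
Qed.

Section PointwiseDerive.
Context {R : realType} {V : normedModType R}.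
Implicit Types (f g : V -> R) (x v : V) (a b k : R).

Lemma is_derive_add f g x v a b : is_derive x v f a -> is_derive x v g b ->
  is_derive x v (fun y => f y + g y) (a + b).
Proof. exact: is_deriveD. Qed.

Lemma is_derive_sub f g x v a b : is_derive x v f a -> is_derive x v g b ->
  is_derive x v (fun y => f y - g y) (a - b).
Proof. exact: is_deriveB. Qed.

Lemma is_derive_scale k f x v a : is_derive x v f a ->
  is_derive x v (fun y => k * f y) (k * a).
Proof. exact: is_deriveZ. Qed.

Lemma is_derive_mul f g x v a b : is_derive x v f a -> is_derive x v g b ->
  is_derive x v (fun y => f y * g y) (a * g x + f x * b).
Proof.
move=> hf hg; have h := is_deriveM hf hg.
by apply: is_derive_eq h _; rewrite /GRing.scale /= addrC (mulrC (g x)).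
Qed.

Lemma is_derive_const k x v : is_derive x v (fun _ => k) 0.
Proof. exact: is_derive_cst. Qed.

End PointwiseDerive.

Lemma is_derive_idR {R : realType} (t : R) : is_derive t 1 (fun s : R => s) 1.
Proof. exact: is_derive_id. Qed.

Lemma is_derive_sqrR {R : realType} (t : R) : is_derive t 1 (fun s : R => s ^+ 2) (2 * t).
Proof.
have h := is_derive_mul (is_derive_idR t) (is_derive_idR t).
have -> : (fun s : R => s ^+ 2) = fun s => s * s by apply/funext => s; rewrite expr2.
by apply: is_derive_eq h _; ring.
Qed.

(* [l] is the second derivative of [f] at [x] in direction [v]. The first derivative
   is an explicit witness, so that the notion is stable under sums and under
   substitutions preserving lines, with no comparison of partial derivatives. *)
Definition has_d2 {R : realType} {V : normedModType R} (f : V -> R)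
    (x v : V) (l : R) : Prop :=
  exists f1 : R -> R,
    (\forall t \near (0 : R),
       is_derive (t : R) 1 (fun t : R => f (x + t *: v)) (f1 t)) /\
    is_derive (0 : R) 1 f1 l.

Section HasD2.
Context {R : realType} {V : normedModType R}.
Implicit Types (f g : V -> R) (x v : V) (l m : R).

Lemma has_d2D f g x v l m :
  has_d2 f x v l -> has_d2 g x v m -> has_d2 (fun y => f y + g y) x v (l + m).
Proof.
move=> [f1 [hf hf1]] [g1 [hg hg1]]; exists (fun t => f1 t + g1 t).
split; last exact: is_deriveD.
by near=> t; apply: is_deriveD; near: t.
Unshelve. all: by end_near. Qed.

Lemma has_d2Z (k : R) f x v l :
  has_d2 f x v l -> has_d2 (fun y => k * f y) x v (k * l).
Proof.
move=> [f1 [hf hf1]]; exists (fun t => k * f1 t).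
split; last exact: is_deriveZ.
by near=> t; apply: is_deriveZ; near: t.
Unshelve. all: by end_near. Qed.

Lemma has_d2B f g x v l m :
  has_d2 f x v l -> has_d2 g x v m -> has_d2 (fun y => f y - g y) x v (l - m).
Proof.
move=> hf /(has_d2Z (-1)) hg; have := has_d2D hf hg.
by rewrite mulN1r; congr has_d2; apply/funext => y; rewrite mulN1r.
Qed.

(** Serves the reflections, which reverse one coordinate direction and must leave second derivatives
    unchanged. *)
Lemma has_d2N f x v l : has_d2 f x v l -> has_d2 f x (- v) l.
Proof.
move=> [f1 [hf hf1]]; exists (fun t => - f1 (- t)).
have dN (t : R) : is_derive t (1 : R) (fun t : R => - t) (-1).
  exact: is_deriveN.
split.
- have hf' : \forall t \near (0 : R),
      is_derive (- t : R) 1 (fun t : R => f (x + t *: v)) (f1 (- t)).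
    have hc : (fun t : R => - t) @ (0 : R) --> (0 : R).
      by rewrite -[X in _ --> X]oppr0; exact: opp_continuous.
    exact: hc hf.
  near=> t.
  have ht : is_derive (- t : R) 1 (fun t : R => f (x + t *: v)) (f1 (- t)) by near: t.
  have /= := @is_derive1_comp R (fun t => f (x + t *: v)) (fun t => - t) t _ _ ht (dN t).
  rewrite mulrN1; apply: eq_is_derive => s /=.
  by rewrite scaleNr scalerN.
- have h : is_derive (- (0 : R)) 1 f1 l by rewrite oppr0.
  have := is_deriveN (@is_derive1_comp R f1 (fun t => - t) 0 _ _ h (dN 0)).
  by rewrite mulrN1 opprK.
Unshelve. all: by end_near. Qed.

(** The first derivative vanishes at the maximum; were [l] positive, it would be positive just to
    the right of 0, and the mean value theorem would push [f] above its maximum. *)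
Lemma has_d2_max f x v l :
  has_d2 f x v l -> (\forall t \near (0 : R), f (x + t *: v) <= f x) -> l <= 0.
Proof.
move=> [f1 [hf hf1]] hmax; rewrite leNgt; apply/negP => l0.
pose g t := f (x + t *: v).
have g0 : g 0 = f x by rewrite /g scale0r addr0.
have [d1 /= d10 hd1] : nbhs_ball (0 : R) [set t : R | is_derive t 1 g (f1 t) /\ g t <= g 0].
  apply/nbhs_ballP; rewrite g0.
  by near=> t; split; near: t.
have inb (t : R) : t \in `](- d1), d1[ -> is_derive t 1 g (f1 t) /\ g t <= g 0.
  rewrite in_itv /= => /andP[t1 t2]; apply: hd1.
  by rewrite /ball /= sub0r normrN ltr_norml t1.
have f10 : f1 0 = 0.
  have h0 : (0 : R) \in `](- d1), d1[ by rewrite in_itv /= oppr_lt0 d10.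
  have h1 : is_derive (0 : R) 1 g 0.
    apply: (@derive1_at_max _ g (- d1) d1 0) => //; first by lra.
      by move=> t /inb [[]].
    by move=> t /inb [].
  have [h2 _] := inb 0 h0.
  by rewrite -(@derive_val _ _ _ _ _ _ _ h2) (@derive_val _ _ _ _ _ _ _ h1).
have : \forall t \near (0 : R)^'+, 0 < f1 t.
  have [df1 vf1] := hf1.
  have hc : (fun h => h^-1 *: ((f1 \o shift 0) (h *: 1) - f1 0)) @ (0 : R)^' --> l.
    by rewrite -vf1; exact: df1.
  have : \forall h \near (0 : R)^', 0 < h^-1 *: ((f1 \o shift 0) (h *: 1) - f1 0).
    by apply: (cvgr_gt l) => //; exact: hc.
  rewrite near_withinE => h1.
  rewrite near_withinE; near=> t => t0.
  have : 0 < t^-1 *: ((f1 \o shift 0) (t *: 1) - f1 0).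
    by apply: (near h1 t) => //; rewrite gt_eqF.
  by rewrite /= addr0 f10 subr0 [t *: 1]mulr1 pmulr_rgt0 ?invr_gt0.
rewrite near_withinE => /nbhs_ballP [d2 /= d20 hd2].
pose s := Num.min d1 d2 / 2.
have s0 : 0 < s by rewrite divr_gt0 // lt_min d10.
have sd : s < Num.min d1 d2 by rewrite ltr_pdivrMr // ltr_pMr ?lt_min ?d10 //; lra.
have [sd1 sd2] : s < d1 /\ s < d2 by move: sd; rewrite lt_min => /andP.
have ins (t : R) : 0 <= t <= s -> t \in `](- d1), d1[.
  by move=> /andP[t0 t1]; rewrite in_itv /=; apply/andP; split; lra.
have [] := @MVT R g f1 0 s s0.
- move=> t; rewrite in_itv /= => /andP[t0 t1].
  by have /ins /inb [] : 0 <= t <= s by rewrite (ltW t0) (ltW t1).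
- apply: derivable_within_continuous => t; rewrite in_itv /= => /ins /inb [].
  by case.
- move=> c; rewrite in_itv /= => /andP[c0 cs] e.
  have /ins /inb [_] : 0 <= s <= s by rewrite (ltW s0) lexx.
  rewrite -subr_le0 e; apply/negP; rewrite -ltNge subr0.
  rewrite mulr_gt0 //; apply: hd2 => //=.
  by rewrite /ball /= sub0r normrN ger0_norm ?ltW // (lt_trans cs).
Unshelve. all: by end_near. Qed.

Lemma has_d2_min f x v l :
  has_d2 f x v l -> (\forall t \near (0 : R), f x <= f (x + t *: v)) -> 0 <= l.
Proof.
move=> /(has_d2Z (-1)) h hm; rewrite -oppr_le0 -mulN1r; apply: has_d2_max h _.
by near=> t; rewrite ler_nM2l //; near: t.
Unshelve. all: by end_near. Qed.

End HasD2.

(** * The one-dimensional profile *)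

(* The truncation is needed because [powR] takes the value [1] at negative bases. *)
Definition ppow {R : realType} (a t : R) : R := Num.max t 0 `^ a.

Section PosPower.
Context {R : realType}.
Implicit Types a s t : R.

Lemma ppow_le0 a t : a != 0 -> t <= 0 -> ppow a t = 0.
Proof. by move=> a0 t0; rewrite /ppow max_r // powR0. Qed.

Lemma ppow_gt0E a t : 0 < t -> ppow a t = t `^ a.
Proof. by move=> t0; rewrite /ppow max_l // ltW. Qed.

Lemma ppow_ge0 a t : 0 <= ppow a t.
Proof. exact: powR_ge0. Qed.

Lemma ppow_gt0 a t : 0 < t -> 0 < ppow a t.
Proof. by move=> t0; rewrite ppow_gt0E // powR_gt0. Qed.

Lemma ppow_homo a s t : 0 <= a -> s <= t -> ppow a s <= ppow a t.
Proof.
have m0 (x : R) : Num.max x 0 \is Num.nneg by rewrite nnegrE le_max lexx orbT.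
move=> a0 st; apply: ge0_ler_powR => //.
by rewrite ge_max !le_max st lexx !orbT.
Qed.

Lemma ppow_ltr a s t : 0 < a -> 0 < t -> s < t -> ppow a s < ppow a t.
Proof.
have m0 (x : R) : Num.max x 0 \is Num.nneg by rewrite nnegrE le_max lexx orbT.
move=> a0 t0 st; apply: gt0_ltr_powR => //.
by rewrite gt_max !lt_max st t0.
Qed.

Lemma near_ppow_pos a t : 0 < t -> \forall s \near t, s `^ a = ppow a s.
Proof.
move=> t0; near=> s; rewrite ppow_gt0E //; near: s; exact: lt_nbhsr.
Unshelve. all: by end_near. Qed.

Lemma near_ppow_neg a t : a != 0 -> t < 0 -> \forall s \near t, 0 = ppow a s.
Proof.
move=> a0 t0; near=> s; rewrite ppow_le0 // ltW //; near: s; exact: lt_nbhsl.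
Unshelve. all: by end_near. Qed.

(** For negative [t] both sides vanish; on the right this needs [a - 1 != 0], because 0 to the power
    0 is 1. *)
Lemma is_derive_ppow_neq0 a t : a != 0 -> a != 1 -> t != 0 ->
  is_derive t 1 (ppow a) (a * ppow (a - 1) t).
Proof.
move=> a0 a1; rewrite neq_lt => /orP[t0|t0].
- rewrite (@ppow_le0 (a - 1)) ?subr_eq0 // ?ltW // mulr0.
  by apply: (near_eq_is_derive (near_ppow_neg a0 t0)); exact: is_derive_cst.
- rewrite (ppow_gt0E _ t0).
  by apply: (near_eq_is_derive (near_ppow_pos a t0)); exact: is_derive1_powR.
Qed.

Lemma ppow_continuous_neq0 a t : a != 0 -> t != 0 -> {for t, continuous (ppow a)}.
Proof.
move=> a0 t0; suff h : derivable (ppow a) t 1.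
  exact/differentiable_continuous/derivable1_diffP.
move: t0; rewrite neq_lt => /orP[t0|t0].
- by apply: (near_eq_derivable (near_ppow_neg a0 t0)); exact: derivable_cst.
- apply: (near_eq_derivable (near_ppow_pos a t0)).
  by apply: derivable_powR; rewrite in_itv /= andbT.
Qed.

Lemma ppow_continuous a : 0 < a -> continuous (ppow a).
Proof.
move=> a0 t; have [->|t0] := eqVneq t 0; last first.
  by apply: (@ppow_continuous_neq0 a t) => //; rewrite gt_eqF.
apply/cvgrPdist_lt => e e0; near=> s.
rewrite (ppow_le0 (t := 0)) ?gt_eqF // sub0r normrN ger0_norm ?ppow_ge0 //.
have -> : e = ppow a (e `^ a^-1).
  by rewrite ppow_gt0E ?powR_gt0 // -powRrM mulVf ?gt_eqF // powRr1 // ltW.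
apply: ppow_ltr; rewrite ?powR_gt0 //.
by near: s; apply: lt_nbhsl; rewrite powR_gt0.
Unshelve. all: by end_near. Qed.

Lemma is_derive_ppow a t : 1 < a -> is_derive t 1 (ppow a) (a * ppow (a - 1) t).
Proof.
move=> a1; have a0 : 0 < a by rewrite (lt_trans ltr01).
have a10 : 0 < a - 1 by rewrite subr_gt0.
have [->|t0] := eqVneq t 0; last first.
  by apply: is_derive_ppow_neq0 => //; rewrite gt_eqF.
rewrite (@ppow_le0 (a - 1)) ?gt_eqF // mulr0.
(* At 0 the difference quotient is [ppow (a - 1)] itself, which tends to 0. *)
have H : (fun h : R => h^-1 *: ((ppow a \o shift 0) (h *: 1) - ppow a 0)) @ (0:R)^' --> (0 : R).
  have H0 : ppow (a - 1) @ (0:R)^' --> (0 : R).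
    rewrite -[X in _ --> X](@ppow_le0 (a - 1) 0) ?gt_eqF //.
    by apply: cvg_within_filter; apply: (ppow_continuous a10).
  apply: cvg_trans H0; apply: near_eq_cvg; near=> h.
  have h0 : h != 0 by near: h; exact: nbhs_dnbhs_neq.
  rewrite /= addr0 [h *: 1]mulr1 (@ppow_le0 a 0) ?gt_eqF // subr0.
  move: h0; rewrite neq_lt => /orP[h0|h0].
    by rewrite !ppow_le0 ?scaler0 ?gt_eqF // ltW.
  rewrite !ppow_gt0E // -(mulr_powRB1 (ltW h0) a0) /GRing.scale /=.
  by rewrite mulKf // gt_eqF.
split; first by apply/cvg_ex; exists 0.
by apply/cvg_lim.
Unshelve. all: by end_near. Qed.

End PosPower.

Lemma powR_npos_le {R : realType} (a x y : R) : a <= 0 -> 0 < x -> x <= y ->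
  y `^ a <= x `^ a.
Proof.
move=> a0 x0 xy; have y0 := lt_le_trans x0 xy.
rewrite -(opprK a) [_ `^ - - a]powRN [X in _ <= X]powRN lef_pV2 ?posrE ?powR_gt0 //.
by apply: ge0_ler_powR; rewrite ?nnegrE ?oppr_ge0 // ltW.
Qed.

Definition du0 {R : realType} (p t : R) : R := cp p * kappa p * ppow (kappa p - 1) t.

Section U0.
Context {R : realType} (p : R) (hp : 0 < p < 1).
Implicit Types s t : R.
Local Notation k := (kappa p).

Lemma kappaM : k * (2 - p) = 2.
Proof. by have /andP[? ?] := hp; rewrite /kappa divfK // gt_eqF //; lra. Qed.

Lemma kappa_gt1 : 1 < k.
Proof.
by have /andP[p0 p1] := hp; rewrite /kappa ltr_pdivlMr; lra.
Qed.

Lemma kappa_lt2 : k < 2.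
Proof.
by have /andP[p0 p1] := hp; rewrite /kappa ltr_pdivrMr; lra.
Qed.

Lemma kappaMpB2 : k * (p - 2) = - 2.
Proof. by have := kappaM; lra. Qed.

Lemma cp_gt0 : 0 < cp p.
Proof.
by have := kappa_gt1; move=> k1; apply: powR_gt0; rewrite mulr_gt0 //; lra.
Qed.

Lemma cp_powB2 : cp p `^ (p - 2) = k * (k - 1).
Proof.
have k1 := kappa_gt1; have /andP[p0 p1] := hp.
rewrite /cp -powRrM div1r mulVf ?powRr1 //; first by rewrite mulr_ge0 //; lra.
by rewrite lt_eqF //; lra.
Qed.

Lemma u0E t : u0 p t = cp p * ppow k t. Proof. by []. Qed.

Lemma u0_le0 t : t <= 0 -> u0 p t = 0.
Proof.
by move=> t0; rewrite u0E ppow_le0 ?mulr0 // gt_eqF // (lt_trans ltr01 kappa_gt1).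
Qed.

Lemma u0_gt0 t : 0 < t -> 0 < u0 p t.
Proof. by move=> t0; rewrite u0E mulr_gt0 ?cp_gt0 ?ppow_gt0. Qed.

Lemma u0_ge0 t : 0 <= u0 p t.
Proof. by rewrite u0E mulr_ge0 ?ppow_ge0 // ltW // cp_gt0. Qed.

Lemma u0_homo s t : s <= t -> u0 p s <= u0 p t.
Proof.
move=> st; rewrite !u0E ler_wpM2l ?(ltW cp_gt0) // ppow_homo //.
by rewrite ltW // (lt_trans ltr01 kappa_gt1).
Qed.

Lemma is_derive_u0 t : is_derive t 1 (u0 p) (du0 p t).
Proof.
have := is_deriveZ (cp p) (is_derive_ppow t kappa_gt1).
by rewrite /du0 -mulrA.
Qed.

Lemma u0_continuous : continuous (u0 p).
Proof.
move=> t; have [h _] := is_derive_u0 t.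
exact/differentiable_continuous/derivable1_diffP.
Qed.

(** The left side is the second derivative of the profile: kappa matches the exponents, since kappa
    (p - 1) = kappa - 2, and [cp] matches the constants. *)
Lemma u0_ode t : 0 < t ->
  cp p * (k * (k - 1) * ppow (k - 2) t) = u0 p t `^ (p - 1).
Proof.
move=> t0; rewrite u0E !ppow_gt0E // powRM ?powR_ge0 ?(ltW cp_gt0) // -powRrM.
have -> : k * (p - 1) = k - 2 by have := kappaM; lra.
have -> : p - 1 = 1 + (p - 2) by lra.
rewrite (@powRD _ (cp p)) ?powRr1 ?cp_powB2 ?(ltW cp_gt0) //; last first.
  by rewrite (gt_eqF cp_gt0) implybT.
by rewrite !mulrA.
Qed.

(** Along the profile the potential is an inverse square of the height. This gives its size in a
    slab of width eps and its variation between two nearby heights. *)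
Lemma u0_powB2 t : 0 < t -> u0 p t `^ (p - 2) = k * (k - 1) / t ^+ 2.
Proof.
move=> t0; rewrite u0E ppow_gt0E // powRM ?powR_ge0 ?(ltW cp_gt0) // -powRrM.
by rewrite kappaMpB2 cp_powB2 powRN powR_mulrn // ltW.
Qed.

Lemma du0_ge0 t : 0 <= du0 p t.
Proof.
rewrite /du0 mulr_ge0 ?ppow_ge0 // mulr_ge0 // ltW ?cp_gt0 //.
by rewrite (lt_trans ltr01 kappa_gt1).
Qed.

Lemma du0_gt0 t : 0 < t -> 0 < du0 p t.
Proof.
move=> t0; rewrite /du0 mulr_gt0 ?ppow_gt0 // mulr_gt0 ?cp_gt0 //.
by rewrite (lt_trans ltr01 kappa_gt1).
Qed.

Lemma du0_homo s t : s <= t -> du0 p s <= du0 p t.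
Proof.
move=> st; rewrite /du0 ler_wpM2l ?ppow_homo //.
  by rewrite mulr_ge0 // ltW ?cp_gt0 // (lt_trans ltr01 kappa_gt1).
by rewrite subr_ge0 ltW // kappa_gt1.
Qed.

(** The quotient of [du0 p t] by [t] decreases because kappa - 1 < 1. Together with the monotonicity
    of [du0] it controls the slope on comparable heights, however large they are. *)
Lemma du0_ratio s t : 0 <= s -> s <= t -> s * du0 p t <= t * du0 p s.
Proof.
move=> s0 st; have k1 := kappa_gt1; have k2 := kappa_lt2.
move: s0; rewrite le_eqVlt => /orP[/eqP s0|s0].
  by rewrite -s0 in st *; rewrite mul0r mulr_ge0 // ?du0_ge0.
have t0 : 0 < t by rewrite (lt_le_trans s0).
rewrite /du0 !ppow_gt0E // [leLHS]mulrCA [leRHS]mulrCA ler_wpM2l //.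
  by rewrite mulr_ge0 // ltW ?cp_gt0 // (lt_trans ltr01 kappa_gt1).
have -> : t = t / s * s by rewrite divfK // gt_eqF.
rewrite powRM ?divr_ge0 // ?(ltW t0) ?(ltW s0) // mulrCA -[leRHS]mulrA.
rewrite ler_wpM2r ?mulr_ge0 ?powR_ge0 // ?(ltW s0) //.
by apply: ler1_powR; rewrite ?ler_pdivlMr ?mul1r //; lra.
Qed.

Lemma u0_incr_ge s t : s <= t -> du0 p s * (t - s) <= u0 p t - u0 p s.
Proof.
move=> st; have [|c] := MVT_segment st (fun x _ => is_derive_u0 x).
  by apply: continuous_subspaceT; exact: u0_continuous.
rewrite in_itv /= => /andP[sc ct] ->.
by rewrite ler_wpM2r ?subr_ge0 // du0_homo.
Qed.

Lemma u0_incr_le s t : s <= t -> u0 p t - u0 p s <= du0 p t * (t - s).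
Proof.
move=> st; have [|c] := MVT_segment st (fun x _ => is_derive_u0 x).
  by apply: continuous_subspaceT; exact: u0_continuous.
rewrite in_itv /= => /andP[sc ct] ->.
by rewrite ler_wpM2r ?subr_ge0 // du0_homo.
Qed.

Lemma u0_le_du0 t : 0 <= t -> u0 p t <= t * du0 p t.
Proof. by move=> /u0_incr_le; rewrite (u0_le0 (lexx 0)) !subr0 mulrC. Qed.

Lemma du0_double h t : 0 <= h -> t <= 2 * h -> du0 p t <= 2 * du0 p h.
Proof.
move=> h0 th; apply: (le_trans (du0_homo th)).
move: (h0); rewrite le_eqVlt => /orP[/eqP <-|hp0].
  by rewrite mulr0 mulr_natl mulr2n lerDl du0_ge0.
have h2 : h <= 2 * h by rewrite mulr_natl mulr2n lerDl.
by rewrite -(ler_pM2l hp0) [leRHS]mulrCA [leRHS]mulrA; exact: du0_ratio.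
Qed.

Lemma u0M r t : 0 < r -> u0 p (r * t) = r `^ k * u0 p t.
Proof.
move=> r0; have k0 : k != 0 by rewrite gt_eqF // (lt_trans ltr01 kappa_gt1).
have [t0|t0] := lerP t 0.
  by rewrite !u0_le0 ?mulr0 // pmulr_rle0.
rewrite !u0E !ppow_gt0E ?mulr_gt0 // powRM ?(ltW r0) ?(ltW t0) //; ring.
Qed.

End U0.

(** * Euclidean balls and extrema *)

(** The squared distance is a polynomial, with exact second derivatives everywhere, unlike [enorm];
    the ambient norm of row vectors is the sup norm and plays a separate part through boxes. *)
Definition sqd {R : realType} {n : nat} (c x : 'rV[R]_n) : R :=
  \sum_(i < n) (x 0 i - c 0 i) ^+ 2.

Lemma continuous_bigsum {R : realType} (T : topologicalType) (I : Type) (s : seq I)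
    (f : I -> T -> R) (x : T) :
  (forall i, {for x, continuous (f i)}) ->
  {for x, continuous (fun y => \sum_(i <- s) f i y)}.
Proof.
move=> cf; elim: s => [|i s IH].
  have -> : (fun y => \sum_(i <- [::]) f i y) = cst 0.
    by apply/funext => y; rewrite big_nil.
  exact: cst_continuous.
have -> : (fun y => \sum_(j <- i :: s) f j y) =
    (fun y => f i y + \sum_(j <- s) f j y).
  by apply/funext => y; rewrite big_cons.
exact: (continuousD (cf i) IH).
Qed.

Lemma continuous_sqr {R : realType} (T : topologicalType) (f : T -> R) (x : T) :
  {for x, continuous f} -> {for x, continuous (fun y => f y ^+ 2)}.
Proof. by move=> cf; exact: (continuousM cf cf). Qed.

Section Euclid.
Context {R : realType} {n : nat}.
Implicit Types (c x y z v w : 'rV[R]_n) (r t : R).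

Lemma sqd_ge0 c x : 0 <= sqd c x.
Proof. by apply: sumr_ge0 => i _; exact: sqr_ge0. Qed.

Lemma sqdxx c : sqd c c = 0.
Proof. by rewrite /sqd big1 // => i _; rewrite subrr expr0n. Qed.

Lemma sqdC c x : sqd c x = sqd x c.
Proof. by apply: eq_bigr => i _; rewrite -sqrrN opprB. Qed.

Lemma coord_sqd c x (i : 'I_n) : (x 0 i - c 0 i) ^+ 2 <= sqd c x.
Proof.
rewrite /sqd (bigD1 i) //= lerDl; apply: sumr_ge0 => j _; exact: sqr_ge0.
Qed.

Lemma coord_sqd_lt c x (i : 'I_n) r :
  0 < r -> sqd c x < r ^+ 2 -> `|x 0 i - c 0 i| < r.
Proof.
move=> r0 /(le_lt_trans (coord_sqd c x i)).
by rewrite -real_normK ?num_real // ltr_pXn2r // ?nnegrE // ltW.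
Qed.

Lemma coord_sqd_le c x (i : 'I_n) r :
  0 <= r -> sqd c x <= r ^+ 2 -> `|x 0 i - c 0 i| <= r.
Proof.
move=> r0 /(le_trans (coord_sqd c x i)).
by rewrite -real_normK ?num_real // ler_pXn2r // ?nnegrE.
Qed.

Lemma enorm_ge0 v : 0 <= enorm v. Proof. exact: sqrtr_ge0. Qed.

Lemma sqr_enorm v : enorm v ^+ 2 = \sum_(i < n) v 0 i ^+ 2.
Proof. by rewrite sqr_sqrtr // sumr_ge0 // => i _; exact: sqr_ge0. Qed.

Lemma sqd0 v : sqd 0 v = enorm v ^+ 2.
Proof. by rewrite sqr_enorm; apply: eq_bigr => i _; rewrite mxE subr0. Qed.

Lemma eballE c x r : 0 <= r -> eball c r x <-> sqd c x < r ^+ 2.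
Proof.
move=> r0; rewrite /eball /=.
have -> : sqd c x = enorm (x - c) ^+ 2.
  by rewrite sqr_enorm; apply: eq_bigr => i _; rewrite !mxE.
by rewrite ltr_pXn2r // nnegrE enorm_ge0.
Qed.

Lemma coord_enorm v (i : 'I_n) : `|v 0 i| <= enorm v.
Proof.
have /coord_sqd_le : sqd 0 v <= enorm v ^+ 2 by rewrite sqd0.
by move=> /(_ i (enorm_ge0 v)); rewrite mxE subr0.
Qed.

Lemma enorm_eq0 v : enorm v = 0 -> v = 0.
Proof.
move=> v0; apply/rowP => i; rewrite mxE; apply/eqP.
by rewrite -normr_le0 -v0 coord_enorm.
Qed.

Lemma enormZ t v : enorm (t *: v) = `|t| * enorm v.
Proof.
rewrite /enorm -sqrtr_sqr -sqrtrM ?sqr_ge0 //; congr Num.sqrt.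
by rewrite mulr_sumr; apply: eq_bigr => i _; rewrite mxE exprMn.
Qed.

(** Cauchy-Schwarz: [2 * enorm v] times the difference of the two sides is the squared length of
    [v - enorm v *: w]. *)
Lemma dotp_unit_le v w : enorm w = 1 -> dotp v w <= enorm v.
Proof.
move=> w1; have [v0|v0] := eqVneq (enorm v) 0.
  rewrite v0 (enorm_eq0 v0) /dotp big1 // => i _; by rewrite mxE mul0r.
have vp : 0 < enorm v by rewrite lt_def v0 enorm_ge0.
rewrite -(@ler_pM2l _ (2 * enorm v)) ?mulr_gt0 // -subr_ge0.
have -> : 2 * enorm v * enorm v - 2 * enorm v * dotp v w =
    \sum_(i < n) (v 0 i - enorm v * w 0 i) ^+ 2.
  transitivity (enorm v ^+ 2 + enorm v ^+ 2 * enorm w ^+ 2 - 2 * enorm v * dotp v w).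
    by rewrite w1; ring.
  rewrite {1}sqr_enorm [enorm w ^+ 2]sqr_enorm /dotp !mulr_sumr -big_split /=.
  by rewrite -sumrB; apply: eq_bigr => i _; ring.
by apply: sumr_ge0 => i _; exact: sqr_ge0.
Qed.

Lemma dotp_normalize v : 0 < enorm v -> dotp v ((enorm v)^-1 *: v) = enorm v.
Proof.
move=> v0; rewrite /dotp.
transitivity ((enorm v)^-1 * enorm v ^+ 2).
  by rewrite sqr_enorm mulr_sumr; apply: eq_bigr => i _; rewrite mxE; ring.
by rewrite expr2 mulKf // gt_eqF.
Qed.

Lemma coord_cont (i : 'I_n) x : {for x, continuous (fun y : 'rV[R]_n => y 0 i)}.
Proof. exact: coord_continuous. Qed.

Lemma sqd_cont c x : {for x, continuous (sqd c)}.
Proof.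
apply: continuous_bigsum => i; apply: continuous_sqr.
apply: (continuousB (@coord_cont i x)); exact: cst_continuous.
Qed.

Lemma enorm_cont x : {for x, continuous (@enorm R n)}.
Proof.
apply: (@continuous_comp _ _ _ (fun v : 'rV[R]_n => \sum_(i < n) v 0 i ^+ 2) Num.sqrt).
  by apply: continuous_bigsum => i; apply: continuous_sqr; exact: coord_cont.
exact: sqrt_continuous.
Qed.

Lemma near_sqd_lt c x r : sqd c x < r -> \forall y \near x, sqd c y < r.
Proof. by move=> h; apply: (@cvgr_lt _ _ _ _ _ _ (@sqd_cont c x) _ h). Qed.

Lemma near_sqd_gt c x r : r < sqd c x -> \forall y \near x, r < sqd c y.
Proof. by move=> h; apply: (@cvgr_gt _ _ _ _ _ _ (@sqd_cont c x) _ h). Qed.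

Lemma near_eball c x r : eball c r x -> \forall y \near x, eball c r y.
Proof.
move=> h; have r0 : 0 <= r by rewrite ltW // (le_lt_trans _ h) ?enorm_ge0.
move/(eballE _ _ r0): h => /near_sqd_lt h.
by near=> y; apply/eballE => //; near: y.
Unshelve. all: by end_near. Qed.

Lemma closed_sqd c r1 r2 : closed [set x | r1 <= sqd c x <= r2].
Proof.
have -> : [set x | r1 <= sqd c x <= r2] =
    sqd c @^-1` [set y | r1 <= y] `&` sqd c @^-1` [set y | y <= r2].
  by apply/seteqP; split => x /=; [move=> /andP | move=> [-> ->]].
apply: closedI; apply: closed_comp.
- by move=> x _; exact: sqd_cont.
- exact: closed_ge.
- by move=> x _; exact: sqd_cont.
- exact: closed_le.
Qed.

Lemma compact_sqd c r1 r2 : compact [set x | r1 <= sqd c x <= r2].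
Proof.
apply: bounded_closed_compact; last exact: closed_sqd.
rewrite /bounded_set /= /bounded_near; near=> M => x /= /andP[_ xr].
have M0 : 0 <= M by near: M; apply: nbhs_pinfty_ge; rewrite num_real.
rewrite [leLHS]/Num.norm /= mx_normrE; apply: bigmax_le => // -[i j] _ /=.
rewrite (ord1 i) -(subrK (c 0 j) (x 0 j)) (le_trans (ler_normD _ _)) //.
have h1 : `|x 0 j - c 0 j| <= 1 + r2.
  have := le_trans (coord_sqd c x j) xr.
  rewrite -real_normK ?num_real //; have := normr_ge0 (x 0 j - c 0 j).
  move: `|_| => s s0 h; have [s1|s1] := lerP s 1; first by nra.
  by nra.
have h2 : `|c 0 j| <= enorm c by exact: coord_enorm.
rewrite (le_trans (lerD h1 h2)) //; near: M; exact: nbhs_pinfty_ge.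
Unshelve. all: by end_near. Qed.

Lemma sqd_line c x (j : 'I_n) t :
  sqd c (x + t *: ebasis R j) = sqd c x + (2 * t * (x 0 j - c 0 j) + t ^+ 2).
Proof.
rewrite /sqd (bigD1 j) //= [in RHS](bigD1 j) //=.
rewrite !mxE !eqxx mulr1 (eq_bigr (fun i => (x 0 i - c 0 i) ^+ 2)); last first.
  by move=> i ij; rewrite !mxE eqxx (negPf ij) mulr0 addr0.
ring.
Qed.

Lemma coord_line x (i j : 'I_n) t :
  (x + t *: ebasis R j) 0 i = x 0 i + t * (i == j)%:R.
Proof. by rewrite !mxE eqxx. Qed.

Lemma near_line x v (P : 'rV[R]_n -> Prop) :
  (\forall y \near x, P y) -> \forall t \near (0 : R), P (x + t *: v).
Proof.
move=> h; have hc : (fun t : R => x + t *: v) @ (0 : R) --> x.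
  have hz : (fun t : R => t *: v) @ (0 : R) --> (0 : R) *: v.
    exact: scalel_continuous.
  have := @cvgD _ _ _ (nbhs (0 : R)) _ (fun=> x) (fun t : R => t *: v) x _
    (@cvg_cst _ x _ (nbhs (0 : R)) _) hz.
  by rewrite scale0r addr0; exact.
exact: hc h.
Qed.

Lemma C2on_has_d2 (U : set 'rV[R]_n) (f : 'rV[R]_n -> R) x (i : 'I_n) :
  C2on U f -> (\forall y \near x, U y) ->
  has_d2 f x (ebasis R i) (partial i (partial i f) x).
Proof.
move=> [C1 C2] nU; exists (fun t => partial i f (x + t *: ebasis R i)); split.
  near=> t; have Ut : U (x + t *: ebasis R i) by near: t; exact: near_line.
  apply: (iffLR (is_derive_line_at f x (ebasis R i) t _)).
  by apply: derivableP; have [_ /(_ i) []] := C1 _ Ut.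
apply: (iffLR (is_derive_line (partial i f) x (ebasis R i) _)).
by apply: derivableP; have [] := C2 _ (nbhs_singleton nU) i i.
Unshelve. all: by end_near. Qed.

Lemma lap_min (f : 'rV[R]_n -> R) x (l : 'I_n -> R) :
  (forall i, has_d2 f x (ebasis R i) (l i)) ->
  (\forall y \near x, f x <= f y) -> 0 <= \sum_(i < n) l i.
Proof.
move=> h hm; apply: sumr_ge0 => i _; apply: has_d2_min (h i) _.
exact: (near_line _ hm).
Qed.

Lemma lap_max (f : 'rV[R]_n -> R) x (l : 'I_n -> R) :
  (forall i, has_d2 f x (ebasis R i) (l i)) ->
  (\forall y \near x, f y <= f x) -> \sum_(i < n) l i <= 0.
Proof.
move=> h hm; apply: sumr_le0 => i _; apply: has_d2_max (h i) _.
exact: (near_line _ hm).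
Qed.

End Euclid.

(** * Sliding and the reflection estimate *)

(** The infimum of the admissible parameters is admissible by closedness; if it were positive,
    compactness would turn the local decrease into a uniform one. The decreased parameter may depend
    on the point, so a contact need not be contradictory: it suffices that the bound near it
    survives a smaller parameter. *)
Lemma sliding {R : realType} {X : topologicalType} (K : set X)
    (P : R -> X -> Prop) (m0 : R) :
  compact K -> 0 <= m0 ->
  (forall x s t, s <= t -> P s x -> P t x) ->
  (forall x, K x -> P m0 x) ->
  (forall x m, K x -> (forall s, m < s -> P s x) -> P m x) ->
  (forall m z, 0 < m <= m0 -> (forall x, K x -> P m x) -> K z ->
     exists2 m', m' < m & \forall x \near z, K x -> P m' x) ->
  forall x, K x -> P 0 x.
Proof.
move=> cK m00 Pmono Pm0 Pclosed Ploc.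
pose M := [set m : R | 0 <= m <= m0 /\ forall x, K x -> P m x].
have Mm0 : M m0 by rewrite /M /= m00 lexx.
have Mlb : has_lbound M by exists 0 => m [/andP[]].
have Minf : has_inf M by split => //; exists m0.
set i := inf M.
have i0 : 0 <= i by apply: lb_le_inf; [exists m0 | move=> m [] /andP[]].
have im0 : i <= m0 by apply: ge_inf.
have Pi x : K x -> P i x.
  move=> Kx; apply: Pclosed => // s iS.
  have si0 : 0 < s - i by rewrite subr_gt0.
  have [m [_ Mm] ms] := inf_adherent si0 Minf.
  by apply: (Pmono x m s) (Mm x Kx); move: ms; rewrite addrC subrK => /ltW.
move: i0; rewrite le_eqVlt => /orP[/eqP i0|i0].
  by move=> x Kx; rewrite i0; exact: Pi.
(* Compactness as a near-covering property along parameters increasing to [i]: the local statement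
   [step] yields a single parameter below [i] valid on all of [K]. *)
have /compact_near_coveringP/near_covering_withinP := cK.
move=> /(_ R (i^'-) P _) /=.
have step x : K x -> \forall x' \near x & m \near i^'-, K x' -> P m x'.
  move=> Kx; have [|m' m'i hm'] := Ploc i x _ Pi Kx; first by rewrite i0.
  exists ([set x' | K x' -> P m' x'], [set m | m' <= m]) => /=.
    by split=> //; exact: nbhs_left_ge.
  by move=> [x' m] [/= hx' mm'] Kx'; apply: Pmono mm' _; exact: hx'.
move=> /(_ step) H.
have [m [mi mP] m_0] : exists2 m, m < i /\ K `<=` P m & 0 <= m.
  near i^'- => m.
  exists m; last by near: m; exact: nbhs_left_ge.
  split; first by near: m; exact: nbhs_left_lt.
  by near: m; exact: H.
suff : i <= m by rewrite leNgt mi.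
by apply: ge_inf => //; split=> //; rewrite m_0 (le_trans (ltW mi)).
Unshelve. all: by end_near. Qed.

Lemma has_d2_eq {R : realType} {V W : normedModType R} (f : V -> R) (g : W -> R)
    (x v : V) (y w : W) (l : R) :
  (forall t : R, f (x + t *: v) = g (y + t *: w)) ->
  has_d2 g y w l -> has_d2 f x v l.
Proof.
move=> e [g1 [h h1]]; exists g1; split=> //; near=> t.
apply: (@eq_is_derive _ _ _ (fun t : R => g (y + t *: w))) => [s|]; first by rewrite e.
by near: t.
Unshelve. all: by end_near. Qed.

Lemma has_d2_quad {R : realType} {V : normedModType R} (f : V -> R)
    (x v : V) (b a : R) :
  (forall t : R, f (x + t *: v) = f x + (b * t + a * t ^+ 2)) ->
  has_d2 f x v (2 * a).
Proof.
move=> e; exists (fun t => b + a * (2 * t)); split.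
  near=> t; apply: (@eq_is_derive _ _ _ (fun t : R => f x + (b * t + a * t ^+ 2))).
    by move=> s; rewrite e.
  have h := is_derive_add (is_derive_const (f x) t (1 : R)) (is_derive_add
    (is_derive_scale b (is_derive_idR t)) (is_derive_scale a (is_derive_sqrR t))).
  by apply: is_derive_eq h _; rewrite add0r mulr1.
have h := is_derive_add (is_derive_const b (0 : R) (1 : R))
  (is_derive_scale a (is_derive_scale 2 (is_derive_idR (0 : R)))).
by apply: is_derive_eq h _; ring.
Unshelve. all: by end_near. Qed.

Section Reflection.
Context {R : realType} {n : nat}.
Implicit Types (c x y z : 'rV[R]_n) (d t M N : R).

Lemma has_d2_sqd c x (j : 'I_n) : has_d2 (sqd c) x (ebasis R j) 2.
Proof.
rewrite -[2]mulr1; apply: (@has_d2_quad _ _ _ _ _ (2 * (x 0 j - c 0 j))) => t.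
by rewrite sqd_line; ring.
Qed.

(** A sup-norm ball is preserved by every coordinate reflection through its centre, and its half is
    a product of segments, hence compact. *)
Definition box c d : set 'rV[R]_n := [set y | forall j, `|y 0 j - c 0 j| <= d].

Definition refl c (i : 'I_n) y : 'rV[R]_n := y - (2 * (y 0 i - c 0 i)) *: ebasis R i.

Lemma reflE c i y j :
  refl c i y 0 j = if j == i then 2 * c 0 i - y 0 i else y 0 j.
Proof.
rewrite /refl !mxE eqxx /=; case: eqP => [->|_] /=; last by rewrite mulr0 subr0.
by rewrite mulr1; ring.
Qed.

Lemma refl_cont c i x : {for x, continuous (refl c i)}.
Proof.
apply: (@continuousB _ _ _ (fun y => y)); first exact: cvg_id.
have h : {for x, continuous (fun y : 'rV[R]_n => 2 * (y 0 i - c 0 i))}.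
  apply: (@continuousM _ _ (fun=> 2)); first exact: cst_continuous.
  by apply: continuousB; [exact: coord_cont | exact: cst_continuous].
exact: (continuous_comp h (@scalel_continuous _ _ _ _)).
Qed.

Lemma near_box c d x : (forall j, `|x 0 j - c 0 j| < d) ->
  \forall y \near x, forall j, `|(y : 'rV[R]_n) 0 j - c 0 j| < d.
Proof.
move=> h; apply: (@filter_forall 'rV[R]_n 'I_n (fun j y => `|y 0 j - c 0 j| < d) (nbhs x)
  (nbhs_filter x)).
move=> j.
have hc : {for x, continuous (fun y : 'rV[R]_n => `|y 0 j - c 0 j|)}.
  apply: (continuous_comp (g := fun s : R => `|s|)); last exact: norm_continuous.
  by apply: continuousB; [exact: coord_cont | exact: cst_continuous].
by apply: (cvgr_lt _ hc); exact: h.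
Qed.

(** The odd part of [f] under the reflection vanishes on the mirror, is at most [M] and has
    Laplacian above [- N]. The maximum principle on the half box bounds it by a quadratic polynomial
    that vanishes at [c], so the bound at [c + t *: ebasis R i] is linear in [t]. *)
Lemma reflection_bound_le (f : 'rV[R]_n -> R) (l : 'rV[R]_n -> 'I_n -> R)
    c d M N (i : 'I_n) t :
  0 < d ->
  (forall y, box c d y -> {for y, continuous f}) ->
  (forall y, box c d y -> forall j, has_d2 f y (ebasis R j) (l y j)) ->
  (forall y, box c d y -> `|f y| <= M) ->
  (forall y, box c d y -> `|\sum_j l y j| < N) ->
  0 <= t <= d ->
  f (c + t *: ebasis R i) - f (c - t *: ebasis R i) <=
    2 * t * (n.+1%:R * M / d + N * d / 2).
Proof.
move=> d0 cf hf fM lN t0d.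
have bc : box c d c by move=> j; rewrite subrr normr0 ltW.
have M0 : 0 <= M := le_trans (normr_ge0 _) (fM c bc).
have N0 : 0 < N := le_lt_trans (normr_ge0 _) (lN c bc).
(* The factor [n%:R] cancels the Laplacian of [sqd c], so the Laplacian of [psi] is exactly [- N].
   On the half box [psi] is nonnegative, and on the faces at distance [d] it is at least [M]. *)
pose psi y := M / d ^+ 2 * (sqd c y + n%:R * ((y 0 i - c 0 i) * (d - (y 0 i - c 0 i))))
  + N / 2 * ((y 0 i - c 0 i) * (d - (y 0 i - c 0 i))).
pose h y := (2^-1 * f y - 2^-1 * f (refl c i y)) - psi y.
pose H : set 'rV[R]_n := [set y | box c d y /\ c 0 i <= y 0 i].
have cH : compact H.
  have := @rV_compact R n (fun j => `[if j == i then c 0 i else c 0 j - d, c 0 j + d]%classic).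
  move=> /(_ (fun j => @segment_compact _ _ _)); congr compact.
  apply/seteqP; split => y /= hy.
    split=> [j|]; last by have := hy i; rewrite /= in_itv /= eqxx => /andP[].
    have := hy j; rewrite /= in_itv /= ler_distl; case: eqP => [->|_ //].
    by move=> /andP[h1 ->]; rewrite andbT (le_trans _ h1) // gerBl ltW.
  case: hy => by1 yi j; have := by1 j; rewrite /= in_itv /= ler_distl.
  by case: eqP => [->|_ //] /andP[_ ->]; rewrite yi.
have reflH y : box c d y -> box c d (refl c i y).
  move=> hy j; rewrite reflE; case: eqP => [->|_]; last exact: hy.
  have := hy i; rewrite -normrN; congr (`|_| <= _); ring.
have s_cont y : {for y, continuous (fun y : 'rV[R]_n => y 0 i - c 0 i)}.
  by apply: continuousB; [exact: coord_cont | exact: cst_continuous].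
have q_cont y : {for y, continuous (fun y : 'rV[R]_n =>
    (y 0 i - c 0 i) * (d - (y 0 i - c 0 i)))}.
  apply: (continuousM (s_cont y)).
  by apply: continuousB; [exact: cst_continuous | exact: s_cont].
have ch y : H y -> {for y, continuous h}.
  move=> [hy _]; apply: continuousB.
    apply: continuousB; apply: (@continuousM _ _ (fun=> 2^-1)).
    - exact: cst_continuous.
    - exact: cf.
    - exact: cst_continuous.
    - by apply: continuous_comp; [exact: refl_cont | apply: cf; exact: reflH].
  apply: continuousD; apply: continuousM; try exact: cst_continuous; last exact: q_cont.
  apply: continuousD; first exact: sqd_cont.
  by apply: continuousM; [exact: cst_continuous | exact: q_cont].
have H0 : H !=set0 by exists c; split.
have [|z /set_mem zH zmax] := @EVT_max_rV R n h H H0 cH.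
  by apply: continuous_in_subspaceT => y /set_mem /ch.
have [zb zi] := zH.
set s := z 0 i - c 0 i.
have s0 : 0 <= s by rewrite subr_ge0.
have sd : s <= d by apply: le_trans (zb i); exact: ler_norm.
have q0 : 0 <= s * (d - s) by rewrite mulr_ge0 // subr_ge0.
have hz : h z <= 0.
  rewrite leNgt; apply/negP => hz0.
  (* A positive maximum cannot lie on an outer face, where [psi] dominates [M], nor, by [sp], on the
     mirror, where the odd part vanishes; it is thus a local maximum in the full space. *)
  have far (j : 'I_n) : `|z 0 j - c 0 j| < d.
    rewrite ltNge; apply/negP => jd; move: hz0; apply/negP; rewrite -leNgt.
    rewrite /h subr_le0 (@le_trans _ _ M) //.
      have := fM _ zb; have := fM _ (reflH _ zb).
      by rewrite !ler_norml => /andP[a1 a2] /andP[b1 b2]; lra.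
    rewrite /psi -/s (@le_trans _ _ (M / d ^+ 2 * (sqd c z + n%:R * (s * (d - s))))) //.
      have {1}-> : M = M / d ^+ 2 * d ^+ 2 by rewrite divfK // expf_neq0 // gt_eqF.
      apply: ler_wpM2l; first by rewrite divr_ge0 // sqr_ge0.
      rewrite (@le_trans _ _ (sqd c z)) ?lerDl ?mulr_ge0 ?subr_ge0 //.
      apply: le_trans (coord_sqd c z j).
      by rewrite -(real_normK (num_real (z 0 j - _))) ler_pXn2r ?nnegrE // ltW.
    by rewrite lerDl mulr_ge0 // divr_ge0 // ltW.
  have sp : 0 < s.
    rewrite lt_def s0 andbT; apply/negP => /eqP se; move: hz0; apply/negP.
    rewrite -leNgt /h; have -> : refl c i z = z.
      by rewrite /refl -/s se mulr0 scale0r subr0.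
    rewrite subrr sub0r oppr_le0 /psi -/s addr_ge0 // mulr_ge0 ?divr_ge0 ?sqr_ge0 //.
      by rewrite addr_ge0 ?sqd_ge0 // mulr_ge0.
    exact: ltW.
  have loc : \forall y \near z, h y <= h z.
    have nz1 : \forall y \near z, c 0 i < (y : 'rV[R]_n) 0 i.
      by apply: (cvgr_gt (z 0 i) (@coord_cont R n i z)); rewrite -subr_gt0.
    near=> y; apply: zmax; apply/mem_set; split.
      move=> j; apply: ltW; move: j.
      by near: y; exact: near_box.
    by apply: ltW; near: y.
  have d2psi j : has_d2 psi z (ebasis R j)
      (M / d ^+ 2 * (2 + n%:R * (2 * - (j == i)%:R)) + N / 2 * (2 * - (j == i)%:R)).
    have hq : has_d2 (fun y : 'rV[R]_n => (y 0 i - c 0 i) * (d - (y 0 i - c 0 i)))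
        z (ebasis R j) (2 * - (j == i)%:R).
      apply: (@has_d2_quad _ _ _ _ _ ((j == i)%:R * (d - 2 * s))) => t'.
      rewrite coord_line eq_sym /s; case: eqP => _ /=; ring.
    apply: has_d2D; apply: has_d2Z => //; apply: has_d2D; first exact: has_d2_sqd.
    exact: has_d2Z.
  have d2r j : has_d2 (fun y => f (refl c i y)) z (ebasis R j) (l (refl c i z) j).
    have [ji|ji] := eqVneq j i.
      apply: (has_d2_eq _ (has_d2N (hf _ (reflH _ zb) j))) => t'; congr f.
      apply/rowP => k; rewrite [RHS]mxE !reflE ji !mxE !eqxx /=.
      by have [_|_] /= := eqVneq k i; [ring | rewrite oppr0 !mulr0 !addr0].
    apply: (has_d2_eq _ (hf _ (reflH _ zb) j)) => t'; congr f.
    apply/rowP => k; rewrite [RHS]mxE !reflE !mxE eqxx /=.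
    have [->|//] := eqVneq k i.
    by rewrite [i == j]eq_sym (negPf ji) /= mulr0 !addr0.
  have := lap_max (fun j => has_d2B (has_d2B (has_d2Z 2^-1 (hf _ zb j))
    (has_d2Z 2^-1 (d2r j))) (d2psi j)) loc.
  rewrite !sumrB -!mulr_sumr; set D := (X in _ - X <= _).
  have -> : D = - N.
    rewrite /D big_split /= -!mulr_sumr big_split /= -!mulr_sumr.
    have -> : \sum_(j < n) - ((j == i)%:R : R) = -1.
      by rewrite sumrN (bigD1 i) //= eqxx big1 ?addr0 // => j /negPf ->.
    by rewrite sumr_const card_ord -[2 *+ n]mulr_natl; field; rewrite gt_eqF.
  have := lN _ zb; have := lN _ (reflH _ zb).
  by rewrite !ltr_norml => /andP[a1 a2] /andP[b1 b2]; lra.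
have : h (c + t *: ebasis R i) <= 0.
  have [t0 td] := andP t0d.
  apply: le_trans (zmax _ _) hz; apply/mem_set; split.
    move=> j; rewrite coord_line addrC addKr.
    by case: (j == i) => /=; [rewrite mulr1 ger0_norm | rewrite mulr0 normr0 ltW].
  by rewrite coord_line eqxx mulr1 lerDl.
rewrite /h.
have -> : refl c i (c + t *: ebasis R i) = c - t *: ebasis R i.
  apply/rowP => k; rewrite reflE !mxE eqxx /=; case: (k =P i) => [->|_] /=.
    by rewrite eqxx mulr1; ring.
  by rewrite !mulr0 oppr0.
rewrite /psi sqd_line coord_line eqxx sqdxx subrr mulr0 !add0r mulr1.
have -> : c 0 i + t - c 0 i = t by ring.
have [t0 td] := andP t0d.
rewrite -subr_ge0 => hb; rewrite -subr_ge0.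
have dn : d != 0 by rewrite gt_eqF.
have : 0 <= M / d ^+ 2 * (n%:R * t ^+ 2 + t * (d - t)) + N / 2 * t ^+ 2.
  rewrite addr_ge0 // mulr_ge0 ?divr_ge0 ?sqr_ge0 ?(ltW N0) //.
  by rewrite addr_ge0 // mulr_ge0 ?sqr_ge0 ?subr_ge0.
have -> : n.+1%:R * M / d = M / d ^+ 2 * (n%:R * d + d).
  by rewrite -natr1; field.
move: hb; move: (M / d ^+ 2) => m; lra.
Unshelve. all: by end_near. Qed.

End Reflection.

(** * Oscillation and viscosity tests *)

Section Oscillation.
Context {R : realType} {n : nat}.
Implicit Types (c x y z : 'rV[R]_n) (d t M N : R).

Lemma reflection_bound (f : 'rV[R]_n -> R) (l : 'rV[R]_n -> 'I_n -> R)
    c d M N (i : 'I_n) t :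
  0 < d ->
  (forall y, box c d y -> {for y, continuous f}) ->
  (forall y, box c d y -> forall j, has_d2 f y (ebasis R j) (l y j)) ->
  (forall y, box c d y -> `|f y| <= M) ->
  (forall y, box c d y -> `|\sum_j l y j| < N) ->
  `|t| <= d ->
  `|f (c + t *: ebasis R i) - f (c - t *: ebasis R i)| <=
    2 * `|t| * (n.+1%:R * M / d + N * d / 2).
Proof.
move=> d0 cf hf fM lN td.
have main s : 0 <= s <= d -> `|f (c + s *: ebasis R i) - f (c - s *: ebasis R i)| <=
    2 * s * (n.+1%:R * M / d + N * d / 2).
  move=> sd; rewrite ler_norml (reflection_bound_le i d0 cf hf fM lN sd) andbT.
  have := @reflection_bound_le R n (fun y => -1 * f y) (fun y j => -1 * l y j)
    c d M N i s d0.
  rewrite -mulrBr mulN1r lerNl; apply=> // y yb.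
  - apply: (@continuousM _ _ (fun=> -1)); [exact: cst_continuous | exact: cf].
  - by move=> j; apply: has_d2Z; exact: hf.
  - by rewrite mulN1r normrN fM.
  - by rewrite -mulr_sumr mulN1r normrN lN.
have [t0|t0] := lerP 0 t.
  by rewrite (ger0_norm t0) in td *; apply: main; rewrite t0.
have Nt0 : 0 <= - t by rewrite oppr_ge0 ltW.
rewrite -normrN (ger0_norm Nt0) in td; rewrite -(normrN t) (ger0_norm Nt0) distrC.
by have := main (- t); rewrite Nt0 td scaleNr opprK; apply.
Qed.

(** Coordinates are changed one at a time, and each change is a reflection about the midpoint of the
    two successive points. The box of radius [2 * d] leaves room for boxes of radius [d] around
    these midpoints. *)
Lemma box_oscillation (f : 'rV[R]_n -> R) (l : 'rV[R]_n -> 'I_n -> R)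
    c d M N x e :
  0 < d ->
  (forall y, box c (2 * d) y -> {for y, continuous f}) ->
  (forall y, box c (2 * d) y -> forall j, has_d2 f y (ebasis R j) (l y j)) ->
  (forall y, box c (2 * d) y -> `|f y| <= M) ->
  (forall y, box c (2 * d) y -> `|\sum_j l y j| < N) ->
  e <= d -> box c e x ->
  `|f x - f c| <= n%:R * (e * (n.+1%:R * M / d + N * d / 2)).
Proof.
move=> d0 cf hf fM lN ed xb; set L := n.+1%:R * M / d + N * d / 2.
pose path k : 'rV[R]_n := \row_j (if (j < k)%N then x 0 j else c 0 j).
have bc : box c (2 * d) c by move=> j; rewrite subrr normr0 mulr_ge0 // ltW.
have L0 : 0 <= L.
  have M0 := le_trans (normr_ge0 _) (fM c bc).
  have N0 := le_lt_trans (normr_ge0 _) (lN c bc).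
  by rewrite addr_ge0 // divr_ge0 ?mulr_ge0 // ltW.
have step (k : 'I_n) : `|f (path k.+1) - f (path k)| <= e * L.
  (* Midpoint of [path k] and [path k.+1], which are symmetric about it in direction [k]. *)
  pose m : 'rV[R]_n := \row_j (if (j < k)%N then x 0 j
                   else if j == k then (x 0 j + c 0 j) / 2 else c 0 j).
  pose t := (x 0 k - c 0 k) / 2.
  have -> : path k.+1 = m + t *: ebasis R k.
    apply/rowP => j; rewrite !mxE eqxx /= ltnS leq_eqVlt -[(j == k :> nat)]/(j == k).
    have [->|jk] /= := eqVneq j k; first by rewrite ltnn mulr1 /t; lra.
    by rewrite mulr0 addr0.
  have -> : path k = m - t *: ebasis R k.
    apply/rowP => j; rewrite !mxE eqxx /=.
    have [->|jk] /= := eqVneq j k; first by rewrite ltnn mulr1 /t; lra.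
    by rewrite mulr0 subr0.
  have tx : `|t| = `|x 0 k - c 0 k| / 2.
    by rewrite /t normrM [`|2^-1|]ger0_norm // invr_ge0.
  have te : 2 * `|t| <= e by rewrite tx; have := xb k; lra.
  have sub y : box m d y -> box c (2 * d) y.
    move=> yb j; rewrite -[y 0 j](subrK (m 0 j)) -addrA.
    rewrite (le_trans (ler_normD _ _)) // mulr_natl mulr2n lerD ?yb //.
    rewrite (le_trans _ ed) // mxE; case: ifP => _; first exact: xb.
    case: eqP => [->|_]; last by rewrite subrr normr0 (le_trans (normr_ge0 _) (xb j)).
    have -> : (x 0 k + c 0 k) / 2 - c 0 k = t by rewrite /t; lra.
    by have := normr_ge0 t; lra.
  have := @reflection_bound f l m d M N k t d0.
  move=> /(_ (fun y yb => cf y (sub y yb)) (fun y yb => hf y (sub y yb))).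
  move=> /(_ (fun y yb => fM y (sub y yb)) (fun y yb => lN y (sub y yb))).
  have td : `|t| <= d by have := normr_ge0 t; lra.
  by move=> /(_ td) h; apply: le_trans h _; rewrite ler_wpM2r.
have -> : x = path n by apply/rowP => j; rewrite mxE ltn_ord.
have -> : c = path 0 by apply/rowP => j; rewrite mxE.
have : forall k, (k <= n)%N -> `|f (path k) - f (path 0)| <= k%:R * (e * L).
  elim=> [|k IH] kn; first by rewrite subrr normr0 mul0r.
  rewrite -(subrK (f (path k)) (f (path k.+1))) -addrA.
  rewrite (le_trans (ler_normD _ _)) // -natr1 mulrDl mul1r [leRHS]addrC.
  by apply: lerD; [exact: (step (Ordinal kn)) | exact: IH (ltnW kn)].
by apply.
Qed.

End Oscillation.

(** * Second-derivative tests on the positivity set, and non-degeneracy *)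

Section ViscosityTests.
Context {R : realType} {n m : nat} (p : R) (u : 'rV[R]_n -> 'rV[R]_m).
Hypothesis hu : visc_sol p (eball 0 1) u.
Implicit Types (x y z : 'rV[R]_n).
Local Notation B := (eball (0 : 'rV[R]_n) 1).

Lemma u_cont x : B x -> {for x, continuous u}.
Proof. by case: hu => h _; exact: h. Qed.

Lemma u_coord_cont x (i : 'I_m) : B x -> {for x, continuous (fun y => u y 0 i)}.
Proof. by move=> /u_cont h; exact: (continuous_comp h (@coord_cont _ _ i _)). Qed.

Lemma u_enorm_cont x : B x -> {for x, continuous (fun y => enorm (u y))}.
Proof. by move=> /u_cont h; exact: (continuous_comp h (@enorm_cont _ _ _)). Qed.

Lemma near_posset z : posset B u z -> \forall y \near z, posset B u y.
Proof.
move=> [Bz uz]; near=> y; split; first by near: y; exact: near_eball.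
by near: y; apply: (cvgr_gt _ (u_enorm_cont Bz)).
Unshelve. all: by end_near. Qed.

Lemma u_has_d2 z (i : 'I_m) (j : 'I_n) : posset B u z ->
  has_d2 (fun y => u y 0 i) z (ebasis R j)
    (partial j (partial j (fun y => u y 0 i)) z).
Proof.
by move=> /near_posset; apply: C2on_has_d2; case: hu => _ [/(_ i) []].
Qed.

Lemma u_laplacian z (i : 'I_m) : posset B u z ->
  laplacian (fun y => u y 0 i) z = enorm (u z) `^ (p - 2) * u z 0 i.
Proof. by case: hu => _ [/(_ i) [_ h] _]; exact: h. Qed.

(** On the positivity set the equation holds classically, so the second-derivative test at a local
    minimum of [u^i - phi] is enough; [phi] needs second derivatives at [z] only. *)
Lemma lower_test (phi : 'rV[R]_n -> R) (l : 'I_n -> R) z (i : 'I_m) :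
  posset B u z -> (forall j, has_d2 phi z (ebasis R j) (l j)) ->
  (\forall y \near z, phi y - phi z <= u y 0 i - u z 0 i) ->
  \sum_j l j <= enorm (u z) `^ (p - 2) * u z 0 i.
Proof.
move=> uz hphi hn; rewrite -u_laplacian // -subr_ge0 /laplacian -sumrB.
apply: (lap_min (fun j => has_d2B (u_has_d2 i j uz) (hphi j))).
near=> y; have : phi y - phi z <= u y 0 i - u z 0 i by near: y.
lra.
Unshelve. all: by end_near. Qed.

Lemma dotp_has_d2 z (e : 'rV[R]_m) (j : 'I_n) : posset B u z ->
  has_d2 (fun y => dotp (u y) e) z (ebasis R j)
    (\sum_i e 0 i * partial j (partial j (fun y => u y 0 i)) z).
Proof.
move=> uz; rewrite /dotp; elim: (index_enum _) => [|i s IH].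
  rewrite big_nil (_ : (fun _ => _) = fun=> 0); last first.
    by apply/funext => y; rewrite big_nil.
  have := has_d2Z 0 (has_d2_sqd 0 z j); rewrite mul0r.
  by congr has_d2; apply/funext => y; rewrite mul0r.
rewrite big_cons (_ : (fun _ => _) = fun y => e 0 i * u y 0 i + \sum_(i <- s) u y 0 i * e 0 i).
  by apply: has_d2D => //; apply: has_d2Z; exact: u_has_d2.
by apply/funext => y; rewrite big_cons mulrC.
Qed.

(* Testing with the direction [u z / |u z|] avoids differentiating [|u|]: the
   linear functional is below [|u|] and agrees with it at [z]. *)
Lemma upper_test (phi : 'rV[R]_n -> R) (l : 'I_n -> R) z :
  posset B u z -> (forall j, has_d2 phi z (ebasis R j) (l j)) ->
  (\forall y \near z, enorm (u y) - enorm (u z) <= phi y - phi z) ->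
  enorm (u z) `^ (p - 1) <= \sum_j l j.
Proof.
move=> uz hphi hn; have [_ uz0] := uz; rewrite /= in uz0.
pose e := (enorm (u z))^-1 *: u z.
have e1 : enorm e = 1.
  by rewrite enormZ ger0_norm ?mulVf ?gt_eqF // invr_ge0 ltW.
have := lap_max (fun j => has_d2B (dotp_has_d2 e j uz) (hphi j)).
rewrite sumrB exchange_big /= subr_le0.
have -> : \sum_i \sum_j e 0 i * partial j (partial j (fun y => u y 0 i)) z
    = enorm (u z) `^ (p - 1).
  transitivity (enorm (u z) `^ (p - 2) * dotp (u z) e).
    rewrite /dotp mulr_sumr; apply: eq_bigr => i _.
    rewrite -mulr_sumr -[X in _ * X]/(laplacian _ z) u_laplacian //; ring.
  rewrite dotp_normalize // mulrC -{1}(powRr1 (ltW uz0)) -powRD.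
    by congr (_ `^ _); lra.
  by rewrite (gt_eqF uz0) implybT.
apply; near=> y.
have h1 : enorm (u y) - enorm (u z) <= phi y - phi z by near: y.
have := dotp_unit_le (u y) e1; rewrite dotp_normalize //; lra.
Unshelve. all: by end_near. Qed.

(** If [u z0] were non-zero, [|u| - th * sqd z0] would have a positive maximum strictly inside the
    ball, where [upper_test] gives [|u|^(p-1) <= 2 n th]. This contradicts [|u| <= M], because
    t^(p-1) decreases. *)
Lemma nondegeneracy z0 rho M : p < 1 -> 0 < rho -> (0 < n)%N ->
  (forall x, sqd z0 x <= rho ^+ 2 -> B x /\ enorm (u x) <= M) ->
  2 * n%:R * M < M `^ (p - 1) * rho ^+ 2 -> enorm (u z0) = 0.
Proof.
move=> p1 rho0 n0 hM hlt; apply/eqP; rewrite -[_ == _]negbK; apply/negP => uz0.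
have rho2 : 0 < rho ^+ 2 by rewrite exprn_gt0.
have [Bz0 uM] : B z0 /\ enorm (u z0) <= M by apply: hM; rewrite sqdxx ltW.
have up : 0 < enorm (u z0) by rewrite lt_def uz0 enorm_ge0.
have M0 : 0 < M by exact: lt_le_trans up uM.
have n0R : 0 < n%:R :> R by rewrite ltr0n.
(* The first inequality keeps the maximum off the sphere of radius [rho], the second contradicts the
   equation; the hypothesis is exactly that both are compatible. *)
have [th [th1 th2]] : exists th : R, M < th * rho ^+ 2 /\ 2 * n%:R * th < M `^ (p - 1).
  have h : M / rho ^+ 2 < M `^ (p - 1) / (2 * n%:R).
    rewrite ltr_pdivrMr // mulrAC ltr_pdivlMr ?mulr_gt0 //.
    by rewrite mulrC.
  have [h1 h2] := midf_lt h; exists ((M / rho ^+ 2 + M `^ (p - 1) / (2 * n%:R)) / 2).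
  split; first by rewrite -ltr_pdivrMr.
  by rewrite mulrC -ltr_pdivlMr // mulr_gt0.
have th0 : 0 < th by rewrite -(pmulr_lgt0 _ rho2) (lt_trans M0).
pose K : set 'rV[R]_n := [set x | 0 <= sqd z0 x <= rho ^+ 2].
have KB x : K x -> B x by move=> /andP[_ /hM []].
pose h x := enorm (u x) - th * sqd z0 x.
have Kz0 : K z0 by rewrite /K /= sqdxx lexx ltW.
have [||z /set_mem Kz zmax] := @EVT_max_rV R n h K _ (@compact_sqd _ _ _ _ _).
- by exists z0.
- apply: continuous_in_subspaceT => y /set_mem /KB By.
  apply: (continuousB (u_enorm_cont By)).
  by apply: continuousM; [exact: cst_continuous | exact: sqd_cont].
have := zmax z0 (mem_set Kz0); rewrite {1}/h sqdxx mulr0 subr0 => hz.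
have [Bz uzM] : B z /\ enorm (u z) <= M by move: Kz => /andP[_ /hM].
have uz : 0 < enorm (u z).
  by have := mulr_ge0 (ltW th0) (sqd_ge0 z0 z); rewrite /h in hz; lra.
have inz : sqd z0 z < rho ^+ 2.
  move: Kz => /andP[_]; rewrite le_eqVlt => /orP[/eqP e|//].
  by move: hz; rewrite /h e; lra.
have pz : posset B u z by [].
have := @upper_test (fun x => th * sqd z0 x) (fun=> th * 2) z pz.
move=> /(_ (fun j => has_d2Z th (has_d2_sqd z0 z j))).
rewrite sumr_const card_ord -[_ *+ n]mulr_natl => H.
have : enorm (u z) `^ (p - 1) <= n%:R * (th * 2).
  apply: H; near=> y.
  have Ky : K y.
    by rewrite /K /= sqd_ge0 /= ltW //; near: y; exact: near_sqd_lt.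
  have := zmax y (mem_set Ky).
  rewrite /h => hh; lra.
apply/negP; rewrite -ltNge; apply: lt_le_trans (_ : M `^ (p - 1) <= _).
  by move: th2; lra.
by apply: powR_npos_le => //; rewrite subr_le0 ltW.
Unshelve. all: by end_near. Qed.

End ViscosityTests.

(** * Barriers *)

Lemma exponent_signs {R : realType} (a : R) : 1 < a -> a < 2 ->
  [/\ 0 < a, 0 < a - 1, a - 1 != 0, a - 1 != 1 & a - 2 != 0].
Proof.
move=> a1 a2; split; [lra | lra | rewrite gt_eqF // | rewrite lt_eqF // | rewrite lt_eqF //]; lra.
Qed.

Section Barrier.
Context {R : realType} {n : nat}.
Implicit Types (c x y z : 'rV[R]_n).
Variables (k : 'I_n) (c : 'rV[R]_n) (A s k0 : R).

Definition gbump x : R := expR (- A * sqd c x).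
Definition bgrad (i : 'I_n) x : R := - (2 * A) * (x 0 i - c 0 i) * gbump x.
Definition bhess (i j : 'I_n) x : R :=
  - (2 * A) * (i == j)%:R * gbump x - (2 * A) * (x 0 i - c 0 i) * bgrad j x.

(** The perturbed height whose zero set plays the role of the free boundary of the barrier. The
    shift [k0] carries the sliding parameter; [s] is positive for comparison from below and negative
    from above. *)
Definition level x : R := x 0 k + k0 + s * gbump x.
Definition lgrad (i : 'I_n) x : R := (k == i)%:R + s * bgrad i x.
Definition lhess (i j : 'I_n) x : R := s * bhess i j x.

Lemma is_derive_coord x (i j : 'I_n) :
  is_derive x (ebasis R j) (fun y : 'rV[R]_n => y 0 i) (i == j)%:R.
Proof.
apply: (iffRL (is_derive_line _ _ _ _)).
have h := is_derive_add (is_derive_const (x 0 i) (0 : R) (1 : R))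
  (is_derive_scale (i == j)%:R (is_derive_idR (0 : R))).
have -> : (fun t => (x + t *: ebasis R j) 0 i) = fun t => x 0 i + (i == j)%:R * t.
  by apply/funext => t; rewrite coord_line mulrC.
by apply: is_derive_eq h _; rewrite add0r mulr1.
Qed.

Lemma is_derive_sqd x (j : 'I_n) :
  is_derive x (ebasis R j) (sqd c) (2 * (x 0 j - c 0 j)).
Proof.
apply: (iffRL (is_derive_line _ _ _ _)).
have h := is_derive_add (is_derive_const (sqd c x) (0 : R) (1 : R)) (is_derive_add
  (is_derive_scale (2 * (x 0 j - c 0 j)) (is_derive_idR (0 : R))) (is_derive_sqrR 0)).
have -> : (fun t => sqd c (x + t *: ebasis R j)) =
    fun t => sqd c x + (2 * (x 0 j - c 0 j) * t + t ^+ 2).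
  by apply/funext => t; rewrite sqd_line; ring.
by apply: is_derive_eq h _; ring.
Qed.

Lemma is_derive_gbump x (j : 'I_n) : is_derive x (ebasis R j) gbump (bgrad j x).
Proof.
have h := is_derive_compR (F := expR) (g := fun y => - A * sqd c y)
  (is_derive_expR (- A * sqd c x))
  (is_derive_scale (- A) (is_derive_sqd x j)).
by apply: is_derive_eq h _; rewrite /bgrad /gbump; ring.
Qed.

Lemma is_derive_bgrad x (i j : 'I_n) :
  is_derive x (ebasis R j) (bgrad i) (bhess i j x).
Proof.
have h := is_derive_mul (is_derive_scale (- (2 * A)) (is_derive_sub (is_derive_coord x i j)
  (is_derive_const (c 0 i) x (ebasis R j)))) (is_derive_gbump x j).
by apply: is_derive_eq h _; rewrite /bhess; ring.
Qed.

Lemma is_derive_level x (j : 'I_n) : is_derive x (ebasis R j) level (lgrad j x).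
Proof.
have h := is_derive_add (is_derive_add (is_derive_coord x k j)
  (is_derive_const k0 x (ebasis R j))) (is_derive_scale s (is_derive_gbump x j)).
by apply: is_derive_eq h _; rewrite addr0.
Qed.

Lemma is_derive_lgrad x (i j : 'I_n) :
  is_derive x (ebasis R j) (lgrad i) (lhess i j x).
Proof.
have h := is_derive_add (is_derive_const (k == i)%:R x (ebasis R j))
  (is_derive_scale s (is_derive_bgrad x i j)).
by apply: is_derive_eq h _; rewrite add0r.
Qed.

Lemma gbump_cont x : {for x, continuous gbump}.
Proof.
apply: (@continuous_comp _ _ _ (fun y => - A * sqd c y) expR).
  by apply: continuousM; [exact: cst_continuous | exact: sqd_cont].
exact: continuous_expR.
Qed.

Lemma coordB_cont (i : 'I_n) x : {for x, continuous (fun y : 'rV[R]_n => y 0 i - c 0 i)}.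
Proof. by apply: continuousB; [exact: coord_cont | exact: cst_continuous]. Qed.

Lemma bgrad_cont i x : {for x, continuous (bgrad i)}.
Proof.
apply: continuousM; last exact: gbump_cont.
by apply: continuousM; [exact: cst_continuous | exact: coordB_cont].
Qed.

Lemma bhess_cont i j x : {for x, continuous (bhess i j)}.
Proof.
apply: continuousB; apply: continuousM.
- exact: cst_continuous.
- exact: gbump_cont.
- by apply: continuousM; [exact: cst_continuous | exact: coordB_cont].
- exact: bgrad_cont.
Qed.

Lemma level_cont x : {for x, continuous level}.
Proof.
apply: continuousD.
  by apply: continuousD; [exact: coord_cont | exact: cst_continuous].
by apply: continuousM; [exact: cst_continuous | exact: gbump_cont].
Qed.

Lemma lgrad_cont i x : {for x, continuous (lgrad i)}.
Proof.
apply: continuousD; first exact: cst_continuous.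
by apply: continuousM; [exact: cst_continuous | exact: bgrad_cont].
Qed.

Lemma lhess_cont i j x : {for x, continuous (lhess i j)}.
Proof. by apply: continuousM; [exact: cst_continuous | exact: bhess_cont]. Qed.

Lemma sum_sqr_lgrad x : \sum_i lgrad i x ^+ 2 =
  1 - 4 * A * s * (x 0 k - c 0 k) * gbump x + 4 * A ^+ 2 * s ^+ 2 * sqd c x * gbump x ^+ 2.
Proof.
rewrite /lgrad /bgrad.
transitivity (\sum_i ((k == i)%:R * (1 - 4 * A * s * (x 0 k - c 0 k) * gbump x)
   + 4 * A ^+ 2 * s ^+ 2 * gbump x ^+ 2 * (x 0 i - c 0 i) ^+ 2)).
  apply: eq_bigr => i _; case: eqP => [<-|_] /=; last by ring.
  by ring.
rewrite big_split /= -mulr_suml -mulr_sumr -/(sqd c x).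
have -> : \sum_i ((k == i)%:R : R) = 1.
  by rewrite (bigD1 k) //= eqxx big1 ?addr0 // => i; rewrite eq_sym => /negPf ->.
ring.
Qed.

Lemma sum_lhess x : \sum_i lhess i i x =
  s * gbump x * (2 * A * (2 * A * sqd c x - n%:R)).
Proof.
rewrite /lhess /bhess /bgrad.
transitivity (\sum_(i < n) (s * - (2 * A) * gbump x
   + 4 * A ^+ 2 * s * gbump x * (x 0 i - c 0 i) ^+ 2)).
  by apply: eq_bigr => i _; rewrite eqxx /=; ring.
rewrite big_split /= -!mulr_sumr -/(sqd c x) sumr_const card_ord -[_ *+ n]mulr_natr; ring.
Qed.

Variables (C a s1 : R).
Hypotheses (a1 : 1 < a) (a2 : a < 2).

(** One family for three uses: [a = kappa p] with [s1 > 0] from below, [a = kappa p * (1 + nu)] with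
    [s1 = 0] from above, and the translated profile with [A], [s], [s1] all zero. As 1 < a < 2, the
    gradient is continuous across the zero level while the Hessian is controlled only off it. *)
Definition barrier x : R := C * ppow a (level x) + s1 * level x.
Definition bargrad (i : 'I_n) x : R :=
  (C * (a * ppow (a - 1) (level x)) + s1) * lgrad i x.
Definition barhess (i j : 'I_n) x : R :=
  C * (a * ((a - 1) * ppow (a - 2) (level x) * lgrad j x)) * lgrad i x
  + (C * (a * ppow (a - 1) (level x)) + s1) * lhess i j x.

Lemma is_derive_barrier x (j : 'I_n) :
  is_derive x (ebasis R j) barrier (bargrad j x).
Proof.
have h := is_derive_add
  (is_derive_scale C (is_derive_compR (is_derive_ppow (level x) a1) (is_derive_level x j)))
  (is_derive_scale s1 (is_derive_level x j)).
by apply: is_derive_eq h _; rewrite /bargrad; ring.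
Qed.

Lemma partial_barrier (j : 'I_n) : partial j barrier = bargrad j.
Proof.
by apply/funext => x; exact: (@derive_val _ _ _ _ _ _ _ (is_derive_barrier x j)).
Qed.

Lemma is_derive_bargrad x (i j : 'I_n) : level x != 0 ->
  is_derive x (ebasis R j) (bargrad i) (barhess i j x).
Proof.
move=> lx0.
have d1 : is_derive (level x) 1 (ppow (a - 1)) ((a - 1) * ppow (a - 2) (level x)).
  have -> : a - 2 = a - 1 - 1 by rewrite -addrA -opprD.
  by have [_ _ h0 h1 _] := exponent_signs a1 a2; apply: is_derive_ppow_neq0.
have h := is_derive_mul (is_derive_add (is_derive_scale C (is_derive_scale a
   (is_derive_compR d1 (is_derive_level x j)))) (is_derive_const s1 x (ebasis R j)))
  (is_derive_lgrad x i j).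
by apply: is_derive_eq h _; rewrite addr0 /barhess.
Qed.

Lemma partial2_barrier x (i j : 'I_n) : level x != 0 ->
  partial j (partial i barrier) x = barhess i j x.
Proof.
move=> /is_derive_bargrad h; rewrite partial_barrier.
exact: (@derive_val _ _ _ _ _ _ _ (h i j)).
Qed.

Lemma barrier_cont x : {for x, continuous barrier}.
Proof.
have cp : {for x, continuous (fun y => ppow a (level y))}.
  apply: (@continuous_comp _ _ _ level (ppow a)); first exact: level_cont.
  by have [? ? _ _ _] := exponent_signs a1 a2; apply: ppow_continuous.
by apply: continuousD; apply: continuousM; rewrite //;
  [exact: cst_continuous | exact: cst_continuous | exact: level_cont].
Qed.

Lemma bargrad_cont (i : 'I_n) x : {for x, continuous (bargrad i)}.
Proof.
have cp : {for x, continuous (fun y => ppow (a - 1) (level y))}.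
  apply: (@continuous_comp _ _ _ level (ppow (a - 1))); first exact: level_cont.
  by have [? ? _ _ _] := exponent_signs a1 a2; apply: ppow_continuous.
apply: continuousM; last exact: lgrad_cont.
apply: continuousD; last exact: cst_continuous.
apply: continuousM; first exact: cst_continuous.
by apply: continuousM => //; exact: cst_continuous.
Qed.

Lemma barhess_cont (i j : 'I_n) x : level x != 0 -> {for x, continuous (barhess i j)}.
Proof.
move=> lx0.
have cp1 : {for x, continuous (fun y => ppow (a - 1) (level y))}.
  apply: (@continuous_comp _ _ _ level (ppow (a - 1))); first exact: level_cont.
  by have [? ? _ _ _] := exponent_signs a1 a2; apply: ppow_continuous.
have cp2 : {for x, continuous (fun y => ppow (a - 2) (level y))}.
  apply: (@continuous_comp _ _ _ level (ppow (a - 2))); first exact: level_cont.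
  by have [_ _ _ _ ?] := exponent_signs a1 a2; apply: (@ppow_continuous_neq0 _ (a - 2)).
apply: continuousD; apply: continuousM; rewrite //.
- apply: continuousM; first exact: cst_continuous.
  apply: continuousM; first exact: cst_continuous.
  apply: continuousM; last exact: lgrad_cont.
  by apply: continuousM => //; exact: cst_continuous.
- exact: lgrad_cont.
- apply: continuousD; last exact: cst_continuous.
  apply: continuousM; first exact: cst_continuous.
  by apply: continuousM => //; exact: cst_continuous.
- exact: lhess_cont.
Qed.

Lemma barrier_C1 (U : set 'rV[R]_n) : C1on U barrier.
Proof.
move=> x _; split; first exact: barrier_cont.
move=> i; split; last by rewrite partial_barrier; exact: bargrad_cont.
by have [] := is_derive_barrier x i.
Qed.

Lemma near_level_neq0 x : level x != 0 -> \forall y \near x, level y != 0.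
Proof.
rewrite neq_lt => /orP[lx|lx].
- have h : \forall y \near x, level y < 0.
    exact: (@cvgr_lt _ _ _ _ _ _ (@level_cont x) _ lx).
  by near=> y; rewrite lt_eqF //; near: y.
- have h : \forall y \near x, 0 < level y.
    exact: (@cvgr_gt _ _ _ _ _ _ (@level_cont x) _ lx).
  by near=> y; rewrite gt_eqF //; near: y.
Unshelve. all: by end_near. Qed.

Lemma barrier_C2 (U : set 'rV[R]_n) : (forall x, U x -> level x != 0) -> C2on U barrier.
Proof.
move=> UN; split; first exact: barrier_C1.
move=> x Ux i j; split.
  by rewrite partial_barrier; have [] := is_derive_bargrad i j (UN x Ux).
rewrite /prop_for /continuous_at partial2_barrier ?UN //.
have e : {near x, barhess i j =1 partial j (partial i barrier)}.
  have h := near_level_neq0 (UN x Ux).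
  by near=> y; rewrite partial2_barrier //; near: y.
by apply: (cvg_trans (near_eq_cvg e)); apply: barhess_cont; exact: UN.
Unshelve. all: by end_near. Qed.

Lemma barrier_has_d2 x (j : 'I_n) : level x != 0 ->
  has_d2 barrier x (ebasis R j) (barhess j j x).
Proof.
move=> lx; rewrite -partial2_barrier //.
apply: (@C2on_has_d2 _ _ [set y | level y != 0]); last exact: near_level_neq0.
by apply: barrier_C2.
Qed.

Lemma sum_barhess x : \sum_i barhess i i x =
  C * a * (a - 1) * ppow (a - 2) (level x) * (\sum_i lgrad i x ^+ 2)
  + (C * a * ppow (a - 1) (level x) + s1) * \sum_i lhess i i x.
Proof.
rewrite !mulr_sumr -big_split; apply: eq_bigr => i _ /=; rewrite /barhess; ring.
Qed.

Lemma laplacian_barrier x : level x != 0 ->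
  laplacian barrier x = \sum_i barhess i i x.
Proof. by move=> lx; apply: eq_bigr => i _; rewrite partial2_barrier. Qed.

Lemma level_has_d2 x (j : 'I_n) : has_d2 level x (ebasis R j) (lhess j j x).
Proof.
exists (fun t => lgrad j (x + t *: ebasis R j)); split.
  near=> t; apply: (iffLR (is_derive_line_at level x (ebasis R j) t _)).
  exact: is_derive_level.
apply: (iffLR (is_derive_line (lgrad j) x (ebasis R j) _)); exact: is_derive_lgrad.
Unshelve. all: by end_near. Qed.

End Barrier.

(** * Strict differential inequalities for the barriers *)

Section BarrierSigns.
Context {R : realType} {n : nat} (p : R) (hp : 0 < p < 1).
Implicit Types (c x y z : 'rV[R]_n).

Lemma gbump_gt0 c (A : R) x : 0 < gbump c A x.
Proof. exact: expR_gt0. Qed.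

Lemma gbump_le1 c (A : R) x : 0 <= A -> gbump c A x <= 1.
Proof. by move=> A0; rewrite -expR0 ler_expR mulNr oppr_le0 mulr_ge0 // sqd_ge0. Qed.

Lemma ppow_split (a t : R) : 0 < t -> ppow (a - 1) t = t * ppow (a - 2) t.
Proof.
move=> t0; rewrite !ppow_gt0E // (_ : a - 1 = 1 + (a - 2)); last by lra.
by rewrite (@powRD _ t 1) ?(gt_eqF t0) ?implybT // powRr1 // ltW.
Qed.

(* The positive part of the extra linear term [s1 * level] only helps, since
   [t `^ (p - 1)] is decreasing; it is there to give the barrier a non-zero
   gradient on its zero set. *)
Lemma sub_barrier (k : 'I_n) c (A s k0 s1 : R) x :
  0 < A -> 0 < s -> 0 < s1 -> 0 <= c 0 k + k0 ->
  n%:R + 2 <= 2 * A * sqd c x -> level k c A s k0 x != 0 ->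
  posrhs p (barrier k c A s k0 (cp p) (kappa p) s1 x) <
  \sum_i barhess k c A s k0 (cp p) (kappa p) s1 i i x.
Proof.
move=> A0 s0 s10 h0 Aq; set g := level _ _ _ _ _ _ => g0.
have k1 := kappa_gt1 hp; have k2 := kappa_lt2 hp; have C0 := cp_gt0 hp.
have /andP[p0 p1] := hp.
rewrite sum_barhess sum_sqr_lgrad sum_lhess -/g.
have e0 := gbump_gt0 c A x.
set e := gbump c A x in e0 *; set y := x 0 k - c 0 k; set q := sqd c x in Aq *.
have q0 : 0 <= q := sqd_ge0 c x.
have gE : g = y + (c 0 k + k0) + s * e by rewrite /g /level -/e /y; ring.
have se0 : 0 < s * e by rewrite mulr_gt0.
set H := s * e * (2 * A * (2 * A * q - n%:R)).
have H0 : 0 < H by rewrite mulr_gt0 // mulr_gt0 ?mulr_gt0 //; lra.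
have barE : barrier k c A s k0 (cp p) (kappa p) s1 x = u0 p g + s1 * g by [].
move: g0; rewrite neq_lt => /orP[gn|gp].
(* Below the zero level only the linear term survives: the right-hand side is 0 there and the
   Laplacian is [s1 * H], which is positive. *)
- rewrite !ppow_le0 ?mulr0 ?mul0r ?add0r ?(ltW gn) //; last 2 first.
  + by rewrite gt_eqF // subr_gt0.
  + by rewrite lt_eqF // subr_lt0.
  rewrite /posrhs barE u0_le0 ?(ltW gn) // add0r.
  by rewrite pmulr_rgt0 // (ltNge 0 g) (ltW gn) /= mulr_gt0.
- have u0g := u0_gt0 hp gp.
  have bp : u0 p g <= u0 p g + s1 * g by rewrite lerDl mulr_ge0 // ltW.
  rewrite /posrhs barE (lt_le_trans u0g bp).
  apply: (@le_lt_trans _ _ (u0 p g `^ (p - 1))).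
    by apply: powR_npos_le => //; rewrite subr_le0 ltW.
  rewrite -(u0_ode hp gp) (ppow_split _ gp).
  have P0 := ppow_gt0 (kappa p - 2) gp; move: (ppow (kappa p - 2) g) P0 => P P0.
  (* Divided by [cp p * kappa p * g^(kappa-2)], the inequality for u0(g) reads (kappa - 1) (|grad
     g|^2 - 1) + g * Lap g >= 0. Strictness is supplied afterwards by [s1 * H]. *)
  have main : 0 <= (kappa p - 1) * (4 * A ^+ 2 * s ^+ 2 * q * e ^+ 2 - 4 * A * s * y * e) + g * H.
    have -> : (kappa p - 1) * (4 * A ^+ 2 * s ^+ 2 * q * e ^+ 2 - 4 * A * s * y * e) + g * H
      = (kappa p - 1) * (4 * A ^+ 2 * q * (s * e) ^+ 2) + 2 * A * (s * e) *
        (g * (2 * A * q - n%:R) - 2 * (kappa p - 1) * y) by rewrite /H; ring.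
    apply: addr_ge0.
      rewrite mulr_ge0 ?subr_ge0 ?(ltW k1) // mulr_ge0 ?sqr_ge0 //.
      by rewrite mulr_ge0 // mulr_ge0 // sqr_ge0.
    apply: mulr_ge0; first by rewrite mulr_ge0 ?mulr_ge0 // ltW.
    (* For [y <= 0] the first-order term has the right sign. For [y > 0] the level exceeds [y], and
       [2 * A * q - n%:R >= 2] beats the factor 2 (kappa - 1). *)
    rewrite subr_ge0; have [y0|y0] := lerP y 0.
      apply: (@le_trans _ _ 0); first by rewrite mulr_ge0_le0 // mulr_ge0 // subr_ge0 ltW.
      by rewrite mulr_ge0 ?(ltW gp) //; lra.
    apply: (@le_trans _ _ (2 * y)).
      by rewrite ler_wpM2r ?(ltW y0) //; lra.
    have yg : y <= g by lra.
    by rewrite mulrC; apply: ler_pM => //; lra.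
  have s1H : 0 < s1 * H by rewrite mulr_gt0.
  set M := (kappa p - 1) * _ + g * H in main.
  have CM : 0 <= cp p * kappa p * P * M.
    by rewrite mulr_ge0 // mulr_ge0 ?(ltW P0) // mulr_ge0 ?(ltW C0) //; lra.
  set Z := (X in _ < X).
  have -> : Z = cp p * (kappa p * (kappa p - 1) * P) + (cp p * kappa p * P * M + s1 * H).
    by rewrite /Z /M; ring.
  by rewrite ltrDl ltr_wpDl.
Qed.

(** The left side is the Laplacian of u0(g) up to the factor [cp p * kappa p * g^(kappa-2)]. The
    terms linear in [s] make it smaller than kappa - 1, and the quadratic one is absorbed because
    [4 * A * s] is at most the height [c 0 k + k0]. The 16 is twice the inverse of the least height
    1/8. *)
Lemma super_barrier_slope (k : 'I_n) c (A s k0 e0 : R) x :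
  0 < A -> 0 < s -> 8^-1 <= c 0 k + k0 -> 4 * s <= c 0 k + k0 ->
  4 * A * s <= c 0 k + k0 -> sqd c x <= 1 -> n%:R + 3 <= 2 * A * sqd c x ->
  0 < e0 <= gbump c A x -> 0 < level k c A (- s) k0 x ->
  (kappa p - 1) * (\sum_i lgrad k c A (- s) i x ^+ 2) +
    level k c A (- s) k0 x * \sum_i lhess c A (- s) i i x <=
  (kappa p - 1) * (1 - A * s * e0 / 16).
Proof.
move=> A0 s0 h8 h1 h2 q1 Aq /andP[e00 e0e]; set g := level _ _ _ _ _ _ => g0.
have k1 := kappa_gt1 hp; have k2 := kappa_lt2 hp.
rewrite sum_sqr_lgrad sum_lhess.
have el1 := gbump_le1 c x (ltW A0); have ep := gbump_gt0 c A x.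
set e := gbump c A x in e0e el1 ep *; set y := x 0 k - c 0 k; set q := sqd c x in Aq q1 *.
have q0 : 0 <= q := sqd_ge0 c x.
set h := c 0 k + k0 in h8 h1 h2.
have gE : g = y + h - s * e by rewrite /g /level -/e /y /h; ring.
set K := kappa p - 1; have K0 : 0 < K by rewrite /K; lra.
have K1 : K < 1 by rewrite /K; lra.
have se : s * e <= s by rewrite ger_pMr.
have se0 : 0 < s * e by rewrite mulr_gt0.
have err : K * (2 * A * s * q * e) <= K * (h / 2).
  rewrite ler_wpM2l ?(ltW K0) //; apply: (@le_trans _ _ (2 * A * s)); last by lra.
  have As0 : 0 <= 2 * A * s by rewrite mulr_ge0 ?mulr_ge0 // ltW.
  by rewrite -mulrA ger_pMr ?mulr_ile1 //; [exact: ltW | rewrite mulr_gt0 ?mulr_gt0].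
(* Three ranges: far below c the term [- 2 * K * y] suffices; slightly below c the level is at least
   [h / 4]; above c the level exceeds [y]. The 3 in [n%:R + 3] gives the margin needed in the middle
   range. *)
have br : K * (h / 4) <= g * (2 * A * q - n%:R) - 2 * K * y - K * (2 * A * s * q * e).
  suff : K * (h / 4) + K * (h / 2) <= g * (2 * A * q - n%:R) - 2 * K * y by lra.
  have g3 : g * 3 <= g * (2 * A * q - n%:R) by rewrite ler_wpM2l ?(ltW g0) //; lra.
  apply: le_trans (lerB g3 (lexx _)).
  have Kh0 : 0 <= K * h by rewrite mulr_ge0 ?(ltW K0) //; lra.
  have [y1|y1] := lerP y (- (h / 2)).
    have : K * y <= K * (- (h / 2)) by rewrite ler_wpM2l ?(ltW K0).
    lra.
  have g4 : h / 4 <= g by lra.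
  have Kh : K * h <= h by rewrite ger_pMl //; lra.
  have [y0|y0] := lerP y 0.
    have : K * y <= 0 by rewrite mulr_ge0_le0 // ltW.
    lra.
  have : K * y <= y by rewrite ger_pMl //; lra.
  lra.
have -> : K * (1 - 4 * A * - s * y * e + 4 * A ^+ 2 * (- s) ^+ 2 * q * e ^+ 2) +
   g * (- s * e * (2 * A * (2 * A * q - n%:R))) =
   K - 2 * A * (s * e) * (g * (2 * A * q - n%:R) - 2 * K * y - K * (2 * A * s * q * e)).
  by ring.
rewrite [leRHS]mulrBr mulr1 lerB //.
apply: (@le_trans _ _ (2 * A * (s * e) * (K * (h / 4)))); last first.
  by rewrite ler_wpM2l // mulr_ge0 ?mulr_ge0 // ltW.
have -> : 2 * A * (s * e) * (K * (h / 4)) = K * (A * s * e * (h / 2)) by field.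
rewrite ler_wpM2l ?(ltW K0) //.
have As0 : 0 <= A * s by rewrite mulr_ge0 ?ltW.
apply: ler_pM; rewrite ?mulr_ge0 ?(ltW e00) ?invr_ge0 ?ler_wpM2l //; lra.
Qed.

(** Raising the exponent costs a factor [1 + nu], an extra [kappa p * nu * |grad g|^2] and a factor
    g^(-2 nu) on the right; the last hypothesis says that these costs are smaller than the gain of
    [super_barrier_slope]. *)
Lemma super_barrier (k : 'I_n) c (A s k0 e0 nu T : R) x :
  0 < A -> 0 < s <= 1 -> 8^-1 <= c 0 k + k0 -> 4 * s <= c 0 k + k0 ->
  4 * A * s <= c 0 k + k0 -> sqd c x <= 1 -> n%:R + 3 <= 2 * A * sqd c x ->
  0 < e0 <= gbump c A x -> 0 < level k c A (- s) k0 x <= T ->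
  0 < nu -> 1 <= T ->
  (1 + nu) * ((kappa p - 1) * (1 - A * s * e0 / 16)
     + kappa p * nu * (1 + 4 * A + 4 * A ^+ 2)) <
    (kappa p - 1) * (1 - 2 * nu * ln T) ->
  \sum_i barhess k c A (- s) k0 (cp p) (kappa p * (1 + nu)) 0 i i x <
  barrier k c A (- s) k0 (cp p) (kappa p * (1 + nu)) 0 x `^ (p - 1).
Proof.
move=> A0 /andP[s0 s1] h8 h1 h2 q1 Aq he /andP[g0 gT] nu0 T1 hnu.
have slope := super_barrier_slope A0 s0 h8 h1 h2 q1 Aq he g0.
have k1 := kappa_gt1 hp; have k2 := kappa_lt2 hp; have C0 := cp_gt0 hp.
rewrite sum_barhess addr0 (ppow_split _ g0) /barrier mul0r addr0.
have S2 : \sum_i lgrad k c A (- s) i x ^+ 2 <= 1 + 4 * A + 4 * A ^+ 2.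
  rewrite sum_sqr_lgrad.
  have el1 := gbump_le1 c x (ltW A0); have ep := gbump_gt0 c A x.
  have y1 : `|x 0 k - c 0 k| <= 1 by apply: coord_sqd_le; rewrite ?expr1n.
  move: (gbump c A x) el1 ep (x 0 k - c 0 k) y1 => e el1 ep y; rewrite ler_norml => /andP[y1 y2].
  have t1 : s * y * e <= 1.
    have se1 : s * e <= 1 by rewrite mulr_ile1 // ltW.
    have se0 : 0 <= s * e by rewrite mulr_ge0 // ltW.
    rewrite mulrAC; apply: (@le_trans _ _ (s * e)) => //.
    by rewrite -[leRHS]mulr1 ler_wpM2l.
  have t2 : s ^+ 2 * (sqd c x * e ^+ 2) <= 1.
    have e2 : e ^+ 2 <= 1 by rewrite expr_le1 // ltW.
    have s2 : s ^+ 2 <= 1 by rewrite expr_le1 // ltW.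
    have qe : sqd c x * e ^+ 2 <= 1 by apply: mulr_ile1; rewrite ?sqd_ge0 ?sqr_ge0.
    by apply: mulr_ile1 => //; rewrite ?sqr_ge0 // mulr_ge0 ?sqd_ge0 ?sqr_ge0.
  have -> : 1 - 4 * A * - s * (y) * e + 4 * A ^+ 2 * (- s) ^+ 2 * sqd c x * e ^+ 2 =
    1 + 4 * A * (s * y * e) + 4 * A ^+ 2 * (s ^+ 2 * (sqd c x * e ^+ 2)) by ring.
  rewrite !lerD // -[leRHS]mulr1 ler_wpM2l // mulr_ge0 ?sqr_ge0 //.
  exact: ltW.
set g := level _ _ _ _ _ _ in g0 gT slope *.
set SS := \sum_i lgrad _ _ _ _ _ _ ^+ 2 in S2 slope *.
set H := \sum_i lhess _ _ _ _ _ _ in slope *.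
set rho := A * s * e0 / 16 in slope hnu; set G1 := 1 + 4 * A + 4 * A ^+ 2 in S2 hnu.
have SS0 : 0 <= SS by apply: sumr_ge0 => i _; exact: sqr_ge0.
rewrite !ppow_gt0E // powRM ?powR_ge0 ?(ltW C0) // -powRrM.
have -> : kappa p * (1 + nu) * (p - 1) = (kappa p * (1 + nu) - 2) + - (2 * nu).
  have e : kappa p * (1 + nu) * (p - 1) =
     kappa p * (1 + nu) + (kappa p * (p - 2)) * (1 + nu) by ring.
  by rewrite e kappaMpB2 //; ring.
rewrite (_ : p - 1 = 1 + (p - 2)); last by lra.
rewrite (@powRD _ (cp p) 1) ?(gt_eqF C0) ?implybT // powRr1 ?(ltW C0) // cp_powB2 //.
rewrite (@powRD _ g (kappa p * (1 + nu) - 2)) ?(gt_eqF g0) ?implybT //.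
have P0 : 0 < g `^ (kappa p * (1 + nu) - 2) by apply: powR_gt0.
move: (g `^ (kappa p * (1 + nu) - 2)) P0 => P P0.
(* The factor g^(-2 nu) may be small for large [g]; the bound [g <= T] keeps it close to 1. *)
have gnu : 1 - 2 * nu * ln T <= g `^ (- (2 * nu)).
  have Tp : 0 < T by lra.
  apply: (@le_trans _ _ (T `^ (- (2 * nu)))).
    by rewrite /powR gt_eqF // -mulNr; apply: le_trans (expR_ge1Dx _); rewrite mulNr.
  by apply: powR_npos_le => //; rewrite oppr_le0 mulr_ge0 // ltW.
have kp : 0 < kappa p by lra.
have main : (1 + nu) * ((kappa p * (1 + nu) - 1) * SS + g * H) <
            (kappa p - 1) * g `^ (- (2 * nu)).
  apply: (@lt_le_trans _ _ ((kappa p - 1) * (1 - 2 * nu * ln T))); last first.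
    by rewrite ler_wpM2l //; lra.
  apply: le_lt_trans hnu; rewrite ler_wpM2l //; first by lra.
  have -> : (kappa p * (1 + nu) - 1) * SS + g * H =
    ((kappa p - 1) * SS + g * H) + kappa p * nu * SS by ring.
  by rewrite lerD // ler_wpM2l // mulr_ge0 // ltW.
have := main; rewrite -(ltr_pM2l (mulr_gt0 (mulr_gt0 C0 kp) P0)).
by congr (is_true (_ < _)); ring.
Qed.

(** At [nu = 0] each condition holds with room to spare, measured by [2 - kappa p], [rho] or [b], so
    a small [nu] works. The last two conditions exchange the exponents kappa and kappa (1 + nu) on
    [0, T] at the price of a shift by [b]. *)
Lemma exists_exponent (rho G T b : R) :
  0 < rho -> 0 <= G -> 1 <= T -> 0 < b <= 1 ->
  exists nu : R, [/\ 0 < nu, kappa p * (1 + nu) < 2,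
    (1 + nu) * ((kappa p - 1) * (1 - rho) + kappa p * nu * G) <
      (kappa p - 1) * (1 - 2 * nu * ln T),
    (forall t, 0 <= t <= T -> t `^ kappa p <= (t + b) `^ (kappa p * (1 + nu))) &
    (forall t, 0 <= t <= T -> t `^ (kappa p * (1 + nu)) <= (t + b) `^ kappa p)].
Proof.
move=> rho0 G0 T1 /andP[b0 b1].
have k1 := kappa_gt1 hp; have k2 := kappa_lt2 hp.
have Tp : 0 < T by lra.
have L0 : 0 <= ln T by rewrite ln_ge0.
have l0 : 0 <= - ln b by rewrite oppr_ge0 ln_le0.
have small (c d : R) : 0 < c -> 0 <= d -> \forall nu \near (0 : R)^'+, nu * d < c.
  move=> c0 d0; have d1 : 0 < d + 1 by lra.
  near=> nu; have nu0 : 0 < nu by near: nu; exact: nbhs_right_gt.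
  have : nu < c / (d + 1) by near: nu; apply: nbhs_right_lt; exact: divr_gt0.
  by rewrite ltr_pdivlMr // mulrDr mulr1; lra.
(* Every requirement is reduced to one linear in [nu], with coefficients depending on [rho], [G],
   [T] and [b]. *)
have [nu [nu0 [nu1 [c2 [c3 [c4 [c5 c6]]]]]]] : exists nu : R, 0 < nu /\
    nu * 1 < 1 /\ nu * 2 < 2 - kappa p /\
    nu * (1 + 4 * G + 2 * ln T) < (kappa p - 1) * rho /\
    nu * ((T + 1) * - ln b) < b /\ nu * (2 * T * ln T) < b /\ nu * ln T < 2^-1.
  near (0 : R)^'+ => nu; exists nu; split; first by near: nu; exact: nbhs_right_gt.
  split; first by near: nu; exact: small.
  split; first by near: nu; apply: small => //; rewrite subr_gt0.
  split.
    near: nu; apply: small; first by rewrite mulr_gt0 // subr_gt0.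
    by rewrite !addr_ge0 // mulr_ge0.
  split.
    by near: nu; apply: small => //; rewrite mulr_ge0 // addr_ge0 // ltW.
  split; last by near: nu; apply: small => //; rewrite invr_gt0.
  by near: nu; apply: small => //; rewrite mulr_ge0 // mulr_ge0 // ltW.
clear small; exists nu; split=> //.
- have : kappa p * nu <= 2 * nu by rewrite ler_wpM2r ?(ltW nu0) // ltW.
  lra.
- have kn : kappa p * nu * G <= 2 * nu * G.
    by rewrite ler_wpM2r // ler_wpM2r ?(ltW nu0) // ltW.
  have knn : kappa p * nu * G * nu <= 2 * nu * G.
    apply: le_trans kn; rewrite -[leRHS]mulr1 ler_wpM2l //; last by lra.
    by rewrite mulr_ge0 // mulr_ge0 ?(ltW nu0) //; lra.
  have kr : (kappa p - 1) * nu * (1 - rho) <= nu.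
    apply: (@le_trans _ _ (1 * nu * 1)); last by lra.
    have kn0 : 0 <= (kappa p - 1) * nu by rewrite mulr_ge0 ?(ltW nu0) //; lra.
    apply: (@le_trans _ _ ((kappa p - 1) * nu * 1)); first by rewrite ler_wpM2l //; lra.
    by rewrite !mulr1 ler_wpM2r ?(ltW nu0) //; lra.
  have kl : (kappa p - 1) * (nu * ln T) <= nu * ln T.
    by rewrite ler_piMl ?mulr_ge0 ?(ltW nu0) //; lra.
  lra.
- move=> t /andP[t0 tT].
  have tb : 0 < t + b by lra.
  rewrite [kappa p * _]mulrC (powRrM (t + b) (1 + nu)).
  apply: ge0_ler_powR; rewrite ?nnegrE ?powR_ge0 //; first by lra.
  rewrite (@powRD _ (t + b) 1) ?(gt_eqF tb) ?implybT // powRr1 ?(ltW tb) //.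
  (* Since [t + b >= b], the power (t + b)^nu is at least 1 - nu |ln b|, and the loss (T + 1) nu |ln
     b| is below [b]. *)
  have h1 : 1 + nu * ln b <= (t + b) `^ nu.
    apply: (@le_trans _ _ (b `^ nu)).
      by rewrite /powR gt_eqF //; exact: expR_ge1Dx.
    by apply: ge0_ler_powR; rewrite ?nnegrE ?(ltW nu0) ?(ltW b0) ?(ltW tb) //; lra.
  apply: (@le_trans _ _ ((t + b) * (1 + nu * ln b))); last by rewrite ler_wpM2l // ltW.
  have : (t + b) * (nu * - ln b) <= (T + 1) * (nu * - ln b).
    by rewrite ler_wpM2r ?mulr_ge0 ?(ltW nu0) //; lra.
  lra.
- move=> t /andP[t0 tT].
  rewrite [kappa p * _]mulrC (powRrM t (1 + nu)).
  apply: ge0_ler_powR; rewrite ?nnegrE ?powR_ge0 //; try lra.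
  move: t0; rewrite le_eqVlt => /orP[/eqP <-|t0].
    by rewrite powR0 ?gt_eqF //; lra.
  rewrite (@powRD _ t 1) ?(gt_eqF t0) ?implybT // powRr1 ?(ltW t0) //.
  (* With [nu * ln T <= 1 / 2], the bound exp z <= 1 / (1 - z) gives exp z <= 1 + 2 z. *)
  have h1 : t `^ nu <= 1 + 2 * (nu * ln T).
    apply: (@le_trans _ _ (T `^ nu)).
      by apply: ge0_ler_powR; rewrite ?nnegrE ?(ltW nu0) ?(ltW t0) ?(ltW Tp) //.
    rewrite /powR gt_eqF //; set z := nu * ln T in c6 *.
    have z0 : 0 <= z by rewrite mulr_ge0 // ltW.
    have ez := expR_ge1Dx (- z).
    have ee : expR z * expR (- z) = 1 by rewrite -expRD subrr expR0.
    have : expR z * (1 - z) <= 1.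
      apply: (@le_trans _ _ (expR z * expR (- z))); last by rewrite ee.
      by rewrite ler_wpM2l ?expR_ge0.
    have := expR_gt0 z; nra.
  apply: (@le_trans _ _ (t * (1 + 2 * (nu * ln T)))); first by rewrite ler_wpM2l // ltW.
  have : t * (nu * ln T) <= T * (nu * ln T).
    by rewrite ler_wpM2r ?mulr_ge0 ?(ltW nu0).
  lra.
Unshelve. all: by end_near. Qed.

End BarrierSigns.

(** * Comparison with sliding barriers *)

(** The ball of radius 1/2 around this point contains a neighbourhood of the origin and stays inside
    the ball of radius 3/4. *)
Definition cen {R : realType} {n : nat} (k : 'I_n) : 'rV[R]_n := 4^-1 *: ebasis R k.

(** * Comparison from below *)

Section Lower.
Context {R : realType} {n : nat}.
Implicit Types (x y z : 'rV[R]_n).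

Lemma cen_coord (k : 'I_n) : (cen k : 'rV[R]_n) 0 k = 4^-1.
Proof. by rewrite !mxE !eqxx mulr1. Qed.

Lemma sqd_cen (k : 'I_n) x : sqd (cen k) x = sqd 0 x - x 0 k / 2 + 16^-1.
Proof.
rewrite sqdC -[cen k]add0r sqd_line [sqd x 0]sqdC mxE; lra.
Qed.

Lemma sqd_cen_le (k : 'I_n) x : sqd (cen k) x <= 4^-1 ->
  [/\ eball 0 1 x, sqd 0 x <= 9 / 16 & `|x 0 k - 4^-1| <= 2^-1].
Proof.
move=> h; have h2 : `|x 0 k - 4^-1| <= 2^-1.
  rewrite -{1}(cen_coord k); apply: coord_sqd_le; first by rewrite invr_ge0.
  by apply: le_trans h _; rewrite exprVn lef_pV2 ?posrE //; lra.
have h3 : sqd 0 x <= 9 / 16.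
  by move: h h2; rewrite sqd_cen ler_norml => h /andP[h1 h2]; lra.
by split=> //; apply/eballE => //; rewrite expr1n; lra.
Qed.

Lemma near_box_ex x (P : 'rV[R]_n -> Prop) : (\forall y \near x, P y) ->
  exists2 d : R, 0 < d & forall y, (forall j, `|y 0 j - x 0 j| < d) -> P y.
Proof.
move=> /nbhs_ballP[d /= d0 h]; exists d => // y hy; apply: h.
by split=> // i j; rewrite (ord1 i) /ball /= distrC.
Qed.

Lemma near_eball_ex x (P : 'rV[R]_n -> Prop) : (\forall y \near x, P y) ->
  exists2 d : R, 0 < d & forall y, eball x d y -> P y.
Proof.
move=> /near_box_ex[d d0 h]; exists d => // y /(eballE _ _ (ltW d0)) hy.
by apply: h => j; exact: coord_sqd_lt.
Qed.

(** Subtracting [s * expR (- A * 4^-1)] cancels the bump on the outer sphere, where the barrier is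
    thus the datum shifted down. [Hini] excludes contact there and [Hin] excludes it on the inner
    sphere. In between, a contact is impossible where [u] is non-zero by the equation, on the free
    boundary by the viscosity condition, and where [u] vanishes nearby because the level has a
    positive Laplacian. *)
Lemma lower_sliding (m : nat) (p : R) (u : 'rV[R]_n -> 'rV[R]_m) (k : 'I_n)
    (i1 : 'I_m) (A s be s1 a del : R) :
  0 < p < 1 -> visc_sol p (eball 0 1) u ->
  0 < A -> 0 < s -> 0 < be -> 0 < s1 -> be + 2 * s <= 4^-1 + a ->
  n%:R + 2 <= 2 * A * del ^+ 2 ->
  (forall x, sqd (cen k) x <= 4^-1 ->
     u0 p (x 0 k + a - be) + s1 * (x 0 k + a - be) <= u x 0 i1) ->
  (forall x, sqd (cen k) x <= del ^+ 2 ->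
     u0 p (x 0 k + a + s) + s1 * `|x 0 k + a + s| < u x 0 i1) ->
  forall x, del ^+ 2 <= sqd (cen k) x <= 4^-1 ->
    barrier k (cen k) A s (a - be - s * expR (- A * 4^-1)) (cp p) (kappa p) s1 x
      <= u x 0 i1.
Proof.
move=> hp hu A0 s0 be0 s10 ha Ad Hini Hin.
have k1 := kappa_gt1 hp; have k2 := kappa_lt2 hp.
set c := cen k; set eR := expR (- A * 4^-1).
have eR0 : 0 < eR by exact: expR_gt0.
have eR1 : eR <= 1 by rewrite /eR -expR0 ler_expR mulNr oppr_le0 mulr_ge0 // ltW.
pose k0 mu := a - be - s * eR - mu.
pose F t := u0 p t + s1 * t.
have Fle t t' : t <= t' -> F t <= F t'.
  by move=> tt; apply: lerD; [exact: u0_homo | rewrite ler_wpM2l // ltW].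
have Flt t t' : t < t' -> F t < F t'.
  by move=> tt; apply: ler_ltD; [apply: u0_homo => //; exact: ltW | rewrite ltr_pM2l].
have Fcont : continuous F.
  move=> t; apply: continuousD; first exact: u0_continuous.
  by apply: continuousM; [exact: cst_continuous | exact: cvg_id].
pose L mu x := level k c A s (k0 mu) x.
have LE mu x : L mu x = L 0 x - mu by rewrite /L /level /k0; ring.
pose phi mu := barrier k c A s (k0 mu) (cp p) (kappa p) s1.
have phiE mu x : phi mu x = F (L mu x) by [].
pose K : set 'rV[R]_n := [set x | del ^+ 2 <= sqd c x <= 4^-1].
pose P mu x := phi mu x <= u x 0 i1.
have KB x : K x -> eball 0 1 x by move=> /andP[_ /sqd_cen_le []].
suff : forall x, K x -> P 0 x by move=> H x Kx; have := H x Kx; rewrite /P /phi /k0 subr0.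
have L0le x : L 0 x <= x 0 k + a - be - s * eR + s.
  rewrite /L /level /k0 subr0.
  have : s * gbump c A x <= s by rewrite ger_pMr // gbump_le1 // ltW.
  by lra.
have ucont z : K z -> {for z, continuous (fun y => u y 0 i1)}.
  by move=> /KB; exact: (u_coord_cont hu).
apply: (@sliding _ _ K P s); [exact: (@compact_sqd _ _ c) | exact: ltW | | | |].
- move=> x t t' tt' Pt; apply: le_trans Pt; rewrite !phiE; apply: Fle.
  by rewrite [leLHS]LE [leRHS]LE; lra.
- move=> x /andP[_ x4]; apply: le_trans (Hini x x4); rewrite phiE; apply: Fle.
  rewrite LE; have := L0le x; have : 0 < s * eR by rewrite mulr_gt0.
  by lra.
- move=> x mu Kx hmu; rewrite /P leNgt; apply/negP => hlt.
  have hc : {for mu, continuous (fun t => F (L 0 x - t))}.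
    apply: (@continuous_comp _ _ _ (fun t => L 0 x - t) F); last exact: Fcont.
    by apply: continuousB; [exact: cst_continuous | exact: cvg_id].
  have hn : \forall t \near mu, u x 0 i1 < F (L 0 x - t).
    by apply: (@cvgr_gt _ _ _ _ _ _ hc); rewrite -LE -phiE.
  near mu^'+ => t.
  have t1 : u x 0 i1 < F (L 0 x - t) by near: t; exact: cvg_within hn.
  have t2 : mu < t by near: t; exact: nbhs_right_gt.
  by have := hmu t t2; rewrite /P phiE LE leNgt t1.
- move=> mu z /andP[mu0 mus] Pmu Kz.
  have [hlt|hge] := ltP (phi mu z) (u z 0 i1).
    have hc : {for mu, continuous (fun t => F (L 0 z - t))}.
      apply: (@continuous_comp _ _ _ (fun t => L 0 z - t) F); last exact: Fcont.
      by apply: continuousB; [exact: cst_continuous | exact: cvg_id].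
    have hn : \forall t \near mu, F (L 0 z - t) < u z 0 i1.
      by apply: (@cvgr_lt _ _ _ _ _ _ hc); rewrite -LE -phiE.
    near mu^'- => t; exists t; first by near: t; exact: nbhs_left_lt.
    have t1 : F (L 0 z - t) < u z 0 i1 by near: t; exact: cvg_within hn.
    have dc : {for z, continuous (fun y => u y 0 i1 - phi t y)}.
      by apply: continuousB; [exact: ucont | exact: barrier_cont].
    have dn : \forall y \near z, 0 < u y 0 i1 - phi t y.
      by apply: (@cvgr_gt _ _ _ _ _ _ dc); rewrite subr_gt0 phiE LE.
    near=> y => _; rewrite /P -subr_ge0 ltW //; near: y; exact: dn.
  have e : u z 0 i1 = phi mu z.
    by apply/eqP; rewrite eq_le hge; exact: Pmu.
  exfalso; have Kz' := Kz; move: Kz' => /andP[z1 z2].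
  have [Bz _ _] := sqd_cen_le z2.
  have [zin|zout] := lerP (sqd c z) (del ^+ 2).
    have := Hin z zin; rewrite e phiE; apply/negP; rewrite -leNgt.
    apply: (@le_trans _ _ (F (z 0 k + a + s))).
      apply: Fle; rewrite LE; have := L0le z; have : 0 < s * eR by rewrite mulr_gt0.
      by lra.
    by rewrite /F lerD2l ler_wpM2l ?(ltW s10) // ler_norm.
  move: z2; rewrite le_eqVlt => /orP[/eqP z4|z4].
    have z4' : sqd (cen k) z <= 4^-1 by rewrite -/c z4.
    have := Hini z z4'; rewrite e phiE; apply/negP; rewrite -ltNge; apply: Flt.
    by rewrite LE /L /level /k0 /gbump z4 -/eR; lra.
  have nK : \forall y \near z, del ^+ 2 < sqd c y /\ sqd c y < 4^-1.
    by near=> y; split; near: y; [exact: near_sqd_gt | exact: near_sqd_lt].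
  have KP y : del ^+ 2 < sqd c y /\ sqd c y < 4^-1 -> P mu y.
    by move=> [y1 y2]; apply: Pmu; rewrite /K /= !ltW.
  have A2 y : del ^+ 2 < sqd c y /\ sqd c y < 4^-1 -> n%:R + 2 <= 2 * A * sqd c y.
    by move=> [y1 _]; apply: le_trans Ad _; rewrite ler_wpM2l ?mulr_ge0 // ltW.
  have A2z : n%:R + 2 <= 2 * A * sqd c z by exact: A2.
  have k00 : 0 <= c 0 k + k0 mu.
    have : s * eR <= s by rewrite ger_pMr.
    by rewrite cen_coord /k0; lra.
  have sub y : del ^+ 2 < sqd c y /\ sqd c y < 4^-1 -> L mu y != 0 ->
      posrhs p (phi mu y) < \sum_i barhess k c A s (k0 mu) (cp p) (kappa p) s1 i i y.
    by move=> hy Ly; apply: sub_barrier => //; exact: A2.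
  have lh0 : 0 < \sum_i lhess c A s i i z.
    rewrite sum_lhess mulr_gt0 ?mulr_gt0 ?gbump_gt0 //.
    by rewrite subr_gt0; apply: lt_le_trans A2z; rewrite ltrDl.
  have nP : \forall y \near z, P mu y.
    by near=> y; apply: KP; near: y.
  have [uz|uz] := ltP 0 (enorm (u z)).
    have pz : posset (eball 0 1) u z by [].
    (* At a nonpositive level the barrier may be singular, so the smaller function [s1 * L] is used
       instead: it touches at [z] with positive Laplacian, while [u^1] is nonpositive there and so
       has nonpositive Laplacian. *)
    have [Lz|Lz] := lerP (L mu z) 0.
      have uz1 : u z 0 i1 = s1 * L mu z by rewrite e phiE /F u0_le0 // add0r.
      have := @lower_test _ _ _ _ _ hu (fun y => s1 * L mu y) _ z i1 pz
        (fun j => has_d2Z s1 (level_has_d2 k c A s (k0 mu) z j)).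
      move=> H; have : \sum_j s1 * lhess c A s j j z <=
          enorm (u z) `^ (p - 2) * u z 0 i1.
        apply: H; near=> y; rewrite -uz1 lerD2r.
        have : P mu y by near: y.
        by apply: le_trans; rewrite phiE /F lerDr u0_ge0.
      rewrite -mulr_sumr; apply/negP; rewrite -ltNge.
      apply: (@le_lt_trans _ _ 0); last exact: mulr_gt0.
      by rewrite mulr_ge0_le0 ?powR_ge0 // uz1 mulr_ge0_le0 // ltW.
    have Lz0 : L mu z != 0 by rewrite gt_eqF.
    have := sub z (conj zout z4) Lz0; apply/negP; rewrite -leNgt.
    have phi0 : 0 < phi mu z.
      by rewrite phiE /F ltr_wpDl ?u0_ge0 // mulr_gt0.
    rewrite /posrhs phi0 -e.
    have u10 : 0 < u z 0 i1 by rewrite e.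
    have := @lower_test _ _ _ _ _ hu (phi mu) _ z i1 pz
        (fun j => barrier_has_d2 (cp p) s1 k1 k2 j Lz0).
    move=> H; apply: (le_trans (H _)).
      near=> y; rewrite e lerD2r.
      by have : P mu y by near: y.
    rewrite (_ : p - 1 = (p - 2) + 1); last by lra.
    rewrite [leRHS]powRD; last by rewrite (gt_eqF u10) implybT.
    rewrite powRr1 ?(ltW u10) // ler_wpM2r ?(ltW u10) //.
    apply: powR_npos_le => //; first by case/andP: hp => ? ?; lra.
    by apply: le_trans (coord_enorm _ i1); exact: ler_norm.
  have uz0 : u z = 0.
    by apply: enorm_eq0; apply/eqP; rewrite eq_le uz enorm_ge0.
  have phiz : phi mu z = 0 by rewrite -e uz0 mxE.
  have Lz : L mu z = 0.
    apply/eqP; case: (ltgtP (L mu z) 0) => // /Flt.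
      by rewrite -phiE phiz /F u0_le0 // mulr0 addr0 ltxx.
    by rewrite -phiE phiz /F u0_le0 // mulr0 addr0 ltxx.
  have [clz|nclz] := pselect (closure (posset (eball 0 1) u) z).
    have fz : freebd (eball 0 1) u z.
      split=> //; split=> //; move=> /interior_subset [_ /=].
      by rewrite ltNge uz.
    have [_ [_ vis]] := hu; apply: (vis z fz (ebasis R i1)).
    have dotE y : dotp (u y) (ebasis R i1) = u y 0 i1.
      rewrite /dotp (bigD1 i1) //= big1; first by rewrite !mxE !eqxx mulr1 addr0.
      by move=> i /negPf ii; rewrite !mxE ii andbF mulr0.
    have [d d0 hd] := near_eball_ex nK.
    exists (phi mu), d; split=> //; split; first exact: barrier_C1.
    split=> //; split; last split; last split; last split.
    (* On the zero level only [s1] times the gradient of the level remains. The point lies below c,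
       so the bump increases in direction [k] and that component of the gradient is at least 1. *)
    + exists k; rewrite partial_barrier // /bargrad -/(L mu z) Lz ppow_le0 //; last first.
        by rewrite gt_eqF // subr_gt0.
      rewrite !mulr0 add0r mulf_neq0 ?gt_eqF // /lgrad eqxx.
      rewrite ltr_wpDr // mulr_ge0 ?(ltW s0) // /bgrad mulr_ge0 ?(ltW (gbump_gt0 _ _ _)) //.
      rewrite mulNr oppr_ge0 mulr_ge0_le0 ?mulr_ge0 ?(ltW A0) //.
      move: Lz; rewrite /L /level.
      have : 0 < s * gbump c A z by rewrite mulr_gt0 ?gbump_gt0.
      by move: k00; lra.
    + apply: barrier_C2 => // y [hy /=]; apply: contraNneq => Ly.
      by rewrite phiE /L Ly /F u0_le0 // mulr0 addr0.
    + move=> y hy phiy; have Ly : L mu y != 0.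
        apply: contraNneq phiy => Ly.
        by rewrite phiE Ly /F u0_le0 // mulr0 addr0.
      by rewrite /phi laplacian_barrier //; apply: sub => //; exact: hd.
    + by move=> y hy; rewrite dotE; apply: KP; exact: hd.
    + by rewrite dotE e.
  have nu0 : \forall y \near z, enorm (u y) <= 0.
    have ncl : \forall y \near z, ~ posset (eball 0 1) u y.
      apply: contrapT => h; apply: nclz => U /= nU; apply: contrapT => hU.
      apply: h; near=> y => hy; apply: hU; exists y; split=> //; near: y.
      exact: nU.
    have nB : \forall y \near z, eball 0 1 y by exact: near_eball.
    near=> y; rewrite leNgt; apply/negP => uy.
    have : ~ posset (eball 0 1) u y by near: y.
    by apply; split=> //; near: y.
  (* Here [u] vanishes near [z], so the barrier and hence the level are nonpositive there: the level
     has a local maximum at [z] despite its positive Laplacian. *)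
  suff : \sum_i lhess c A s i i z <= 0 by rewrite leNgt lh0.
  apply: (lap_max (fun j => level_has_d2 k c A s (k0 mu) z j)).
  near=> y; rewrite -/(L mu y) -/(L mu z) Lz leNgt; apply/negP => Ly.
  have uy : u y = 0.
    by apply: enorm_eq0; apply/eqP; rewrite eq_le enorm_ge0 andbT; near: y.
  have : P mu y by near: y.
  rewrite /P uy mxE phiE; apply/negP; rewrite -ltNge /F.
  by rewrite ltr_wpDl ?u0_ge0 // mulr_gt0.
Unshelve. all: by end_near. Qed.

End Lower.

(** * Comparison from above *)

Section Upper.
Context {R : realType} {n : nat}.
Implicit Types (x y z : 'rV[R]_n).

(* The right-hand side is [o(rho ^+ 2)] because the exponent exceeds [kappa p]. *)
Lemma small_radius (p nu La : R) : 0 < p < 1 -> 0 < nu -> 0 < La ->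
  \forall rho \near (0 : R)^'+,
    2 * n%:R * (cp p * (La * rho) `^ (kappa p * (1 + nu))) <
    (cp p * (La * rho) `^ (kappa p * (1 + nu))) `^ (p - 1) * rho ^+ 2.
Proof.
move=> hp nu0 La0; have k1 := kappa_gt1 hp; have C0 := cp_gt0 hp.
have K0 : 0 < kappa p * (kappa p - 1) by rewrite mulr_gt0 //; lra.
have hc : {for 0, continuous (fun rho : R => ppow (2 * nu) (La * rho))}.
  apply: (@continuous_comp _ _ _ (fun t : R => La * t) (ppow (2 * nu))).
    by apply: continuousM; [exact: cst_continuous | exact: cvg_id].
  by apply: ppow_continuous; rewrite mulr_gt0.
(* The powers of [rho] cancel and leave (La rho)^(2 nu) < kappa (kappa - 1) / (2 n La^2); [n.+1]
   keeps the denominator positive. *)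
pose c : R := kappa p * (kappa p - 1) / (2 * n.+1%:R * La ^+ 2).
have c0 : 0 < c by rewrite divr_gt0 // mulr_gt0 ?mulr_gt0 ?exprn_gt0.
have hn : \forall rho \near (0 : R), ppow (2 * nu) (La * rho) < c.
  apply: (@cvgr_lt _ _ _ _ _ _ hc); rewrite mulr0 ppow_le0 //.
  by rewrite gt_eqF // mulr_gt0.
near=> rho.
have r0 : 0 < rho by near: rho; exact: nbhs_right_gt.
have hr : ppow (2 * nu) (La * rho) < c by near: rho; exact: cvg_within hn.
have t0 : 0 < La * rho by rewrite mulr_gt0.
have M0 : 0 < cp p * (La * rho) `^ (kappa p * (1 + nu)) by rewrite mulr_gt0 ?powR_gt0.
move: hr; rewrite ppow_gt0E //.
have tn0 : 0 < (La * rho) `^ (2 * nu) by rewrite powR_gt0.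
have -> : (cp p * (La * rho) `^ (kappa p * (1 + nu))) `^ (p - 1) =
    (cp p * (La * rho) `^ (kappa p * (1 + nu))) *
     (kappa p * (kappa p - 1) / ((La * rho) ^+ 2 * (La * rho) `^ (2 * nu))).
  rewrite (_ : p - 1 = 1 + (p - 2)); last by lra.
  rewrite (@powRD _ _ 1) ?(gt_eqF M0) ?implybT // powRr1 ?(ltW M0) //.
  rewrite [_ `^ (p - 2)]powRM ?powR_ge0 ?(ltW C0) // cp_powB2 // -powRrM.
  congr (_ * (_ * _)).
  have -> : kappa p * (1 + nu) * (p - 2) = - (2 + 2 * nu).
    have e : kappa p * (1 + nu) * (p - 2) = (kappa p * (p - 2)) * (1 + nu) by ring.
    by rewrite e kappaMpB2 //; ring.
  rewrite powRN (@powRD _ _ 2) ?(gt_eqF t0) ?implybT //.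
  by rewrite powR_mulrn // ltW.
move: ((La * rho) `^ (2 * nu)) tn0 => tn tn0 hr.
move: (cp p * _) M0 => M M0.
rewrite [ltLHS]mulrC -mulrA ltr_pM2l // mulrAC ltr_pdivlMr; last first.
  by rewrite mulr_gt0 // exprn_gt0.
rewrite exprMn.
have -> : 2 * n%:R * (La ^+ 2 * rho ^+ 2 * tn) = (2 * n%:R * La ^+ 2 * tn) * rho ^+ 2 by ring.
rewrite ltr_pM2r ?exprn_gt0 //.
move: hr; rewrite /c ltr_pdivlMr; last by rewrite mulr_gt0 ?mulr_gt0 ?exprn_gt0.
apply: le_lt_trans; rewrite [leRHS]mulrC ler_wpM2r ?(ltW tn0) //.
by rewrite ler_wpM2r ?sqr_ge0 // ler_wpM2l // ler_nat.
Unshelve. all: by end_near. Qed.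

(** A Lipschitz bound in the sup norm. Around a point of nonpositive level it makes the level, hence
    the base of the power in the barrier, at most a multiple of the radius. *)
Lemma level_growth (k : 'I_n) (c : 'rV[R]_n) (A s k0 r : R) x z :
  0 < A -> 0 < s <= 1 -> 0 <= r ->
  (forall j, `|x 0 j - c 0 j| <= 1) -> (forall j, `|z 0 j - c 0 j| <= 1) ->
  (forall j, `|x 0 j - z 0 j| <= r) ->
  level k c A (- s) k0 x <= level k c A (- s) k0 z + (1 + 2 * A * n%:R) * r.
Proof.
move=> A0 /andP[s0 s1] r0 xc zc xz; rewrite /level.
have hq : sqd c x - sqd c z <= n%:R * (2 * r).
  rewrite /sqd -sumrB.
  have -> : n%:R * (2 * r) = \sum_(i < n) 2 * r by rewrite sumr_const card_ord mulr_natl.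
  apply: ler_sum => i _; have := xc i; have := zc i; have := xz i.
  rewrite subr_sqr (_ : x 0 i - c 0 i - (z 0 i - c 0 i) = x 0 i - z 0 i); last by ring.
  move=> h1 h2 h3; apply: le_trans (ler_norm _) _; rewrite normrM mulrC.
  apply: ler_pM => //; apply: le_trans (ler_normD _ _) _.
  by rewrite (_ : 2 = 1 + 1) // lerD.
have hb : gbump c A z * (1 - A * (sqd c x - sqd c z)) <= gbump c A x.
  have -> : gbump c A x = gbump c A z * expR (- A * (sqd c x - sqd c z)).
    by rewrite /gbump -expRD; congr expR; ring.
  rewrite ler_wpM2l ?(ltW (gbump_gt0 _ _ _)) //.
  by apply: le_trans (expR_ge1Dx _); rewrite mulNr.
have b0 := gbump_gt0 c A z; have b1 := gbump_le1 c z (ltW A0).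
have h4 : s * (gbump c A z * (A * (sqd c x - sqd c z))) <= A * (n%:R * (2 * r)).
  rewrite mulrA; apply: (@le_trans _ _ (s * gbump c A z * (A * (n%:R * (2 * r))))).
    by rewrite ler_wpM2l ?ler_wpM2l ?(ltW A0) // mulr_ge0 // ltW.
  rewrite ler_piMl ?mulr_ge0 ?(ltW A0) //.
  by rewrite mulr_ile1 // ltW.
have h5 : s * (gbump c A z * (1 - A * (sqd c x - sqd c z))) <= s * gbump c A x.
  by rewrite ler_wpM2l // ltW.
have h6 := le_trans (ler_norm _) (xz k).
lra.
Qed.

(** A contact at positive level contradicts the strict supersolution inequality. A contact at
    nonpositive level is no contradiction: non-degeneracy shows that [u] vanishes around it, so the
    bound persists there for any smaller parameter. *)
Lemma upper_sliding (m : nat) (p : R) (u : 'rV[R]_n -> 'rV[R]_m) (k : 'I_n)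
    (A s be b nu T del : R) :
  0 < p < 1 -> visc_sol p (eball 0 1) u ->
  0 < A -> 0 < s <= 16^-1 -> 16 * A * s <= 1 -> 0 < be -> 0 <= b ->
  n%:R + 3 <= 2 * A * del ^+ 2 ->
  0 < nu -> kappa p * (1 + nu) < 2 -> 1 + b + be + 2 * s <= T ->
  (1 + nu) * ((kappa p - 1) * (1 - A * s * expR (- A * 4^-1) / 16)
     + kappa p * nu * (1 + 4 * A + 4 * A ^+ 2)) <
    (kappa p - 1) * (1 - 2 * nu * ln T) ->
  (forall t, 0 <= t <= T -> t `^ kappa p <= (t + be) `^ (kappa p * (1 + nu))) ->
  (forall x, sqd (cen k) x <= 4^-1 -> enorm (u x) <= u0 p (x 0 k + b)) ->
  (forall x, sqd (cen k) x <= del ^+ 2 -> enorm (u x) < u0 p (x 0 k + b - s)) ->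
  forall x, del ^+ 2 <= sqd (cen k) x <= 4^-1 ->
    enorm (u x) <= cp p * ppow (kappa p * (1 + nu))
      (level k (cen k) A (- s) (b + be + s * expR (- A * 4^-1)) x).
Proof.
move=> hp hu A0 /andP[s0 s16] As be0 b0 Ad nu0 knu hT hnu hexp Hup Hin.
have k1 := kappa_gt1 hp; have k2 := kappa_lt2 hp; have C0 := cp_gt0 hp.
have n0 : (0 < n)%N by exact: leq_ltn_trans (leq0n k) (ltn_ord k).
have s1 : s <= 1 by lra.
set c := cen k; set eR := expR (- A * 4^-1) in hnu *.
have eR0 : 0 < eR by exact: expR_gt0.
have eR1 : eR <= 1 by rewrite /eR -expR0 ler_expR mulNr oppr_le0 mulr_ge0 // ltW.
have seR : 0 < s * eR by rewrite mulr_gt0.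
have seR1 : s * eR <= s by rewrite ger_pMr.
set k' := kappa p * (1 + nu) in knu hexp *.
have k'1 : 1 < k' by apply: (lt_le_trans k1); rewrite ler_peMr //; lra.
have k'0 : 0 < k' by lra.
pose k0 mu := b + be + s * eR + mu.
pose F t := cp p * ppow k' t.
have Fle t t' : t <= t' -> F t <= F t'.
  by move=> tt; rewrite ler_wpM2l ?(ltW C0) // ppow_homo // ltW.
have Flt t t' : 0 < t' -> t < t' -> F t < F t'.
  by move=> t'0 tt; rewrite ltr_pM2l // ppow_ltr.
have Fcont : continuous F.
  move=> t; apply: (@continuousM _ _ (fun=> cp p) (ppow k')).
    exact: cst_continuous.
  exact: ppow_continuous.
(* The shift [be] pays for the larger exponent, so that the given upper bound starts and confines
   the sliding. *)
have u0F t : t <= T -> u0 p t <= F (t + be).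
  move=> tT; have [t0|t0] := lerP t 0.
    by rewrite u0_le0 // mulr_ge0 ?(ltW C0) ?ppow_ge0.
  rewrite u0E ler_wpM2l ?(ltW C0) // !ppow_gt0E //; last by lra.
  by apply: hexp; rewrite (ltW t0).
pose L mu x := level k c A (- s) (k0 mu) x.
have LE mu x : L mu x = L 0 x + mu by rewrite /L /level /k0; ring.
pose phi mu := barrier k c A (- s) (k0 mu) (cp p) k' 0.
have phiE mu x : phi mu x = F (L mu x) by rewrite /phi /barrier mul0r addr0.
pose K : set 'rV[R]_n := [set x | del ^+ 2 <= sqd c x <= 4^-1].
pose P mu x := enorm (u x) <= phi mu x.
have KB x : K x -> eball 0 1 x by move=> /andP[_ /sqd_cen_le []].
have xk4 x : sqd c x <= 4^-1 -> x 0 k <= 3 / 4.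
  by move=> /sqd_cen_le [_ _]; rewrite ler_norml => /andP[_]; lra.
suff : forall x, K x -> P 0 x.
  by move=> H x Kx; have := H x Kx; rewrite /P phiE /L /k0 addr0.
have L0ge x : x 0 k + b + be - s + s * eR <= L 0 x.
  rewrite /L /level /k0 addr0.
  have : s * gbump c A x <= s by rewrite ger_pMr // gbump_le1 // ltW.
  by lra.
have bR x : sqd c x <= 4^-1 -> eR <= gbump c A x.
  by move=> h; rewrite /eR /gbump ler_expR !mulNr lerN2 ler_wpM2l // ltW.
have L0le x : sqd c x <= 4^-1 -> L 0 x <= x 0 k + b + be.
  move=> h; rewrite /L /level /k0 addr0.
  have : s * eR <= s * gbump c A x by rewrite ler_wpM2l ?bR // ltW.
  by lra.
have ucont z : K z -> {for z, continuous (fun y => enorm (u y))}.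
  by move=> /KB; exact: (u_enorm_cont hu).
apply: (@sliding _ _ K P s); [exact: (@compact_sqd _ _ c) | exact: ltW | | | |].
- move=> x t t' tt' Pt; apply: (le_trans Pt); rewrite !phiE; apply: Fle.
  by rewrite [leLHS]LE [leRHS]LE; lra.
- move=> x /andP[_ x4]; apply: (le_trans (Hup x x4)); rewrite phiE.
  apply: (le_trans (u0F _ _)); first by have := xk4 x x4; lra.
  by apply: Fle; rewrite LE; have := L0ge x; lra.
- move=> x mu Kx hmu; rewrite /P leNgt; apply/negP => hlt.
  have hc : {for mu, continuous (fun t => F (L 0 x + t))}.
    apply: (@continuous_comp _ _ _ (fun t => L 0 x + t) F); last exact: Fcont.
    by apply: continuousD; [exact: cst_continuous | exact: cvg_id].
  have hn : \forall t \near mu, F (L 0 x + t) < enorm (u x).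
    by apply: (@cvgr_lt _ _ _ _ _ _ hc); rewrite -LE -phiE.
  near mu^'+ => t.
  have t1 : F (L 0 x + t) < enorm (u x) by near: t; exact: cvg_within hn.
  have t2 : mu < t by near: t; exact: nbhs_right_gt.
  by have := hmu t t2; rewrite /P phiE LE leNgt t1.
- move=> mu z /andP[mu0 mus] Pmu Kz.
  have [hlt|hge] := ltP (enorm (u z)) (phi mu z).
    have hc : {for mu, continuous (fun t => F (L 0 z + t))}.
      apply: (@continuous_comp _ _ _ (fun t => L 0 z + t) F); last exact: Fcont.
      by apply: continuousD; [exact: cst_continuous | exact: cvg_id].
    have hn : \forall t \near mu, enorm (u z) < F (L 0 z + t).
      by apply: (@cvgr_gt _ _ _ _ _ _ hc); rewrite -LE -phiE.
    near mu^'- => t; exists t; first by near: t; exact: nbhs_left_lt.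
    have t1 : enorm (u z) < F (L 0 z + t) by near: t; exact: cvg_within hn.
    have dc : {for z, continuous (fun y => phi t y - enorm (u y))}.
      by apply: continuousB; [exact: barrier_cont | exact: ucont].
    have dn : \forall y \near z, 0 < phi t y - enorm (u y).
      by apply: (@cvgr_gt _ _ _ _ _ _ dc); rewrite subr_gt0 phiE LE.
    near=> y => _; rewrite /P -subr_ge0 ltW //; near: y; exact: dn.
  have e : enorm (u z) = phi mu z.
    by apply/eqP; rewrite eq_le hge andbT; exact: Pmu.
  have Kz' := Kz; move: Kz' => /andP[z1 z2].
  have [Bz _ _] := sqd_cen_le z2.
  have [zin|zout] := lerP (sqd c z) (del ^+ 2).
    exfalso; have := Hin z zin; rewrite e phiE; apply/negP; rewrite -leNgt.
    apply: (le_trans (u0F _ _)); first by have := xk4 z z2; lra.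
    by apply: Fle; rewrite LE; have := L0ge z; lra.
  (* Where [u] vanishes nearby every parameter is admissible; [mu - 1] is one choice. *)
  have nul : (\forall y \near z, K y -> enorm (u y) <= 0) ->
      exists2 m' : R, m' < mu & \forall y \near z, K y -> P m' y.
    move=> nu_0; exists (mu - 1); first by rewrite ltrBlDr ltrDl.
    near=> y => Ky; apply: (@le_trans _ _ 0); first by move: Ky; near: y.
    by rewrite phiE mulr_ge0 ?(ltW C0) ?ppow_ge0.
  move: (z2); rewrite le_eqVlt => /orP[/eqP z4|z4].
    have Lz : L mu z = z 0 k + b + be + mu.
      by rewrite /L /level /k0 /gbump z4 -/eR; ring.
    (* On the outer sphere, below the plane of the upper profile, [u] vanishes near [z] by the upper
       bound itself; elsewhere the level is positive and the barrier strictly exceeds that bound. *)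
    have [zk|zk] := ltP (z 0 k + b) 0.
      apply: nul.
      have hn : \forall y \near z, (y : 'rV[R]_n) 0 k < - b.
        by apply: (@cvgr_lt _ _ _ _ _ _ (@coord_cont R n k z)); lra.
      near=> y => /andP[_ y4]; apply: (le_trans (Hup y y4)).
      have yb : y 0 k < - b by near: y.
      by rewrite u0_le0 //; lra.
    exfalso; have := Hup z z2; rewrite e phiE; apply/negP; rewrite -ltNge.
    apply: (le_lt_trans (u0F _ _)); first by have := xk4 z z2; lra.
    by rewrite Lz; apply: Flt; lra.
  have nK : \forall y \near z, del ^+ 2 < sqd c y /\ sqd c y < 4^-1.
    by near=> y; split; near: y; [exact: near_sqd_gt | exact: near_sqd_lt].
  have KP y : del ^+ 2 < sqd c y /\ sqd c y < 4^-1 -> P mu y.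
    by move=> [y1 y2]; apply: Pmu; rewrite /K /= !ltW.
  have nP : \forall y \near z, P mu y.
    by near=> y; apply: KP; near: y.
  have [Lz|Lz] := ltP 0 (L mu z).
    exfalso; have Lz0 : L mu z != 0 by rewrite gt_eqF.
    have uz : 0 < enorm (u z) by rewrite e phiE mulr_gt0 // ppow_gt0.
    have pz : posset (eball 0 1) u z by [].
    have := @upper_test _ _ _ _ _ hu (phi mu) _ z pz
        (fun j => barrier_has_d2 (cp p) 0 k'1 knu j Lz0).
    move=> H; have : enorm (u z) `^ (p - 1) <=
       \sum_j barhess k c A (- s) (k0 mu) (cp p) k' 0 j j z.
      apply: H; near=> y; rewrite e lerD2r.
      by have : P mu y by near: y.
    rewrite e; apply/negP; rewrite -ltNge.
    apply: (@super_barrier _ _ _ hp k c A s (k0 mu) eR nu T z) => //.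
    + by rewrite s0.
    + by rewrite cen_coord /k0; lra.
    + by rewrite cen_coord /k0; lra.
    + by rewrite cen_coord /k0; lra.
    + by lra.
    + by apply: le_trans Ad _; rewrite ler_wpM2l ?mulr_ge0 // ltW.
    + by rewrite eR0 bR.
    + rewrite -/(L mu z) Lz /= LE; have := L0le z z2; have := xk4 z z2; lra.
    + by lra.
  apply: nul.
  have [d d0 hd] := near_box_ex nK.
  (* Twice the Lipschitz constant: the balls are centred at points [y] within [rho] of [z], so their
     points lie within [2 * rho] of [z]. *)
  pose La := 2 * (1 + 2 * A * n%:R).
  have La0 : 0 < La by rewrite mulr_gt0 // ltr_wpDr // mulr_ge0 // mulr_ge0 // ltW.
  near (0 : R)^'+ => rho.
  have r0 : 0 < rho by near: rho; exact: nbhs_right_gt.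
  have rd : 2 * rho < d.
    rewrite mulrC -ltr_pdivlMr //; near: rho; apply: nbhs_right_lt.
    exact: divr_gt0.
  have rsmall : 2 * n%:R * (cp p * (La * rho) `^ k') <
      (cp p * (La * rho) `^ k') `^ (p - 1) * rho ^+ 2.
    by near: rho; exact: small_radius.
  have nz : \forall y \near z, sqd z y < rho ^+ 2.
    by apply: near_sqd_lt; rewrite sqdxx exprn_gt0.
  near=> y => _.
  have yz : sqd z y < rho ^+ 2 by near: y.
  rewrite (@nondegeneracy _ _ _ _ _ hu y rho (cp p * (La * rho) `^ k')) //.
    by have /andP[] := hp.
  move=> x xy.
  have xz j : `|x 0 j - z 0 j| <= 2 * rho.
    rewrite -(subrK (y 0 j) (x 0 j)) -addrA; apply: (le_trans (ler_normD _ _)).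
    have h1 := coord_sqd_le j (ltW r0) xy; have h2 := coord_sqd_lt j r0 yz.
    by rewrite mulr_natl mulr2n lerD // ltW.
  have xK : del ^+ 2 < sqd c x /\ sqd c x < 4^-1.
    by apply: hd => j; apply: le_lt_trans rd.
  have half w : sqd c w <= 4^-1 -> forall j, `|w 0 j - c 0 j| <= 1.
    by move=> h j; apply: coord_sqd_le => //; rewrite expr1n; lra.
  split; first by apply: KB; rewrite /K /= !ltW //; case: xK.
  apply: (le_trans (KP x xK)); rewrite phiE.
  have -> : cp p * (La * rho) `^ k' = F (La * rho) by rewrite /F ppow_gt0E // mulr_gt0.
  apply: Fle.
  have := @level_growth k c A s (k0 mu) (2 * rho) x z A0.
  have r2 : 0 <= 2 * rho by rewrite mulr_ge0 // ltW.
  rewrite s0 s1 => /(_ isT r2).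
  move=> /(_ (half x (ltW (proj2 xK))) (half z z2) xz).
  rewrite -/(L mu x) -/(L mu z) /La; lra.
Unshelve. all: by end_near. Qed.

End Upper.

(** * Improvement at unit scale *)

Section Dichotomy.
Context {R : realType} {n m : nat} (p : R) (u : 'rV[R]_n -> 'rV[R]_m).
Hypotheses (hp : 0 < p < 1) (hu : visc_sol p (eball 0 1) u).
Variables (k : 'I_n) (i1 : 'I_m) (a b : R).
Hypothesis ab : a < b.
Hypothesis Hup : forall y, eball 0 1 y -> enorm (u y) <= u0 p (y 0 k + b).
Hypothesis Hlow : forall y, eball 0 1 y -> - a <= y 0 k -> u0 p (y 0 k + a) <= u y 0 i1.
Implicit Types (x y z : 'rV[R]_n).
Local Notation eps := (b - a).

Lemma sqd_near_ball y0 x : sqd 0 y0 <= 9 / 16 -> sqd y0 x <= 64^-1 -> eball 0 1 x.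
Proof.
move=> h1 h2; apply/eballE => //; rewrite expr1n.
(* Young's inequality (v + w)^2 <= 5/4 v^2 + 5 w^2 in each coordinate; the total is at most 45/64 +
   5/64. *)
apply: (@le_lt_trans _ _ (5 / 4 * sqd 0 y0 + 5 * sqd y0 x)); last by lra.
rewrite /sqd !mulr_sumr -big_split; apply: ler_sum => i _ /=; rewrite !mxE !subr0.
have -> : x 0 i = y0 0 i + (x 0 i - y0 0 i) by ring.
by move: (y0 0 i) (x 0 i - _) => v w; have := sqr_ge0 (v - 4 * w); rewrite !expr2; nra.
Qed.

(* In the slab where [u^1] may be negative, [|u| <= u0 eps], so the potential
   [|u| `^ (p - 2)] is at least of order [eps ^- 2] there. *)
Lemma negative_part y0 : sqd 0 y0 <= 9 / 16 ->
  - (64 * u0 p eps * ((2 * n%:R + 1) * eps ^+ 2 / (kappa p * (kappa p - 1)))) <= u y0 0 i1.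
Proof.
move=> hy0.
have k1 := kappa_gt1 hp; have e0 : 0 < eps by rewrite subr_gt0.
have KK : 0 < kappa p * (kappa p - 1) by rewrite mulr_gt0 //; lra.
set la := (2 * n%:R + 1) * eps ^+ 2 / (kappa p * (kappa p - 1)).
have n0 : 0 <= n%:R :> R by exact: ler0n.
have la0 : 0 < la by rewrite divr_gt0 // mulr_gt0 ?exprn_gt0 //; lra.
set M := u0 p eps; have M0 : 0 < M := u0_gt0 hp e0.
(* The factor 64 makes [Q] exceed [M] on the sphere [sqd y0 x = 64^-1], and [la] makes M^(p-2) [Q]
   exceed the Laplacian [128 * n%:R * M] of [Q]. *)
pose Q x := 64 * M * (sqd y0 x + la).
have Q0 x : 0 < Q x.
  rewrite /Q; apply: mulr_gt0; first by apply: mulr_gt0.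
  by apply: ltr_wpDl => //; exact: sqd_ge0.
pose h x := u x 0 i1 + Q x.
pose K : set 'rV[R]_n := [set x | 0 <= sqd y0 x <= 64^-1].
have KB x : K x -> eball 0 1 x by move=> /andP[_]; exact: sqd_near_ball.
have Ky0 : K y0 by rewrite /K /= sqdxx lexx /= invr_ge0.
have [||z /set_mem Kz zmin] := @EVT_min_rV R n h K _ (@compact_sqd _ _ _ _ _).
- by exists y0.
- apply: continuous_in_subspaceT => y /set_mem /KB By.
  apply: continuousD; first exact: (u_coord_cont hu).
  apply: continuousM; first exact: cst_continuous.
  by apply: continuousD; [exact: sqd_cont | exact: cst_continuous].
suff hz : 0 <= h z.
  have := le_trans hz (zmin y0 (mem_set Ky0)).
  by rewrite /h /Q sqdxx add0r -subr_ge0; lra.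
rewrite leNgt; apply/negP => hz.
have uzQ : u z 0 i1 < - Q z by move: hz; rewrite /h; lra.
have Bz := KB z Kz.
have uz : 0 < enorm (u z).
  apply: lt_le_trans (coord_enorm _ i1); rewrite normr_gt0 lt_eqF //.
  by have := Q0 z; lra.
(* A negative [u^1] forces [z] below the plane of the lower profile, so its height over the upper
   one is at most [eps]. *)
have uM : enorm (u z) <= M.
  apply: (le_trans (Hup Bz)); apply: u0_homo => //.
  have [za|za] := lerP (- a) (z 0 k); last by lra.
  by have := Hlow Bz za; have := u0_ge0 hp (z 0 k + a); have := Q0 z; lra.
have zin : sqd y0 z < 64^-1.
  move: Kz => /andP[_]; rewrite le_eqVlt => /orP[/eqP e|//]; move: uzQ; rewrite /Q e.
  have := le_trans (coord_enorm (u z) i1) uM; rewrite ler_norml => /andP[h1 _] h2.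
  have : 0 < 64 * M * la by rewrite mulr_gt0 // mulr_gt0.
  by lra.
have pz : posset (eball 0 1) u z by [].
have := @lower_test _ _ _ _ _ hu (fun x => - (64 * M) * sqd y0 x) _ z i1 pz
   (fun j => has_d2Z (- (64 * M)) (has_d2_sqd y0 z j)).
rewrite sumr_const card_ord -[_ *+ n]mulr_natl => H.
have {H} : n%:R * (- (64 * M) * 2) <= enorm (u z) `^ (p - 2) * u z 0 i1.
  apply: H; near=> y.
  have Ky : K y by rewrite /K /= sqd_ge0 ltW //; near: y; exact: near_sqd_lt.
  by have := zmin y (mem_set Ky); rewrite /h /Q; lra.
apply/negP; rewrite -ltNge.
apply: (@le_lt_trans _ _ (M `^ (p - 2) * - Q z)).
  apply: (@le_trans _ _ (enorm (u z) `^ (p - 2) * - Q z)).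
    by rewrite ler_wpM2l ?powR_ge0 // ltW.
  rewrite ler_wnM2r //; first by rewrite oppr_le0 ltW.
  by apply: powR_npos_le => //; case/andP: hp => ? ?; lra.
rewrite /M u0_powB2 // -/M.
suff : 128 * (n%:R * M) < kappa p * (kappa p - 1) / eps ^+ 2 * Q z.
  by rewrite mulrN; move: (_ / _ * Q z) => w; lra.
apply: (@lt_le_trans _ _ (kappa p * (kappa p - 1) / eps ^+ 2 * (64 * M * la))).
  have -> : kappa p * (kappa p - 1) / eps ^+ 2 * (64 * M * la) = 64 * M * (2 * n%:R + 1).
    by rewrite /la; field; rewrite !gt_eqF //; lra.
  by lra.
rewrite ler_wpM2l ?divr_ge0 ?sqr_ge0 ?(ltW KK) //.
by rewrite /Q ler_wpM2l ?lerDr ?sqd_ge0 // mulr_ge0 // ltW.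
Unshelve. all: by end_near. Qed.

Local Notation h := (4^-1 + a).
Local Notation E := (du0 p h).

Lemma translated_profileE (c : 'rV[R]_n) y :
  barrier k c 0 0 a (cp p) (kappa p) 0 y = u0 p (y 0 k + a).
Proof. by rewrite /barrier /level !mul0r !addr0. Qed.

Lemma laplacian_translated_profile (c : 'rV[R]_n) y : 0 < y 0 k + a ->
  \sum_i barhess k c 0 0 a (cp p) (kappa p) 0 i i y = u0 p (y 0 k + a) `^ (p - 1).
Proof.
move=> ya; rewrite sum_barhess sum_sqr_lgrad sum_lhess !mul0r mulr0 addr0.
have -> : level k c 0 0 a y = y 0 k + a by rewrite /level mul0r addr0.
by rewrite -u0_ode //; ring.
Qed.

Lemma powR_splitB2 (v : R) : 0 < v -> v `^ (p - 1) = v `^ (p - 2) * v.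
Proof.
move=> v0; rewrite (_ : p - 1 = p - 2 + 1); last by lra.
by rewrite (@powRD _ v (p - 2)) ?(gt_eqF v0) ?implybT // powRr1 // ltW.
Qed.

(** By [u0_powB2] the difference is kappa (kappa - 1) (t^(-2) - (t + e)^(-2)) times the profile,
    which is at most 8 C e / t^2. As t >= 1/16, this is at most 2048 C e. *)
Lemma profile_gap (t e C : R) : 0 < t -> 0 < e -> 16^-1 <= t -> 0 < C ->
  du0 p (t + e) <= 2 * C ->
  u0 p t `^ (p - 1) - u0 p (t + e) `^ (p - 2) * u0 p t < 2100 * C * e.
Proof.
move=> t0 e0 t16 C0 hC.
have te0 : 0 < t + e by rewrite addr_gt0.
have K0 : 0 < kappa p * (kappa p - 1).
  by have k1 := kappa_gt1 hp; rewrite mulr_gt0 //; lra.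
have K2 : kappa p * (kappa p - 1) <= 2.
  have k1 := kappa_gt1 hp; have k2 := kappa_lt2 hp.
  by rewrite -[leRHS]mulr1; apply: ler_pM; lra.
have Ut : u0 p t <= t * (2 * C).
  apply: (le_trans (u0_le_du0 hp (ltW t0))); rewrite ler_wpM2l ?(ltW t0) //.
  by apply: le_trans hC; apply: du0_homo => //; rewrite lerDl ltW.
have U0 := ltW (u0_gt0 hp t0).
have inv : (t ^+ 2)^-1 - ((t + e) ^+ 2)^-1 <= 2 * e / t ^+ 3.
  rewrite -subr_ge0.
  have -> : 2 * e / t ^+ 3 - ((t ^+ 2)^-1 - ((t + e) ^+ 2)^-1) =
    (3 * e ^+ 2 * t + 2 * e ^+ 3) / (t ^+ 3 * (t + e) ^+ 2).
    by field; rewrite !gt_eqF.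
  apply: divr_ge0; last by rewrite mulr_ge0 ?exprn_ge0 // ltW.
  by rewrite addr_ge0 // mulr_ge0 ?exprn_ge0 ?mulr_ge0 ?sqr_ge0 // ltW.
have inv0 : 0 <= (t ^+ 2)^-1 - ((t + e) ^+ 2)^-1.
  by rewrite subr_ge0 lef_pV2 ?posrE ?exprn_gt0 // lerXn2r ?nnegrE ?lerDl // ltW.
rewrite powR_splitB2 ?u0_gt0 // -mulrBl !u0_powB2 //.
have -> : kappa p * (kappa p - 1) / t ^+ 2 - kappa p * (kappa p - 1) / (t + e) ^+ 2 =
   kappa p * (kappa p - 1) * ((t ^+ 2)^-1 - ((t + e) ^+ 2)^-1) by rewrite [RHS]mulrBr.
apply: (@le_lt_trans _ _ (2 * (2 * e / t ^+ 3) * (t * (2 * C)))).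
  apply: ler_pM => //; first by rewrite mulr_ge0 // ltW.
  by apply: ler_pM => //; exact: ltW.
have -> : 2 * (2 * e / t ^+ 3) * (t * (2 * C)) = 8 * (C * e) / t ^+ 2.
  by field; rewrite gt_eqF.
rewrite ltr_pdivrMr ?exprn_gt0 //.
have Ce : 0 < C * e by rewrite mulr_gt0.
have t2 : 256^-1 <= t ^+ 2.
  have -> : 256^-1 = 16^-1 ^+ 2 :> R by field.
  by rewrite lerXn2r ?nnegrE ?invr_ge0 // ltW.
have : C * e * 256^-1 <= C * e * t ^+ 2 by rewrite ler_wpM2l // ltW.
have -> : 2100 * C * e * t ^+ 2 = 2100 * (C * e * t ^+ 2) by ring.
by move: (C * e) (t ^+ 2) Ce => w v w0; lra.
Qed.

(* The nonnegative differences [u^1 - u0 (x_k + a)] and [u0 (x_k + b) - u^1] have a sum of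
   order [eps] at [cen k], and the gradient estimate keeps the first one almost
   constant on a ball of fixed radius. *)
Lemma dichotomy (d e : R) :
  8^-1 <= h -> eps <= 16^-1 -> d = (32 * n%:R)^-1 -> 0 < e <= d ->
  n%:R * (e * (n.+1%:R * 2 / d + 1050 * d)) <= 8^-1 ->
  (forall x, sqd (cen k) x <= e ^+ 2 -> u0 p (x 0 k + a) + E * eps / 8 <= u x 0 i1) \/
  (forall x, sqd (cen k) x <= e ^+ 2 ->
     u x 0 i1 <= u0 p (x 0 k + b) - E * eps * (3 / 8)).
Proof.
move=> h8 e16 dE /andP[e0 ed] he.
have k1 := kappa_gt1 hp; have k2 := kappa_lt2 hp; have eps0 : 0 < eps by rewrite subr_gt0.
have n0 : (0 < n)%N by exact: leq_ltn_trans (leq0n k) (ltn_ord k).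
have n1 : 1 <= n%:R :> R by rewrite ler1n.
have d0 : 0 < d by rewrite dE invr_gt0 mulr_gt0 // ltr0n.
have dn : 32 * n%:R * d = 1 by rewrite dE divff // gt_eqF // mulr_gt0 // ltr0n.
have d32 : d <= 32^-1 by nra.
have h0 : 0 < h by lra.
have E0 : 0 < E := du0_gt0 hp h0.
have p1 : p < 1 by case/andP: hp.
set c := cen k.
pose f y := u y 0 i1 - barrier k c 0 0 a (cp p) (kappa p) 0 y.
pose l y j := partial j (partial j (fun y => u y 0 i1)) y
  - barhess k c 0 0 a (cp p) (kappa p) 0 j j y.
have fE y : f y = u y 0 i1 - u0 p (y 0 k + a) by rewrite /f translated_profileE.
have bk y : box c (2 * d) y -> [/\ eball 0 1 y, h / 2 <= y 0 k + a, y 0 k + a <= h + 16^-1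
    & y 0 k + b <= 2 * h].
  move=> yb; have := yb k; rewrite cen_coord ler_norml => /andP[y1 y2].
  have [|By _ _] := @sqd_cen_le R n k y; last by split=> //; lra.
  rewrite /sqd; apply: (@le_trans _ _ (\sum_(i < n) (2 * d) ^+ 2)).
    apply: ler_sum => i _; rewrite -(real_normK (num_real (y 0 i - _))).
    by rewrite lerXn2r ?nnegrE ?mulr_ge0 ?(ltW d0).
  rewrite sumr_const card_ord -[_ *+ n]mulr_natl exprMn expr2; nra.
have bu y : box c (2 * d) y -> [/\ u0 p (y 0 k + a) <= u y 0 i1,
    u y 0 i1 <= enorm (u y), enorm (u y) <= u0 p (y 0 k + a + eps) & 0 < y 0 k + a].
  move=> /bk [By y1 y2 y3]; split; last by lra.
  - by apply: Hlow => //; lra.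
  - by apply: le_trans (coord_enorm _ i1); exact: ler_norm.
  - by have := Hup By; congr (_ <= u0 p _); ring.
have pos y : box c (2 * d) y -> posset (eball 0 1) u y.
  move=> yb; have [By _ _ _] := bk y yb; have [h1 h2 _ h3] := bu y yb; split=> //=.
  by have := u0_gt0 hp h3; lra.
have dub y : box c (2 * d) y -> du0 p (y 0 k + a + eps) <= 2 * E.
  by move=> /bk [_ y1 y2 y3]; apply: du0_double => //; lra.
have fM y : box c (2 * d) y -> `|f y| <= 2 * E * eps.
  move=> yb; have [h1 h2 h3 h4] := bu y yb.
  rewrite fE ger0_norm ?subr_ge0 //.
  have tt : y 0 k + a <= y 0 k + a + eps by rewrite lerDl ltW.
  have := u0_incr_le hp tt; rewrite [_ + eps - _]addrAC subrr add0r.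
  have : du0 p (y 0 k + a + eps) * eps <= 2 * E * eps.
    by apply: ler_wpM2r; [exact: ltW | exact: dub].
  by lra.
have lN y : box c (2 * d) y -> `|\sum_j l y j| < 2100 * E * eps.
  move=> yb; have [U1 U2 U3 t0] := bu y yb; have [_ t1 _ _] := bk y yb.
  rewrite /l sumrB -/(laplacian (fun y => u y 0 i1) y) (u_laplacian hu i1 (pos y yb)).
  rewrite laplacian_translated_profile //.
  have t16 : 16^-1 <= y 0 k + a by lra.
  have gap := profile_gap t0 eps0 t16 E0 (dub y yb).
  have U0 := u0_gt0 hp t0.
  have w0 : 0 < u y 0 i1 := lt_le_trans U0 U1.
  have v0 : 0 < enorm (u y) := lt_le_trans w0 U2.
  have p10 : p - 1 <= 0 by rewrite subr_le0 ltW.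
  have p20 : p - 2 <= 0 by rewrite subr_le0 ltW // (lt_trans p1) // ltrDl.
  (* From u0(t) <= u^1 <= |u| <= u0(t + eps), the Laplacian of [u^1] lies between the two quantities
     compared in [profile_gap]. *)
  have hi : enorm (u y) `^ (p - 2) * u y 0 i1 <= u0 p (y 0 k + a) `^ (p - 1).
    apply: (@le_trans _ _ (u y 0 i1 `^ (p - 1))); last exact: powR_npos_le.
    by rewrite powR_splitB2 // ler_wpM2r ?(ltW w0) // powR_npos_le.
  have lo : u0 p (y 0 k + a + eps) `^ (p - 2) * u0 p (y 0 k + a) <=
      enorm (u y) `^ (p - 2) * u y 0 i1.
    by apply: ler_pM; rewrite ?powR_ge0 ?(ltW U0) // powR_npos_le.
  rewrite ler0_norm ?subr_le0 // opprB; apply: le_lt_trans gap.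
  by rewrite lerD2l lerN2.
have osc x : sqd c x <= e ^+ 2 -> `|f x - f c| <= E * eps / 8.
  move=> xe; have := @box_oscillation R n f l c d (2 * E * eps) (2100 * E * eps) x e d0.
  move=> H; apply: (le_trans (H _ _ fM lN ed _)).
  - move=> y yb; have [By _ _ _] := bk y yb.
    by apply: continuousB; [exact: (u_coord_cont hu) | exact: barrier_cont].
  - move=> y yb j; apply: has_d2B; first by apply: (u_has_d2 hu); exact: pos.
    apply: barrier_has_d2 => //; rewrite /level mul0r addr0 gt_eqF //.
    by have [] := bu y yb.
  - by move=> j; apply: coord_sqd_le => //; exact: ltW.
  have -> : n%:R * (e * (n.+1%:R * (2 * E * eps) / d + 2100 * E * eps * d / 2)) =
    E * eps * (n%:R * (e * (n.+1%:R * 2 / d + 1050 * d))) by field; rewrite gt_eqF.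
  by rewrite ler_wpM2l // mulr_ge0 // ltW.
have Ee : 0 < E * eps by rewrite mulr_gt0.
(* With oscillation at most 1/8 (in units of [E * eps]), [f] is at least 1/8 on the ball or at most
   3/8. The profiles differ by at least 3/4, so the second case leaves 3/8 to the upper one. *)
have [fc|fc] := lerP (E * eps / 4) (f c).
  left; move=> x xe; have := osc x xe; rewrite ler_norml (fE x) => /andP[g1 _].
  by lra.
right; move=> x xe; have := osc x xe; rewrite ler_norml (fE x) => /andP[_ g2].
have xb : box c (2 * d) x.
  move=> j; apply: (@le_trans _ _ e); last by lra.
  by apply: coord_sqd_le => //; exact: ltW.
have xk : `|x 0 k - 4^-1| <= 32^-1.
  rewrite -(cen_coord k); apply: (@le_trans _ _ e); last by lra.
  by apply: coord_sqd_le => //; exact: ltW.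
move: xk; rewrite ler_norml => /andP[x1 x2].
(* The height at [x] is at least h - 1/32, hence at least 3/4 of [h] since h >= 1/8; [du0_ratio]
   transfers this to the slope. *)
have dl : E * (3 / 4) <= du0 p (x 0 k + a).
  have [xh|xh] := lerP h (x 0 k + a).
    by have := du0_homo hp xh; lra.
  have xa0 : 0 <= x 0 k + a by lra.
  have := du0_ratio hp xa0 (ltW xh) => hr; rewrite -(ler_pM2l h0).
  apply: le_trans hr; rewrite mulrCA mulrC ler_wpM2r ?(ltW E0) //; lra.
have xab : x 0 k + a <= x 0 k + b by rewrite lerD2l ltW.
have := u0_incr_ge hp xab.
have -> : x 0 k + b - (x 0 k + a) = eps by ring.
have : E * (3 / 4) * eps <= du0 p (x 0 k + a) * eps by rewrite ler_wpM2r // ltW.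
by lra.
Qed.

End Dichotomy.

(** Only the squares of the other components enter. With [tau] of order eps^(5/8) they amount to
    eps^(5/4), below the order eps allowed to [ze]; what matters is that 5/8 exceeds 1/2. *)
Lemma enorm_le_main {R : realType} {m : nat} (v : 'rV[R]_m) (i1 : 'I_m) (tau U ze : R) :
  0 <= U -> U <= v 0 i1 -> (forall i, i != i1 -> `|v 0 i| <= tau) ->
  m%:R * tau ^+ 2 <= 2 * U * ze -> 0 <= ze -> enorm v <= v 0 i1 + ze.
Proof.
move=> U0 Uv hv hm ze0; have v0 : 0 <= v 0 i1 := le_trans U0 Uv.
rewrite -(@ler_pXn2r _ 2) ?nnegrE ?enorm_ge0 ?addr_ge0 // sqr_enorm (bigD1 i1) //=.
have : \sum_(i < m | i != i1) v 0 i ^+ 2 <= m%:R * tau ^+ 2.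
  apply: (@le_trans _ _ (\sum_(i < m | i != i1) tau ^+ 2)).
    apply: ler_sum => i ii; rewrite -(real_normK (num_real (v 0 i))).
    have t0 : 0 <= tau := le_trans (normr_ge0 _) (hv i ii).
    by rewrite lerXn2r ?nnegrE ?hv.
  rewrite sumr_const -[_ *+ #|_|]mulr_natl ler_wpM2r ?sqr_ge0 // ler_nat.
  by rewrite -[leqRHS]card_ord max_card.
have : 2 * U * ze <= 2 * v 0 i1 * ze by rewrite ler_wpM2r // ler_wpM2l.
have := sqr_ge0 ze; rewrite sqrrD; move: (v 0 i1 ^+ 2) (ze ^+ 2) => a c; lra.
Qed.

Section BumpGap.
Context {R : realType} (A : R) (A0 : 0 < A).

(* Gain of the bump [exp (- A * sqd c x)] on [sqd c x <= 1 / 8], which contains a small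
   ball around the origin, over its value on the outer sphere [sqd c x = 1 / 4]. *)
Definition bump_gap : R := expR (- A * 8^-1) - expR (- A * 4^-1).

Lemma bump_gap_gt0 : 0 < bump_gap.
Proof. by rewrite subr_gt0 ltr_expR !mulNr ltrN2 ltr_pM2l //; lra. Qed.

Lemma bump_gap_le1 : bump_gap <= 1.
Proof.
have : expR (- A * 8^-1) <= 1.
  by rewrite -expR0 ler_expR mulNr oppr_le0 mulr_ge0 ?invr_ge0 // ltW.
by rewrite /bump_gap; have := expR_gt0 (- A * 4^-1); lra.
Qed.

Lemma small_ball_sqd {n : nat} (k : 'I_n) (r : R) (y : 'rV[R]_n) :
  r <= 128^-1 -> eball 0 r y -> 32^-1 <= sqd (cen k) y <= 8^-1.
Proof.
move=> r1 hy; have r0 : 0 < r by exact: le_lt_trans (enorm_ge0 _) hy.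
move/(eballE _ _ (ltW r0)): hy => hy.
have := coord_sqd_lt k r0 hy; rewrite mxE subr0 ltr_norml => /andP[y1 y2].
have r2 : r ^+ 2 <= 128^-1.
  by rewrite expr2 -[leRHS]mulr1; apply: ler_pM; rewrite ?(ltW r0) //; lra.
have := sqd_ge0 0 y; rewrite sqd_cen; lra.
Qed.

Lemma gbump_near {n : nat} (k : 'I_n) (y : 'rV[R]_n) : sqd (cen k) y <= 8^-1 ->
  expR (- A * 8^-1) <= gbump (cen k) A y.
Proof. by move=> h; rewrite ler_expR !mulNr lerN2 ler_wpM2l // ltW. Qed.

End BumpGap.

(** * Transfer of the gain from c to the origin *)

Section UnitScale.
Context {R : realType} {n m : nat} (p : R) (u : 'rV[R]_n -> 'rV[R]_m).
Hypotheses (hp : 0 < p < 1) (hu : visc_sol p (eball 0 1) u).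
Variables (k : 'I_n) (i1 : 'I_m) (a b : R).
Hypothesis ab : a < b.
Hypothesis Hup : forall y, eball 0 1 y -> enorm (u y) <= u0 p (y 0 k + b).
Hypothesis Hlow : forall y, eball 0 1 y -> - a <= y 0 k -> u0 p (y 0 k + a) <= u y 0 i1.
Implicit Types (x y z : 'rV[R]_n).
Local Notation eps := (b - a).
Local Notation h := (4^-1 + a).
Local Notation E := (du0 p h).
Variables (e A : R).
Hypotheses (h8 : 8^-1 <= h) (eps16 : eps <= 16^-1) (e0 : 0 < e) (e32 : e <= 32^-1).
Hypotheses (A0 : 0 < A) (Ae : n%:R + 3 <= 2 * A * e ^+ 2).
Local Notation eta := (bump_gap A / 128).

Lemma sqr_radius_le : e ^+ 2 <= 32^-1.
Proof.
have e01 := e0; have e132 := e32.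
by rewrite expr2 -[leRHS]mulr1; apply: ler_pM; rewrite ?(ltW e01) //; lra.
Qed.

Lemma near_cen x : sqd (cen k) x <= e ^+ 2 ->
  [/\ sqd (cen k) x <= 4^-1, h - 32^-1 <= x 0 k + a & x 0 k + a <= h + 32^-1].
Proof.
move=> hx; have e2 := sqr_radius_le; have e132 := e32.
have : `|x 0 k - 4^-1| <= e.
  by rewrite -(cen_coord k); apply: coord_sqd_le => //; exact: ltW.
by rewrite ler_norml => /andP[h1 h2]; split; lra.
Qed.

(* With the amplitude [s = eps / 64] half of the gain [s * bump_gap A] is spent on the
   downward shift of the barrier; the other half is [eta * eps]. *)
Lemma lower_improvement :
  64 * du0 p 1 * (2 * n%:R + 1) * eps / (kappa p * (kappa p - 1)) <=
    eta ^+ 2 * (du0 p 2 / 2) ->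
  (forall x, sqd (cen k) x <= e ^+ 2 -> u0 p (x 0 k + a) + E * eps / 8 <= u x 0 i1) ->
  forall y, eball 0 eta y -> - (a + eta * eps) <= y 0 k ->
    u0 p (y 0 k + (a + eta * eps)) <= u y 0 i1.
Proof.
move=> Hsmall Hin; have k1 := kappa_gt1 hp.
have gap0 := bump_gap_gt0 A0; have gap1 := bump_gap_le1 A0.
have eps0 : 0 < eps by rewrite subr_gt0.
have h80 := h8; have ep16 := eps16.
(* [H] bounds the heights in the ball. By [du0_ratio], this [s1] gives [s1 * t <= be * du0 p t] on
   [0, H], so the linear term costs no more than the downward shift by [be] provides. *)
pose s := eps / 64; pose be := eta * eps; pose H := h + 1; pose s1 := be * du0 p H / H.
have s0 : 0 < s by rewrite divr_gt0.
have eta0 : 0 < eta by rewrite divr_gt0.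
have eta1 : eta <= 128^-1 by lra.
have be0 : 0 < be by rewrite mulr_gt0.
have bes : be <= s / 2.
  have : eta * eps <= 128^-1 * eps by rewrite ler_wpM2r // ltW.
  by rewrite /be /s; lra.
have s16 : s <= 1024^-1 by rewrite /s; lra.
have H0 : 0 < H by rewrite /H; lra.
have h0 : 0 < h by lra.
have E0 : 0 < E := du0_gt0 hp h0.
have s10 : 0 < s1 by rewrite divr_gt0 // mulr_gt0 // du0_gt0.
have s1le t : 0 <= t -> t <= H -> s1 * t <= be * du0 p t.
  move=> t0 tH; rewrite /s1 mulrAC ler_pdivrMr // -mulrA -[leRHS]mulrA ler_wpM2l ?(ltW be0) //.
  by rewrite mulrC [leRHS]mulrC; exact: du0_ratio.
have Hini x : sqd (cen k) x <= 4^-1 ->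
    u0 p (x 0 k + a - be) + s1 * (x 0 k + a - be) <= u x 0 i1.
  move=> x4; have [Bx x9] := sqd_cen_le x4; rewrite ler_norml => /andP[x1 x2].
  have [xa|xa] := lerP 0 (x 0 k + a).
    have ux : u0 p (x 0 k + a) <= u x 0 i1.
      by apply: Hlow => //; rewrite -subr_ge0 opprK addrC addrC.
    apply: le_trans ux.
    have [tb|tb] := lerP (x 0 k + a - be) 0.
      by rewrite (u0_le0 hp tb) add0r (le_trans _ (u0_ge0 hp _)) // mulr_ge0_le0 // ltW.
    have tH : x 0 k + a - be <= H by rewrite /H; lra.
    have := s1le _ (ltW tb) tH.
    have tt : x 0 k + a - be <= x 0 k + a by rewrite gerBl ltW.
    have := u0_incr_ge hp tt.
    have -> : x 0 k + a - (x 0 k + a - be) = be by ring.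
    by rewrite mulrC; move: (s1 * _) (be * _) => v w; lra.
  have tb : x 0 k + a - be <= 0 by lra.
  rewrite (u0_le0 hp tb) add0r; apply: (@le_trans _ _ (- (s1 * be))).
    have : s1 * (x 0 k + a) <= 0 by rewrite mulr_ge0_le0 // ltW.
    by rewrite mulrBr; lra.
  apply: le_trans (negative_part hp hu ab Hup Hlow x9); rewrite lerN2.
  (* A point with [x 0 k + a < 0] occurs only for bounded [h]. Then [s1] is at least a universal
     multiple of [eps], so [s1 * be] is of order eps^2 and dominates the negative part. *)
  have H2 : H <= 2 by rewrite /H; lra.
  have r2 : du0 p 2 / 2 <= du0 p H / H.
    by rewrite ler_pdivrMr // mulrAC ler_pdivlMr // mulrC [leRHS]mulrC du0_ratio // ltW.
  have KK : 0 < kappa p * (kappa p - 1) by rewrite mulr_gt0 ?(lt_trans ltr01 k1) // subr_gt0.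
  have ue : u0 p eps <= eps * du0 p 1.
    apply: (le_trans (u0_le_du0 hp (ltW eps0))); rewrite ler_wpM2l ?(ltW eps0) //.
    by apply: du0_homo => //; lra.
  have n0 : 0 <= 2 * n%:R + 1 :> R by rewrite addr_ge0 // mulr_ge0.
  apply: (@le_trans _ _ (eps ^+ 2 * (eta ^+ 2 * (du0 p 2 / 2)))); last first.
    have -> : s1 * be = eps ^+ 2 * (eta ^+ 2 * (du0 p H / H)) by rewrite /s1 /be; ring.
    by rewrite !ler_wpM2l ?sqr_ge0.
  apply: (@le_trans _ _ (64 * (eps * du0 p 1) *
      ((2 * n%:R + 1) * eps ^+ 2 / (kappa p * (kappa p - 1))))).
    rewrite ler_wpM2r ?ler_wpM2l // divr_ge0 ?(ltW KK) // mulr_ge0 ?sqr_ge0 //.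
  have -> : 64 * (eps * du0 p 1) * ((2 * n%:R + 1) * eps ^+ 2 / (kappa p * (kappa p - 1)))
     = eps ^+ 2 * (64 * du0 p 1 * (2 * n%:R + 1) * eps / (kappa p * (kappa p - 1))).
    by ring.
  by rewrite ler_wpM2l ?sqr_ge0.
have Hin' x : sqd (cen k) x <= e ^+ 2 ->
    u0 p (x 0 k + a + s) + s1 * `|x 0 k + a + s| < u x 0 i1.
  move=> xe; have [x4 x1 x2] := near_cen xe; have := Hin x xe.
  move: (x 0 k + a) x1 x2 => t t1 t2.
  have ts0 : 0 <= t + s by lra.
  rewrite (ger0_norm ts0); apply: lt_le_trans.
  have tsH : t + s <= H by rewrite /H; lra.
  have ts2 : t + s <= 2 * h by lra.
  have d2 := du0_double hp (ltW h0) ts2.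
  have g1 := s1le _ ts0 tsH.
  have g2 : be * du0 p (t + s) <= (s / 2) * (2 * E).
    by apply: ler_pM; rewrite ?(ltW be0) ?du0_ge0.
  have tt : t <= t + s by rewrite lerDl ltW.
  have := u0_incr_le hp tt; rewrite addrAC subrr add0r => g3.
  have g4 : du0 p (t + s) * s <= 2 * E * s by rewrite ler_wpM2r // ltW.
  have Es : E * eps = 64 * (E * s) by rewrite /s; field.
  have Es0 : 0 < E * s by rewrite mulr_gt0.
  move: g1 g2 g3 g4; rewrite Es.
  move: (u0 p t) (u0 p (t + s)) (s1 * _) (be * _) (_ * s) => v1 v2 v3 v4 v5.
  by lra.
have cond : be + 2 * s <= 4^-1 + a by lra.
have Ae' : n%:R + 2 <= 2 * A * e ^+ 2 by have := Ae; lra.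
have main := lower_sliding hp hu A0 s0 be0 s10 cond Ae' Hini Hin'.
move=> y hy ya; have /andP[y32 y8] := small_ball_sqd k eta1 hy.
have yK : e ^+ 2 <= sqd (cen k) y <= 4^-1.
  by have e2 := sqr_radius_le; apply/andP; split; lra.
apply: le_trans (main y yK); rewrite /barrier.
set L := level _ _ _ _ _ _.
have Lge : y 0 k + (a + eta * eps) <= L.
  rewrite /L /level; have := gbump_near A0 y8; rewrite -(ler_pM2l s0) => hb.
  have : s * bump_gap A = 2 * be by rewrite /s /be; field.
  by rewrite /bump_gap mulrBr -/be; lra.
have L0 : 0 <= L by apply: le_trans Lge; rewrite -subr_ge0 in ya; rewrite opprK in ya.
apply: (le_trans (u0_homo hp Lge)).
by rewrite u0E lerDl mulr_ge0 // ltW.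
Qed.

(** Here [s * bump_gap A] equals [4 * be]: one [be] pays for raising the exponent, one for returning
    to kappa, and the remaining [2 * be] is the gain [eta * eps]. The bound [T] may grow with [b],
    since [nu] is chosen after it. *)
Lemma upper_improvement : 0 <= b -> A * eps <= 4 ->
  (forall x, sqd (cen k) x <= e ^+ 2 -> enorm (u x) <= u0 p (x 0 k + b) - E * eps / 8) ->
  forall y, eball 0 eta y -> enorm (u y) <= u0 p (y 0 k + (b - eta * eps)).
Proof.
move=> b0 Aeps Hin; have k1 := kappa_gt1 hp; have C0 := cp_gt0 hp.
have gap0 := bump_gap_gt0 A0; have gap1 := bump_gap_le1 A0.
have eps0 : 0 < eps by rewrite subr_gt0.
have h80 := h8; have ep16 := eps16.
pose s := eps / 64; pose be := eta * eps / 2; pose T := b + 3.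
have s0 : 0 < s by rewrite divr_gt0.
have eta0 : 0 < eta by rewrite divr_gt0.
have eta1 : eta <= 128^-1 by lra.
have be0 : 0 < be by rewrite divr_gt0 // mulr_gt0.
have bes : be <= s / 4.
  have : eta * eps <= 128^-1 * eps by rewrite ler_wpM2r // ltW.
  by rewrite /be /s; lra.
have s16 : s <= 1024^-1 by rewrite /s; lra.
have h0 : 0 < h by lra.
have E0 : 0 < E := du0_gt0 hp h0.
have rho0 : 0 < A * s * expR (- A * 4^-1) / 16.
  by rewrite divr_gt0 // mulr_gt0 ?expR_gt0 // mulr_gt0.
have G0 : 0 <= 1 + 4 * A + 4 * A ^+ 2.
  by rewrite !addr_ge0 // mulr_ge0 ?sqr_ge0 // ltW.
have T1 : 1 <= T by rewrite /T; lra.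
have be01 : 0 < be <= 1 by rewrite be0 /=; lra.
have [nu [nu0 nu2 hnu hex1 hex2]] := exists_exponent hp rho0 G0 T1 be01.
have s01 : 0 < s <= 16^-1 by rewrite s0 /=; lra.
have As : 16 * A * s <= 1.
  have -> : 16 * A * s = A * eps / 4 by rewrite /s; field.
  by lra.
have hT : 1 + b + be + 2 * s <= T by rewrite /T; lra.
have Hup' x : sqd (cen k) x <= 4^-1 -> enorm (u x) <= u0 p (x 0 k + b).
  by move=> /sqd_cen_le [Bx _ _]; exact: Hup.
have Hin' x : sqd (cen k) x <= e ^+ 2 -> enorm (u x) < u0 p (x 0 k + b - s).
  move=> xe; have [x4 x1 x2] := near_cen xe; apply: (le_lt_trans (Hin x xe)).
  have t2 : x 0 k + b <= 2 * h by lra.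
  have tt : x 0 k + b - s <= x 0 k + b by rewrite gerBl ltW.
  have := u0_incr_le hp tt; have -> : x 0 k + b - (x 0 k + b - s) = s by ring.
  have d2 := du0_double hp (ltW h0) t2.
  have g4 : du0 p (x 0 k + b) * s <= 2 * E * s by rewrite ler_wpM2r // ltW.
  have Es : E * eps = 64 * (E * s) by rewrite /s; field.
  have Es0 : 0 < E * s by rewrite mulr_gt0.
  move: g4; rewrite Es; move: (u0 p (_ - s)) (u0 p _) (_ * s) => v1 v2 v3.
  by lra.
have main := upper_sliding hp hu A0 s01 As be0 b0 Ae nu0 nu2 hT hnu hex1 Hup' Hin'.
move=> y hy; have /andP[y32 y8] := small_ball_sqd k eta1 hy.
have yK : e ^+ 2 <= sqd (cen k) y <= 4^-1.
  by have e2 := sqr_radius_le; apply/andP; split; lra.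
apply: (le_trans (main y yK)).
set L := level _ _ _ _ _ _; set k' := kappa p * (1 + nu) in nu2 hex2 *.
have Lle : L + be <= y 0 k + (b - eta * eps).
  rewrite /L /level; have := gbump_near A0 y8; rewrite -(ler_pM2l s0) => hb.
  have : s * bump_gap A = 4 * be by rewrite /s /be; field.
  have : eta * eps = 2 * be by rewrite /be; field.
  by rewrite /bump_gap mulrBr; lra.
apply: le_trans (u0_homo hp Lle); rewrite u0E ler_wpM2l ?(ltW C0) //.
have k'0 : k' != 0 by rewrite gt_eqF // mulr_gt0 //; lra.
have [L0|L0] := lerP L 0; first by rewrite (ppow_le0 k'0 L0) ppow_ge0.
rewrite !ppow_gt0E //; last by lra.
apply: hex2; rewrite (ltW L0) /=.
have [_ _] : [/\ eball 0 1 y, sqd 0 y <= 9 / 16 & `|y 0 k - 4^-1| <= 2^-1].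
  by apply: sqd_cen_le; case/andP: yK.
rewrite ler_norml => /andP[_ y2].
have : 0 < eta * eps by rewrite mulr_gt0.
by rewrite /T; lra.
Qed.

End UnitScale.

(** Only one of the two bounds improves, so the dichotomy at c decides which end of the interval
    moves. All constants are chosen before [u], [a] and [b]. *)
Lemma normalized_improvement {R : realType} (n m : nat) (p : R) :
  0 < p < 1 -> (0 < n)%N ->
  exists epsb eta : R, 0 < epsb /\ 0 < eta < 1 /\
  forall (u : 'rV[R]_n -> 'rV[R]_m) (k : 'I_n) (i1 : 'I_m) (a b : R),
    visc_sol p (eball 0 1) u -> a < b -> 0 <= b -> b - a <= epsb ->
    (forall y, eball 0 1 y -> enorm (u y) <= u0 p (y 0 k + b)) ->
    (forall y, eball 0 1 y -> - a <= y 0 k -> u0 p (y 0 k + a) <= u y 0 i1) ->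
    (forall y, eball 0 1 y -> forall i, i != i1 -> `|u y 0 i| <= (b - a) `^ (5 / 8)) ->
    (forall y, eball 0 eta y -> - (a + eta * (b - a)) <= y 0 k ->
       u0 p (y 0 k + (a + eta * (b - a))) <= u y 0 i1) \/
    (forall y, eball 0 eta y -> enorm (u y) <= u0 p (y 0 k + (b - eta * (b - a)))).
Proof.
move=> hp n0; have k1 := kappa_gt1 hp.
have n0R : 0 < n%:R :> R by rewrite ltr0n.
have n1 : 1 <= n%:R :> R by rewrite ler1n.
pose d : R := (32 * n%:R)^-1.
have d0 : 0 < d by rewrite invr_gt0 mulr_gt0.
have d32 : d <= 32^-1.
  by rewrite lef_pV2 ?posrE ?mulr_gt0 // -[leLHS]mulr1 ler_wpM2l.
pose X : R := n%:R * (n.+1%:R * 2 / d + 1050 * d).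
have X0 : 0 < X.
  apply: mulr_gt0 n0R _; apply: addr_gt0.
    by apply: divr_gt0 => //; apply: mulr_gt0; rewrite ltr0n.
  by apply: mulr_gt0; [rewrite ltr0n | exact: d0].
(* Chosen so that [e <= d] and [e * X <= 8^-1] hold together. *)
pose e := d / (1 + 8 * d * X).
have D1 : 0 < 8 * d * X by rewrite mulr_gt0 // mulr_gt0.
have D0 : 0 < 1 + 8 * d * X by rewrite addr_gt0.
have e0 : 0 < e by rewrite divr_gt0.
have ed : e <= d by rewrite ler_pdivrMr // ler_peMr ?(ltW d0) // lerDl ltW.
have e32 : e <= 32^-1 by exact: le_trans ed d32.
have eX : n%:R * (e * (n.+1%:R * 2 / d + 1050 * d)) <= 8^-1.
  rewrite mulrCA -/X /e mulrAC ler_pdivrMr //; lra.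
pose A : R := (n%:R + 3) / (2 * e ^+ 2).
have A0 : 0 < A.
  by apply: divr_gt0; [exact: addr_gt0 | apply: mulr_gt0 => //; exact: exprn_gt0].
have Ae : n%:R + 3 <= 2 * A * e ^+ 2.
  have -> : 2 * A * e ^+ 2 = n%:R + 3 by rewrite /A; field; rewrite gt_eqF.
  exact: lexx.
pose eta := bump_gap A / 128.
have gap0 := bump_gap_gt0 A0; have gap1 := bump_gap_le1 A0.
have KK : 0 < kappa p * (kappa p - 1).
  by rewrite mulr_gt0 ?(lt_trans ltr01 k1) // subr_gt0.
have du1 : 0 < du0 p 1 := du0_gt0 hp ltr01.
have du2 : 0 < du0 p 2 := du0_gt0 hp (ltr0Sn _ 1).
pose B := 64 * du0 p 1 * (2 * n%:R + 1).
have B0 : 0 < B.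
  by rewrite /B; apply: mulr_gt0; [exact: mulr_gt0 | rewrite addr_gt0 // mulr_gt0].
have eta0 : 0 < eta by rewrite divr_gt0.
have eta1 : eta < 1 by rewrite /eta ltr_pdivrMr //; lra.
pose c1 := eta ^+ 2 * (du0 p 2 / 2) * (kappa p * (kappa p - 1)) / B.
have c10 : 0 < c1.
  by rewrite divr_gt0 // mulr_gt0 // mulr_gt0 ?exprn_gt0 // divr_gt0.
have w0 : 0 < u0 p 16^-1 * du0 p 8^-1 by rewrite mulr_gt0 ?u0_gt0 ?du0_gt0.
pose th := u0 p 16^-1 * du0 p 8^-1 / (4 * m.+1%:R).
have th0 : 0 < th by rewrite divr_gt0 // mulr_gt0 // ltr0n.
(* The bounds serve, in order, the height of c above the lower profile, the slope condition on the
   upper barrier, the negative part of [u^1], and the smallness of the remaining components through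
   eps^(1/4) <= [th]. *)
have [epsb [ep0 ep1 ep2 ep3 ep4]] : exists epsb : R,
    [/\ 0 < epsb, epsb < 16^-1, epsb < 4 / A, epsb < c1 & epsb < th ^+ 4].
  near (0 : R)^'+ => epsb; exists epsb; split.
  - by near: epsb; exact: nbhs_right_gt.
  - by near: epsb; apply: nbhs_right_lt.
  - by near: epsb; apply: nbhs_right_lt; exact: divr_gt0.
  - by near: epsb; exact: nbhs_right_lt.
  - by near: epsb; apply: nbhs_right_lt; exact: exprn_gt0.
exists epsb, eta; split=> //; rewrite eta0 eta1; split=> //.
move=> u k i1 a b hu ab b0 hab Hup Hlow Hoth.
have eps0 : 0 < b - a by rewrite subr_gt0.
have eps16 : b - a <= 16^-1 by exact: le_trans hab (ltW ep1).
have h8 : 8^-1 <= 4^-1 + a by lra.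
have ded : 0 < e <= d by rewrite e0.
have [HA|HB] := dichotomy hp hu ab Hup Hlow h8 eps16 (erefl d) ded eX.
- left; apply: (lower_improvement hp hu ab Hup Hlow h8 eps16 e0 e32 A0 Ae _ HA).
  rewrite ler_pdivrMr // -/B -/eta -ler_pdivlMl // mulrC.
  exact: (le_trans hab (ltW ep3)).
- right; apply: (upper_improvement hp hu ab Hup h8 eps16 e0 e32 A0 Ae b0).
    by rewrite mulrC -ler_pdivlMr //; exact: (le_trans hab (ltW ep2)).
  move=> x xe; have [x4 x1 x2] := near_cen a e0 e32 xe.
  have [Bx _ _] := sqd_cen_le x4.
  have xa : - a <= x 0 k by lra.
  have Ux := Hlow x Bx xa.
  have U16 : u0 p 16^-1 <= u x 0 i1.
    by apply: le_trans Ux; apply: u0_homo => //; lra.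
  have E0 : 0 <= du0 p (4^-1 + a) := du0_ge0 hp _.
  (* Of the margin 3/8 given by the dichotomy, 1/4 may be lost in passing from [u^1] to |u|; the
     remaining 1/8 is what [upper_improvement] asks for. *)
  have ze0 : 0 <= du0 p (4^-1 + a) * (b - a) / 4.
    by rewrite divr_ge0 // mulr_ge0 // ltW.
  have hm : m%:R * (b - a) `^ (5 / 8) ^+ 2 <=
      2 * u0 p 16^-1 * (du0 p (4^-1 + a) * (b - a) / 4).
    have -> : (b - a) `^ (5 / 8) ^+ 2 = (b - a) * (b - a) `^ 4^-1.
      rewrite -powR_mulrn ?powR_ge0 // -powRrM.
      have -> : 5 / 8 * 2 = 1 + 4^-1 :> R by field.
      by rewrite (@powRD _ _ 1) ?(gt_eqF eps0) ?implybT // powRr1 // ltW.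
    have hth : (b - a) `^ 4^-1 <= th.
      have -> : th = (th ^+ 4) `^ 4^-1.
        by rewrite -powR_mulrn ?(ltW th0) // -powRrM divff ?powRr1 // ltW.
      apply: ge0_ler_powR; rewrite ?nnegrE ?invr_ge0 ?exprn_ge0 ?(ltW th0) ?(ltW eps0) //.
      exact: (le_trans hab (ltW ep4)).
    apply: (@le_trans _ _ ((b - a) * (m%:R * th))).
      rewrite mulrCA ler_wpM2l ?(ltW eps0) // ler_wpM2l //.
    apply: (@le_trans _ _ ((b - a) * (u0 p 16^-1 * du0 p 8^-1 / 4))).
      rewrite ler_wpM2l ?(ltW eps0) //.
      have -> : m%:R * th = u0 p 16^-1 * du0 p 8^-1 / 4 * (m%:R / m.+1%:R).
        have mp : m.+1%:R != 0 :> R by rewrite pnatr_eq0.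
        by rewrite /th; move: (m.+1%:R) mp => M mp; field.
      rewrite ler_piMr //.
        by rewrite divr_ge0 // ltW.
      by rewrite ler_pdivrMr ?ltr0n // mul1r ler_nat.
    have -> : 2 * u0 p 16^-1 * (du0 p (4^-1 + a) * (b - a) / 4) =
      (b - a) * (u0 p 16^-1 * du0 p (4^-1 + a) / 4) * 2 by ring.
    have u16 : 0 <= u0 p 16^-1 := u0_ge0 hp _.
    apply: (@le_trans _ _ ((b - a) * (u0 p 16^-1 * du0 p (4^-1 + a) / 4))).
      rewrite ler_wpM2l ?(ltW eps0) // ler_wpM2r // ler_wpM2l //.
      by apply: du0_homo.
    rewrite ler_peMr ?ler1n // mulr_ge0 ?(ltW eps0) // divr_ge0 //.
    exact: mulr_ge0.
  have := enorm_le_main (u0_ge0 hp _) U16 (Hoth x Bx) hm ze0.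
  have := HB x xe; move: (u0 p (x 0 k + b)) (enorm _) (u x 0 i1) => v1 v2 v3.
  by move: (du0 p _ * _) => v4; lra.
Unshelve. all: by end_near. Qed.

(** * Rescaling *)

Section Affine.
Context {R : realType} {n : nat} (q : 'rV[R]_n) (r C : R).
Implicit Types (x y z : 'rV[R]_n) (f : 'rV[R]_n -> R).

Definition aff y : 'rV[R]_n := q + r *: y.

Lemma aff_cont y : {for y, continuous aff}.
Proof.
apply: continuousD; first exact: cst_continuous.
by apply: continuousZr; exact: cvg_id.
Qed.

Lemma near_aff (P : 'rV[R]_n -> Prop) y :
  (\forall x \near aff y, P x) -> \forall z \near y, P (aff z).
Proof. exact: aff_cont. Qed.

Lemma is_derive_aff f y v l : is_derive (aff y) v f l ->
  is_derive y v (fun z => C * f (aff z)) (C * r * l).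
Proof.
move=> /is_derive_line h; apply: (iffRL (is_derive_line _ _ _ _)).
have h0 : is_derive (r * 0) 1 (fun t => f (aff y + t *: v)) l by rewrite mulr0.
have h1 := is_derive_scale C (is_derive_compR (F := fun t => f (aff y + t *: v))
  (g := fun t : R => r * t) h0 (is_derive_scale r (is_derive_idR (0 : R)))).
have -> : (fun t => C * f (aff (y + t *: v))) = fun t => C * f (aff y + (r * t) *: v).
  by apply/funext => t; rewrite /aff scalerDr addrA scalerA.
by apply: is_derive_eq h1 _; ring.
Qed.

Lemma partial_aff f y (i : 'I_n) : derivable f (aff y) (ebasis R i) ->
  partial i (fun z => C * f (aff z)) y = C * r * partial i f (aff y).
Proof.
move=> /derivableP /is_derive_aff h.
exact: (@derive_val _ _ _ _ _ _ _ h).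
Qed.

Lemma comp_aff_cont f y : {for aff y, continuous f} ->
  {for y, continuous (fun z => C * f (aff z))}.
Proof.
move=> cf; apply: continuousM; first exact: cst_continuous.
by apply: (@continuous_comp _ _ _ aff f); [exact: aff_cont | exact: cf].
Qed.

End Affine.

Section AffineC2.
Context {R : realType} {n : nat} (q : 'rV[R]_n) (r C : R).
Implicit Types (x y z : 'rV[R]_n) (f : 'rV[R]_n -> R).
Variables (U : set 'rV[R]_n) (f : 'rV[R]_n -> R).
Hypothesis openU : forall x, U x -> \forall y \near x, U y.
Local Notation V := [set y | U (aff q r y)].
Local Notation g := (fun z => C * f (aff q r z)).

Lemma near_partial_aff y (i : 'I_n) : C1on U f -> V y ->
  {near y, (fun z => C * r * partial i f (aff q r z)) =1 partial i g}.
Proof.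
move=> C1 Vy; have h := near_aff (openU Vy).
near=> z; rewrite partial_aff //.
have Uz : U (aff q r z) by near: z.
by have [_ /(_ i) []] := C1 _ Uz.
Unshelve. all: by end_near. Qed.

Lemma C1on_aff : C1on U f -> C1on V g.
Proof.
move=> C1 y Vy; have [cf df] := C1 _ Vy; split; first exact: comp_aff_cont.
move=> i; have [dfi cfi] := df i; split.
  by have [] := is_derive_aff C (derivableP dfi).
rewrite /prop_for /continuous_at partial_aff //.
apply: (cvg_trans (near_eq_cvg (near_partial_aff i C1 Vy))).
exact: comp_aff_cont cfi.
Qed.

Lemma partial2_aff y (i j : 'I_n) : C2on U f -> V y ->
  derivable (partial i g) y (ebasis R j) /\
  partial j (partial i g) y = C * r * r * partial j (partial i f) (aff q r y).
Proof.
move=> [C1 C2] Vy; have [d2 _] := C2 _ Vy i j.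
have h := near_eq_is_derive (near_partial_aff i C1 Vy)
  (is_derive_aff (C * r) (derivableP d2)).
by split; [have [] := h | exact: (@derive_val _ _ _ _ _ _ _ h)].
Qed.

Lemma C2on_aff : C2on U f -> C2on V g.
Proof.
move=> C2U; have [C1 C2] := C2U; split; first exact: C1on_aff.
move=> y Vy i j; have [h1 h2] := partial2_aff i j C2U Vy; split=> //.
rewrite /prop_for /continuous_at h2.
have e : {near y, (fun z => C * r * r * partial j (partial i f) (aff q r z)) =1
    partial j (partial i g)}.
  have h := near_aff (openU Vy).
  near=> z; have Vz : V z by near: z.
  by apply: esym; have [_ e2] := partial2_aff i j C2U Vz; exact: e2.
apply: (cvg_trans (near_eq_cvg e)).
by apply: comp_aff_cont; have [_] := C2 _ Vy i j.
Unshelve. all: by end_near. Qed.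

Lemma laplacian_aff y : C2on U f -> V y ->
  laplacian g y = C * r ^+ 2 * laplacian f (aff q r y).
Proof.
move=> C2U Vy; rewrite /laplacian mulr_sumr; apply: eq_bigr => i _.
have [_ e] := partial2_aff i i C2U Vy.
by apply: (etrans e); rewrite expr2 !mulrA.
Qed.

End AffineC2.

Section Rescale.
Context {R : realType} {n m : nat} (p : R) (u : 'rV[R]_n -> 'rV[R]_m).
Hypotheses (hp : 0 < p < 1) (hu : visc_sol p (eball 0 1) u).
Variables (q : 'rV[R]_n) (r : R).
Hypotheses (r0 : 0 < r) (qr : eball q r `<=` eball 0 1).
Implicit Types (x y z : 'rV[R]_n).
Local Notation B := (eball (0 : 'rV[R]_n) 1).
Local Notation kp := (kappa p).

(** The scaling that preserves the equation, since kappa (p - 2) = - 2. *)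
Definition rescale y : 'rV[R]_m := (r `^ kp)^-1 *: u (aff q r y).

Lemma rk_gt0 : 0 < r `^ kp. Proof. exact: powR_gt0. Qed.

Lemma enorm_rescale y : enorm (rescale y) = (r `^ kp)^-1 * enorm (u (aff q r y)).
Proof. by rewrite enormZ ger0_norm // invr_ge0 powR_ge0. Qed.

Lemma rescale_coord y (i : 'I_m) : rescale y 0 i = (r `^ kp)^-1 * u (aff q r y) 0 i.
Proof. by rewrite mxE. Qed.

Lemma eball_aff z d x : 0 < d -> eball (aff q r z) (r * d) (aff q r x) <-> eball z d x.
Proof.
move=> d0; rewrite /eball /= /aff opprD addrACA subrr add0r -scalerBr enormZ gtr0_norm //.
by rewrite ltr_pM2l.
Qed.

Lemma aff_ball y : B y -> B (aff q r y).
Proof.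
move=> /(eball_aff 0 y ltr01); rewrite mulr1 {1}/aff scaler0 addr0; exact: qr.
Qed.

Lemma posset_rescale y : posset B rescale y -> posset B u (aff q r y).
Proof.
move=> [/aff_ball By /= uy]; split=> //=.
by move: uy; rewrite enorm_rescale pmulr_rgt0 // invr_gt0 rk_gt0.
Qed.

Definition unaff x : 'rV[R]_n := aff (- (r^-1 *: q)) r^-1 x.

Lemma unaffK x : aff q r (unaff x) = x.
Proof.
rewrite /unaff /aff scalerDr scalerN !scalerA divff ?gt_eqF // !scale1r.
by rewrite addrA subrr add0r.
Qed.

Lemma affK y : unaff (aff q r y) = y.
Proof.
rewrite /unaff /aff scalerDr scalerA mulVf ?gt_eqF // scale1r addrA.
by rewrite (addrC _ (r^-1 *: q)) subrr add0r.
Qed.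

Lemma rescale_cont y : B y -> {for y, continuous rescale}.
Proof.
move=> /aff_ball /(u_cont hu) cu; apply: continuousZr.
by apply: (@continuous_comp _ _ _ (aff q r) u); [exact: aff_cont | exact: cu].
Qed.

(** The test function is carried back by the inverse affine map and multiplied by r^kappa; as kappa
    (p - 1) = kappa - 2, both sides of its strict inequality scale alike. *)
Lemma touched_below_rescale (f : 'rV[R]_m) z :
  touched_below p (fun x => dotp (rescale x) f) z ->
  touched_below p (fun x => dotp (u x) f) (aff q r z).
Proof.
move=> [phi [d [d0 [C1 [phiz [[i di] [C2 [lap [le e]]]]]]]]].
have rk := rk_gt0.
pose g x := r `^ kp * phi (unaff x).
have sub x : eball (aff q r z) (r * d) x -> eball z d (unaff x).
  by rewrite -{1}(unaffK x) => /(eball_aff z (unaff x) d0).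
have open1 x : eball z d x -> \forall y \near x, eball z d y by exact: near_eball.
have open2 x : (eball z d `&` [set y | phi y != 0]) x ->
    \forall y \near x, (eball z d `&` [set y | phi y != 0]) y.
  move=> [zx /= px]; have [cx _] := C1 x zx.
  have h1 := open1 x zx.
  have h2 : \forall y \near x, phi y != 0.
    move: px; rewrite neq_lt => /orP[px|px].
    - have h : \forall y \near x, phi y < 0 by exact: (@cvgr_lt _ _ _ _ _ _ cx _ px).
      by near=> y; rewrite lt_eqF //; near: y.
    - have h : \forall y \near x, 0 < phi y by exact: (@cvgr_gt _ _ _ _ _ _ cx _ px).
      by near=> y; rewrite gt_eqF //; near: y.
  by near=> y; split; near: y.
have gC1 := C1on_aff (q := - (r^-1 *: q)) (r := r^-1) (r `^ kp) open1 C1.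
have gC2 := C2on_aff (- (r^-1 *: q)) r^-1 (r `^ kp) open2 C2.
have gphi x : g x != 0 -> phi (unaff x) != 0.
  by apply: contraNneq => h; rewrite /g h mulr0.
have dotE x : dotp (u x) f = r `^ kp * dotp (rescale (unaff x)) f.
  rewrite /dotp mulr_sumr; apply: eq_bigr => j _.
  by rewrite rescale_coord unaffK mulrA mulrA mulfV ?mul1r // gt_eqF.
have zz : eball z d z by apply/(eballE _ _ (ltW d0)); rewrite sqdxx exprn_gt0.
exists g, (r * d); split; first exact: mulr_gt0.
split; first by move=> x /sub /gC1.
split; first by rewrite /g affK phiz mulr0.
split.
  exists i; rewrite /g partial_aff -/(unaff _) affK.
    by rewrite mulf_neq0 // mulf_neq0 ?invr_eq0 ?gt_eqF.
  by have [_ /(_ i) []] := C1 z zz.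
split.
  have [gC21 gC22] := gC2; split.
    by move=> x [/sub hx /= gx]; apply: gC21; split=> //; exact: gphi.
  by move=> x [/sub hx /= gx]; apply: gC22; split=> //; exact: gphi.
split; last split.
- move=> x hx gx; have hx' := sub x hx; have px := gphi x gx.
  rewrite (laplacian_aff (r `^ kp) open2) //.
  have := lap (unaff x) hx' px; rewrite -/(unaff x).
  rewrite -(@ltr_pM2l _ (r `^ kp * r^-1 ^+ 2)); last first.
    by rewrite mulr_gt0 // exprn_gt0 // invr_gt0.
  apply: le_lt_trans; rewrite /posrhs /g (pmulr_rgt0 _ rk).
  case: ifP => [p0|_]; last by rewrite mulr0.
  rewrite powRM ?(ltW p0) ?powR_ge0 // -powRrM.
  have -> : kp * (p - 1) = kp + - 2 by have := kappaM hp; lra.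
  rewrite (@powRD _ _ kp) ?(gt_eqF r0) ?implybT // powRN powR_mulrn ?(ltW r0) //.
  by rewrite exprVn.
- by move=> x hx; rewrite dotE ler_pM2l //; apply: le; exact: sub.
- by rewrite /g affK e [RHS]dotE affK.
Unshelve. all: by end_near. Qed.

Lemma visc_sol_rescale : visc_sol p B rescale.
Proof.
have rk := rk_gt0; have [_ [reg vis]] := hu.
split; first by move=> y; exact: rescale_cont.
split.
- move=> i; have [C2 lap] := reg i.
  have open x : posset B u x -> \forall y \near x, posset B u y by exact: (near_posset hu).
  have fE : (fun x => rescale x 0 i) = fun x => (r `^ kp)^-1 * u (aff q r x) 0 i.
    by apply/funext => x; rewrite rescale_coord.
  rewrite fE; have [gC1 gC2] := C2on_aff q r (r `^ kp)^-1 open C2.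
  split; first by split=> y /posset_rescale hy; [exact: gC1 | exact: gC2].
  move=> y /posset_rescale hy.
  have /= -> := laplacian_aff (r `^ kp)^-1 open C2 hy; rewrite lap //.
  rewrite enorm_rescale rescale_coord powRM ?enorm_ge0 ?invr_ge0 ?powR_ge0 //.
  have -> : (r `^ kp)^-1 `^ (p - 2) = r ^+ 2.
    by rewrite -powRN -powRrM mulNr (kappaMpB2 hp) opprK powR_mulrn // ltW.
  by rewrite [LHS]mulrAC; ring.
- move=> z [Bz [cz nz]] f /touched_below_rescale; apply: vis; split; first exact: aff_ball.
  split.
    move=> W /= nW; have [y [hy Wy]] := cz _ (aff_cont nW).
    by exists (aff q r y); split=> //; exact: posset_rescale.
  move=> /interior_subset [_ /= uz]; apply: nz.
  have vz : 0 < enorm (rescale z) by rewrite enorm_rescale mulr_gt0 // invr_gt0.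
  have h1 : \forall y \near z, B y by exact: near_eball.
  have h2 : \forall y \near z, 0 < enorm (rescale y).
    have cc : {for z, continuous (fun y => enorm (rescale y))}.
      exact: (continuous_comp (rescale_cont Bz) (@enorm_cont _ _ _)).
    exact: (@cvgr_gt _ _ _ _ _ _ cc _ vz).
  by rewrite /interior; near=> y; split; near: y.
Unshelve. all: by end_near. Qed.

End Rescale.

(** Here the position of [x0] enters: below the plane of the upper profile [u] would vanish near
    [x0], which would then be neither in the positivity set nor on the free boundary. After
    rescaling this is [0 <= b], which places c above the free boundary. *)
Lemma closure_height {R : realType} {n m : nat} (p : R) (u : 'rV[R]_n -> 'rV[R]_m)
    (x0 : 'rV[R]_n) (k : 'I_n) (r b : R) :
  0 < p < 1 -> 0 < r ->
  (posset (eball 0 1) u x0 \/ freebd (eball 0 1) u x0) ->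
  (forall y, eball x0 r y -> enorm (u y) <= u0 p (y 0 k + b)) ->
  0 <= x0 0 k + b.
Proof.
move=> hp r0 hx0 Hup; rewrite leNgt; apply/negP => neg.
have nx : \forall y \near x0, eball x0 r y.
  by apply: near_eball; apply/(eballE _ _ (ltW r0)); rewrite sqdxx exprn_gt0.
have nk : \forall y \near x0, (y : 'rV[R]_n) 0 k < - b.
  by apply: (@cvgr_lt _ _ _ _ _ _ (@coord_cont R n k x0)); rewrite -subr_gt0 in neg *;
    move: neg; rewrite sub0r opprD; lra.
have zero : \forall y \near x0, ~ posset (eball 0 1) u y.
  near=> y; move=> [_ /=]; apply/negP; rewrite -leNgt.
  have xy : eball x0 r y by near: y.
  have yk : y 0 k < - b by near: y.
  by apply: (le_trans (Hup y xy)); rewrite u0_le0 //; lra.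
case: hx0 => [h|[_ [cl _]]]; first exact: (nbhs_singleton zero).
by have [y [hy]] := cl _ zero; apply.
Unshelve. all: by end_near. Qed.

Unset Implicit Arguments.

Theorem theorem3p1 (R : realType) (n m : nat) (p : R) :
  (2 <= n)%N -> (1 <= m)%N -> 0 < p < 1 ->
  exists (epsb eta : R), 0 < epsb /\ 0 < eta < 1 /\
  forall (u : 'rV[R]_n -> 'rV[R]_m) (x0 : 'rV[R]_n) (r a0 b0 : R),
    visc_sol p (eball 0 1) u ->
    (posset (eball 0 1) u x0 \/ freebd (eball 0 1) u x0) ->
    0 < r -> eball x0 r `<=` eball 0 1 ->
    a0 <= b0 -> b0 - a0 <= epsb * r ->
    (forall y, eball x0 r y -> forall j : 'I_n, nat_of_ord j = n.-1 ->
       enorm (u y) <= u0 p (y 0 j + b0)) ->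
    (forall y, eball x0 r y -> forall j : 'I_n, nat_of_ord j = n.-1 ->
       - a0 <= y 0 j -> forall i : 'I_m, nat_of_ord i = 0%N ->
       u0 p (y 0 j + a0) <= u y 0 i) ->
    (forall y, eball x0 r y -> forall i : 'I_m, (1 <= nat_of_ord i)%N ->
       `|u y 0 i| <= r `^ (kappa p) * ((b0 - a0) / r) `^ (5 / 8)) ->
    exists a1 b1 : R,
      a0 <= a1 /\ a1 <= b1 /\ b1 <= b0 /\ b1 - a1 = (1 - eta) * (b0 - a0) /\
      (forall y, eball x0 (eta * r) y -> forall j : 'I_n, nat_of_ord j = n.-1 ->
         enorm (u y) <= u0 p (y 0 j + b1)) /\
      (forall y, eball x0 (eta * r) y -> forall j : 'I_n, nat_of_ord j = n.-1 ->
         - a1 <= y 0 j -> forall i : 'I_m, nat_of_ord i = 0%N ->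
         u0 p (y 0 j + a1) <= u y 0 i).
Proof.
move=> n2 m1 hp.
have n0 : (0 < n)%N by exact: ltn_trans n2.
have kp : (n.-1 < n)%N by rewrite prednK.
pose k : 'I_n := Ordinal kp; pose i1 : 'I_m := Ordinal m1.
have kE (j : 'I_n) : nat_of_ord j = n.-1 -> j = k by move=> jn; apply: val_inj.
have iE (i : 'I_m) : nat_of_ord i = 0%N -> i = i1 by move=> i0; apply: val_inj.
have [epsb [eta [ep0 [/andP[eta0 eta1] main]]]] := normalized_improvement m hp n0.
exists epsb, eta; split=> //; split; first by rewrite eta0.
move=> u x0 r a0 b0 hu hx0 r0 sub ab abe Hup Hlow Hoth.
have Hup' y : eball x0 r y -> enorm (u y) <= u0 p (y 0 k + b0).
  by move=> hy; exact: Hup.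
have small y : eball x0 (eta * r) y -> eball x0 r y.
  move=> hy; apply: lt_le_trans hy _; rewrite ger_pMl //; exact: ltW.
(* If the two profiles coincide there is nothing to gain, and the interval is kept. *)
move: ab; rewrite le_eqVlt => /orP[/eqP ab|ab].
  exists a0, b0; rewrite -ab lexx subrr mulr0; do 4 split=> //.
  split=> [y /small hy|y /small hy]; first by rewrite ab; exact: Hup.
  by move=> j jn ya i; exact: Hlow.
have bx := closure_height hp r0 hx0 Hup'.
have rk : 0 < r `^ kappa p := rk_gt0 p r0.
(* The new offsets are heights relative to the centre [x0], in units of [r]; the homogeneity of
   degree kappa of the profile makes the hypotheses match. *)
pose v := rescale p u x0 r; pose a := (x0 0 k + a0) / r; pose b := (x0 0 k + b0) / r.
have abE : b - a = (b0 - a0) / r by rewrite /a /b -mulrBl; congr (_ / _); ring.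
have vball y : eball 0 1 y -> eball x0 r (aff x0 r y).
  move=> /(eball_aff x0 r0 0 y ltr01).
  by rewrite mulr1 {1}/aff scaler0 addr0.
have affk y : aff x0 r y 0 k = x0 0 k + r * y 0 k by rewrite !mxE.
have profile (c : R) (y : 'rV[R]_n) : u0 p (y 0 k + (x0 0 k + c) / r) =
    (r `^ kappa p)^-1 * u0 p (aff x0 r y 0 k + c).
  have -> : aff x0 r y 0 k + c = r * (y 0 k + (x0 0 k + c) / r).
    by rewrite affk; field; rewrite gt_eqF.
  by rewrite u0M // mulrA mulVf ?mul1r // gt_eqF.
have := main v k i1 a b (visc_sol_rescale hp hu r0 sub); case.
- by rewrite -subr_gt0 abE divr_gt0 // subr_gt0.
- by rewrite divr_ge0 // ltW.
- by rewrite abE ler_pdivrMr.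
- move=> y /vball hy; rewrite profile enorm_rescale // ler_pM2l ?invr_gt0 //.
  exact: Hup'.
- move=> y /vball hy ya; rewrite profile rescale_coord ler_pM2l ?invr_gt0 //.
  apply: Hlow => //; rewrite affk.
  move: ya; rewrite /a -mulNr ler_pdivrMr // mulrC; lra.
- move=> y /vball hy i ii; rewrite rescale_coord normrM ger0_norm ?invr_ge0 ?powR_ge0 //.
  rewrite ler_pdivrMl // abE; apply: Hoth => //.
  by rewrite lt0n; apply: contraNneq ii => i0; apply/eqP/iE.
- move=> low; exists (a0 + eta * (b0 - a0)), b0.
  have e0 : 0 < eta * (b0 - a0) by rewrite mulr_gt0 // subr_gt0.
  have e1 : eta * (b0 - a0) <= b0 - a0 by rewrite ger_pMl ?subr_gt0 // ltW.
  split; first by rewrite lerDl ltW.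
  split; first by rewrite -lerBrDl.
  split=> //; split; first by ring.
  split=> [y /small hy|y hy j /kE -> ya i /iE ->]; first exact: Hup.
  have hy' : eball 0 eta (unaff x0 r y).
    apply/(eball_aff x0 r0 0 _ eta0).
    by rewrite unaffK // {1}/aff scaler0 addr0 mulrC.
  have aE : a + eta * (b - a) = (x0 0 k + (a0 + eta * (b0 - a0))) / r.
    by rewrite abE /a; field; rewrite gt_eqF.
  have := low _ hy'; rewrite aE profile rescale_coord unaffK // ler_pM2l ?invr_gt0 //.
  apply; rewrite -mulNr ler_pdivrMr //.
  by have := affk (unaff x0 r y); rewrite unaffK // mulrC => h; rewrite h in ya; lra.
- move=> up; exists a0, (b0 - eta * (b0 - a0)).
  have e0 : 0 < eta * (b0 - a0) by rewrite mulr_gt0 // subr_gt0.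
  have e1 : eta * (b0 - a0) <= b0 - a0 by rewrite ger_pMl ?subr_gt0 // ltW.
  split=> //; split; first by rewrite lerBrDl -lerBrDr.
  split; first by rewrite gerBl ltW.
  split; first by ring.
  split=> [y hy j /kE ->|y /small hy j jn ya i]; last exact: Hlow.
  have hy' : eball 0 eta (unaff x0 r y).
    apply/(eball_aff x0 r0 0 _ eta0).
    by rewrite unaffK // {1}/aff scaler0 addr0 mulrC.
  have bE : b - eta * (b - a) = (x0 0 k + (b0 - eta * (b0 - a0))) / r.
    by rewrite abE /b; field; rewrite gt_eqF.
  have := up _ hy'; rewrite bE profile enorm_rescale // unaffK // ler_pM2l ?invr_gt0 //.
Qed.
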